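(* Assume that each $f_i:\mathbb{R}^d\to\mathbb{R}$ ($i=1,\dots,N$) is three times continuously differentiable with bounded third derivative and is $L$-smooth, and that $\sigma_*^2:=\sup_{x\in\mathbb{R}^d}\|\sigma_{\mathrm{MB}}(x)\sigma_{\mathrm{MB}}(x)^T\|_S<\infty$. Assume also that $f$ is weakly-quasi-convex: there is $\tau>0$ such that $\langle\nabla f(x),x-x^\star\rangle\ge\tau(f(x)-f(x^\star))$ for all $x\in\mathbb{R}^d$. Let $\{X(t)\}_{t\ge 0}$ be the solution to the MB-PGF equation $$dX(t)=-\psi(t)\nabla f(X(t))\,dt+\psi(t)\sqrt{h/b(t)}\,\sigma_{\mathrm{MB}}(X(t))\,dB(t),\qquad X(0)=x_0 .$$ Let $t>0$ and let $\tilde t\in[0,t]$ be a random time point (drawn independently of the process $X$) with probability density $s\mapsto\psi(s)/\varphi(t)$ on $[0,t]$ (and $0$ otherwise). Then $$\mathbb{E}\left[f(X(\tilde t))-f(x^\star)\right]\le\frac{\|x_0-x^\star\|^2}{2\,\tau\,\varphi(t)}+\frac{h\,d\,\sigma_*^2}{2\,\tau\,\varphi(t)}\int_0^t\frac{\psi(s)^2}{b(s)}\,ds$$ and $$\mathbb{E}\left[f(X(t))-f(x^\star)\right]\le\frac{\|x_0-x^\star\|^2}{2\,\tau\,\varphi(t)}+\frac{h\,d\,\sigma_*^2}{2\,\tau\,\varphi(t)}\int_0^t\bigl(L\,\tau\,\varphi(s)+1\bigr)\frac{\psi(s)^2}{b(s)}\,ds .$$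
   Context: $f_1,\dots,f_N:\mathbb{R}^d\to\mathbb{R}$, $f:=\frac1N\sum_{i=1}^N f_i$, and $x^\star\in\mathbb{R}^d$ is a global minimizer of $f$. A differentiable function $g$ is $L$-smooth if $\|\nabla g(x)-\nabla g(y)\|\le L\|x-y\|$ for all $x,y$. $\|\cdot\|$ is the Euclidean norm and $\|\cdot\|_S$ the spectral norm. The constant $h>0$ is the discretization stepsize. The adjustment function $\psi:[0,\infty)\to[0,1]$ is continuously differentiable, non-increasing, with $\psi(0)=1$; $\varphi(t):=\int_0^t\psi(s)\,ds$. The mini-batch size function $b:[0,\infty)\to(0,\infty)$ is continuously differentiable with $b(t)\ge 1$. The volatility $\sigma_{\mathrm{MB}}(x):=\Sigma_{\mathrm{MB}}(x)^{1/2}$ is the principal (positive semidefinite) square root of $$\Sigma_{\mathrm{MB}}(x):=\frac1N\sum_{i=1}^N(\nabla f(x)-\nabla f_i(x))(\nabla f(x)-\nabla f_i(x))^T .$$ $\{B(t)\}_{t\ge0}$ is a $d$-dimensional Brownian motion on a filtered probability space, and $x_0\in\mathbb{R}^d$ is a deterministic initial condition. *)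

(* Defs.v *)
From HB Require Import structures.
From mathcomp Require Import all_boot all_order all_algebra.
From mathcomp Require Import all_classical all_reals all_analysis.

Set Implicit Arguments.
Unset Strict Implicit.
Unset Printing Implicit Defensive.

Import Order.TTheory GRing.Theory Num.Theory.
Import numFieldNormedType.Exports.

Local Open Scope classical_set_scope.
Local Open Scope ring_scope.

(* Points of R^d are column vectors. *)

(* The library norm on matrices is the sup norm (same topology); [enorm] is the
   Euclidean norm on 'cV_d and the Frobenius norm on general matrices. *)
Definition enorm (R : realType) (m n : nat) (A : 'M[R]_(m, n)) : R :=
  Num.sqrt (\sum_i \sum_j A i j ^+ 2).

Definition dot (R : realType) (d : nat) (u v : 'cV[R]_d) : R :=
  \sum_i u i 0 * v i 0.

Definition spectral_norm (R : realType) (d : nat) (A : 'M[R]_d) : R :=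
  sup [set enorm (A *m u) | u in [set u : 'cV[R]_d | enorm u <= 1]].

Definition is_psd (R : realType) (d : nat) (A : 'M[R]_d) : Prop :=
  A^T = A /\ forall u : 'cV[R]_d, 0 <= dot u (A *m u).

(* For a positive semidefinite S the set below is a singleton; the default
   value 0 is only relevant for other S. *)
Definition principal_sqrt (R : realType) (d : nat) (S : 'M[R]_d) : 'M[R]_d :=
  xget 0 [set A : 'M[R]_d | is_psd A /\ A *m A = S].

Definition grad (R : realType) (d : nat) (g : 'cV[R]_d -> R) (x : 'cV[R]_d) :
    'cV[R]_d :=
  \col_i 'D_(delta_mx i 0) g x.

(* Dg is C^k as a map into the finite-dimensional space of linear forms iff
   x |-> Dg(x) v is C^k for every direction v. *)
Fixpoint Ck (R : realType) (d : nat) (k : nat) (g : 'cV[R]_d -> R) : Prop :=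
  if k is k'.+1 then
    (forall x, differentiable g x) /\
    (forall v : 'cV[R]_d, Ck k' (fun x => 'D_v g x))
  else continuous g.

Definition bounded_third_derivative (R : realType) (d : nat)
    (g : 'cV[R]_d -> R) : Prop :=
  exists M : R, forall x u v w : 'cV[R]_d,
    `|'D_u (fun y => 'D_v (fun z => 'D_w g z) y) x|
      <= M * enorm u * enorm v * enorm w.

Definition L_smooth (R : realType) (d : nat) (L : R) (g : 'cV[R]_d -> R) :
    Prop :=
  (forall x, differentiable g x) /\
  (forall x y, enorm (grad g x - grad g y) <= L * enorm (x - y)).

Definition average (R : realType) (d N : nat) (f_ : 'I_N -> 'cV[R]_d -> R)
    (x : 'cV[R]_d) : R :=
  N%:R^-1 * \sum_(i < N) f_ i x.

Definition SigmaMB (R : realType) (d N : nat) (f_ : 'I_N -> 'cV[R]_d -> R)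
    (x : 'cV[R]_d) : 'M[R]_d :=
  N%:R^-1 *: \sum_(i < N)
    ((grad (average f_) x - grad (f_ i) x) *m
     (grad (average f_) x - grad (f_ i) x)^T).

Definition sigmaMB (R : realType) (d N : nat) (f_ : 'I_N -> 'cV[R]_d -> R)
    (x : 'cV[R]_d) : 'M[R]_d :=
  principal_sqrt (SigmaMB f_ x).

Definition volatility_norms (R : realType) (d N : nat)
    (f_ : 'I_N -> 'cV[R]_d -> R) : set R :=
  [set spectral_norm (sigmaMB f_ x *m (sigmaMB f_ x)^T) | x in [set: 'cV[R]_d]].

Definition sigma_star2 (R : realType) (d N : nat)
    (f_ : 'I_N -> 'cV[R]_d -> R) : R :=
  sup (volatility_norms f_).

Definition weakly_quasi_convex (R : realType) (d : nat) (tau : R)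
    (g : 'cV[R]_d -> R) (xstar : 'cV[R]_d) : Prop :=
  forall x, tau * (g x - g xstar) <= dot (grad g x) (x - xstar).

(* Functions on [0, +oo[ are represented by functions on R whose values at
   negative arguments are irrelevant; at 0 the derivative is one-sided. *)
Definition C1_nonneg (R : realType) (g : R -> R) : Prop :=
  exists2 g' : R -> R,
    {within `[0, +oo[, continuous g'} &
    forall x : R, 0 <= x ->
      (fun y => (g y - g x) / (y - x)) @ within `[0, +oo[ (x^') --> g' x.

Definition adjustment_function (R : realType) (psi : R -> R) : Prop :=
  [/\ C1_nonneg psi,
      (forall s, 0 <= s -> 0 <= psi s <= 1),
      (forall s t, 0 <= s -> s <= t -> psi t <= psi s) &
      psi 0 = 1].

Definition batch_size_function (R : realType) (b : R -> R) : Prop :=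
  C1_nonneg b /\ (forall s, 0 <= s -> 1 <= b s).

Definition phi (R : realType) (psi : R -> R) (t : R) : R :=
  \int[lebesgue_measure]_(s in `[0, t]) psi s.

Definition measurable_wrt (R : realType) (T : Type) (G : set (set T))
    (Y : T -> R) : Prop :=
  preimage_set_system setT Y measurable `<=` G.

(* The sigma-algebra generated by the real random variables Y i, i in D. *)
Definition sigma_generated (R : realType) (T I : Type) (D : set I)
    (Y : I -> T -> R) : set (set T) :=
  <<s \bigcup_(i in D) preimage_set_system setT (Y i) measurable >>.

Definition independent (R : realType) (disp : measure_display)
    (T : measurableType disp) (P : probability T R) (G H : set (set T)) : Prop :=
  forall A B, G A -> H B -> P (A `&` B) = (P A * P B)%E.

Definition filtration (R : realType) (disp : measure_display)
    (T : measurableType disp) (F : R -> set (set T)) : Prop :=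
  [/\ (forall s, 0 <= s -> sigma_algebra setT (F s)),
      (forall s, 0 <= s -> F s `<=` measurable) &
      (forall s t, 0 <= s -> s <= t -> F s `<=` F t)].

Definition adapted (R : realType) (T : Type) (m n : nat)
    (F : R -> set (set T)) (X : R -> T -> 'M[R]_(m, n)) : Prop :=
  forall s, 0 <= s -> forall i j, measurable_wrt (F s) (fun w => X s w i j).

Definition continuous_paths (R : realType) (T : Type) (m n : nat)
    (X : R -> T -> 'M[R]_(m, n)) : Prop :=
  forall w, {within `[0, +oo[, continuous (fun s => X s w)}.

Definition brownian_motion (R : realType) (disp : measure_display)
    (T : measurableType disp) (P : probability T R) (F : R -> set (set T))
    (d : nat) (B : R -> T -> 'cV[R]_d) : Prop :=
  [/\ adapted F B,
      continuous_paths B,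
      {ae P, forall w, B 0 w = 0},
      (forall s t, 0 <= s -> s < t ->
        independent P (F s)
          (sigma_generated setT
            (fun (i : 'I_d) w => (B t w - B s w) i 0))) &
      (* B t - B s has law N(0, (t - s) I_d); the last parameter of
         normal_prob is the standard deviation *)
      (forall s t, 0 <= s -> s < t ->
        forall A : 'I_d -> set R, (forall i, measurable (A i)) ->
        P [set w | forall i, A i ((B t w - B s w) i 0)] =
        (\prod_(i < d) normal_prob 0 (Num.sqrt (t - s)) (A i))%E)].

(* The process sum_(k < n) xi_k 1_(]t_k, t_(k+1)]), with t = [sp_time],
   xi = [sp_val] and n = [sp_size]. *)
Record simple_process (R : realType) (T : Type) (d : nat) := SimpleProcess {
  sp_size : nat ;
  sp_time : nat -> R ;
  sp_val : nat -> T -> 'M[R]_d }.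

Definition is_simple (R : realType) (T : Type) (d : nat)
    (F : R -> set (set T)) (t : R) (S : simple_process R T d) : Prop :=
  [/\ sp_time S 0 = 0, sp_time S (sp_size S) = t,
      (forall k, (k < sp_size S)%N -> sp_time S k < sp_time S k.+1),
      (forall k, (k < sp_size S)%N ->
        forall i j, measurable_wrt (F (sp_time S k))
                      (fun w => sp_val S k w i j)) &
      (exists M : R, forall k, (k < sp_size S)%N ->
        forall w, enorm (sp_val S k w) <= M)].

Definition sp_eval (R : realType) (T : Type) (d : nat)
    (S : simple_process R T d) (s : R) (w : T) : 'M[R]_d :=
  \sum_(k < sp_size S | sp_time S k < s <= sp_time S k.+1) sp_val S k w.

Definition sp_integral (R : realType) (T : Type) (d : nat)
    (S : simple_process R T d) (B : R -> T -> 'cV[R]_d) (w : T) : 'cV[R]_d :=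
  \sum_(k < sp_size S)
    sp_val S k w *m (B (sp_time S k.+1) w - B (sp_time S k) w).

(* H belongs to the space of jointly measurable adapted processes on [0, t]
   that are square-integrable for dt x P. *)
Definition ito_integrable (R : realType) (disp : measure_display)
    (T : measurableType disp) (P : probability T R) (F : R -> set (set T))
    (d : nat) (t : R) (H : R -> T -> 'M[R]_d) : Prop :=
  [/\ (forall i j, measurable_fun (`[0, t] `*` [set: T])
         (fun p : measurableTypeR R * T => H p.1 p.2 i j)),
      (forall s, 0 <= s <= t ->
         forall i j, measurable_wrt (F s) (fun w => H s w i j)) &
      (\int[P]_w \int[lebesgue_measure]_(s in `[0%R, t])
         (enorm (H s w) ^+ 2)%:E < +oo)%E].

(* I is (a version of) the Ito integral of H dB over [0, t]: the L^2 limit of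
   the integrals of simple processes converging to H in L^2(dt x P). By the Ito
   isometry I does not depend, up to a null set, on the approximation S. *)
Definition is_ito_integral (R : realType) (disp : measure_display)
    (T : measurableType disp) (P : probability T R) (F : R -> set (set T))
    (d : nat) (B : R -> T -> 'cV[R]_d) (t : R) (H : R -> T -> 'M[R]_d)
    (I : T -> 'cV[R]_d) : Prop :=
  [/\ ito_integrable P F t H,
      (forall i, measurable_fun [set: T] (fun w => I w i 0)) &
      exists S : nat -> simple_process R T d,
        [/\ (forall n, is_simple F t (S n)),
            (fun n => \int[P]_w \int[lebesgue_measure]_(s in `[0%R, t])
               (enorm (sp_eval (S n) s w - H s w) ^+ 2)%:E)%E
              @ \oo --> 0%E &
            (fun n => \int[P]_w
               (enorm (sp_integral (S n) B w - I w) ^+ 2)%:E)%E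
              @ \oo --> 0%E]].

Definition lebesgue_integral_vec (R : realType) (d : nat) (t : R)
    (g : R -> 'cV[R]_d) : 'cV[R]_d :=
  \col_i (\int[lebesgue_measure]_(s in `[0, t]) g s i 0).

(* dX = mu(t, X) dt + vol(t, X) dB, X(0) = x0, on [0, +oo[. *)
Definition sde_solution (R : realType) (disp : measure_display)
    (T : measurableType disp) (P : probability T R) (F : R -> set (set T))
    (d : nat) (B : R -> T -> 'cV[R]_d)
    (mu : R -> 'cV[R]_d -> 'cV[R]_d) (vol : R -> 'cV[R]_d -> 'M[R]_d)
    (x0 : 'cV[R]_d) (X : R -> T -> 'cV[R]_d) : Prop :=
  [/\ adapted F X,
      continuous_paths X,
      {ae P, forall w, X 0 w = x0} &
      forall t, 0 <= t ->
        exists2 I : T -> 'cV[R]_d,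
          is_ito_integral P F B t (fun s w => vol s (X s w)) I &
          {ae P, forall w, X t w =
             x0 + lebesgue_integral_vec t (fun s => mu s (X s w)) + I w}].

Definition mb_pgf_solution (R : realType) (disp : measure_display)
    (T : measurableType disp) (P : probability T R) (F : R -> set (set T))
    (d N : nat) (B : R -> T -> 'cV[R]_d) (f_ : 'I_N -> 'cV[R]_d -> R)
    (h : R) (psi b : R -> R) (x0 : 'cV[R]_d) (X : R -> T -> 'cV[R]_d) : Prop :=
  sde_solution P F B
    (fun s x => - psi s *: grad (average f_) x)
    (fun s x => (psi s * Num.sqrt (h / b s)) *: sigmaMB f_ x)
    x0 X.

Definition process_sigma_algebra (R : realType) (T : Type) (d : nat)
    (X : R -> T -> 'cV[R]_d) : set (set T) :=
  sigma_generated [set p : R * 'I_d | 0 <= p.1] (fun p w => X p.1 w p.2 0).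

Definition has_density (R : realType) (disp : measure_display)
    (T : measurableType disp) (P : probability T R) (Y : {RV P >-> R})
    (p : R -> R) : Prop :=
  forall A : set R, measurable A ->
    distribution P Y A = (\int[lebesgue_measure]_(s in A) (p s)%:E)%E.

(* Main.v *)
Require Import Defs.
From HB Require Import structures.
From mathcomp Require Import all_boot all_order all_algebra.
From mathcomp Require Import all_classical all_reals all_analysis.
From mathcomp Require Import measurable_realfun real_interval.
From mathcomp Require Import ring lra.

(** Write f for the average of the f_i, x_opt for its minimizer,
    u(r) = E[f(X_r) - f(x_opt)] and c = h d sigma_*^2. The theorem follows from
    two estimates of expectations along the flow, for 0 <= s <= t:
<<
      u(t) <= u(s) + (L c / 2) int_s^t psi^2/b
      tau int_0^t psi u <= |x0 - x_opt|^2 / 2 + (c / 2) int_0^t psi^2/b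
>>
    They are what Ito's formula gives for f - f(x_opt) and |x - x_opt|^2 / 2.
    Here they are two instances of [energy_inequality], which is proved by
    summing one-step estimates. If g has gradient G and satisfies the descent
    inequality
    g(y) <= g(x) + <G(x), y - x> + K/2 |y - x|^2, then over a step [s, t] the
    displacement is a drift plus a noise increment J. The noise enters only
    through E<G(X_s), J> <= 0 and through E|J|^2, which is at most the integral
    over [s, t] of any bound of the squared Frobenius norm of the volatility
    ([ito_increment_orthogonal], [ito_increment_energy]); the drift gives the
    dissipation int psi <G(X), grad f(X)> up to an error that is o(t - s)
    uniformly, and [le_of_local_increments] removes the error by refining the
    partition. For the first estimate G = grad f and the dissipation is
    nonnegative; for the second one G(x) = x - x_opt, and weak quasi-convexity
    bounds the dissipation below by tau (f - f(x_opt)). The squared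
    Frobenius norm of a matrix A is at most d times the spectral norm of A A^T
    ([frobenius_spectral]), whence the constant c.

    The stochastic integral is a limit in L^2 of integrals of simple processes,
    and the approximations chosen for different final times are unrelated. An
    increment I_t - I_s is therefore compared with the integral over the part
    after s of a simple process for [0, t]; what happens before s is small
    because two approximations of the same integrand are close there. This
    rests on the isometry for simple processes ([ge0_family_isometry]), hence on
    the first two moments of Gaussian increments and on the product rule for
    independent random variables.

    Finiteness of the second moments on bounded intervals is not part of the
    notion of solution. It comes from Gronwall's inequality, used path by path
    ([integral_gronwall], [second_moment_bound]).

    For the iterate at a random time, the time is rounded up to a grid: on each
    cell, independence factors the expectation, the first estimate bounds the
    value at the right end point by the values in the cell, and Fatou's lemma
    removes the rounding ([expectation_random_time]). The result is at most
    the average of u with weight psi, which the second estimate bounds. For the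
    last iterate, averaging the first estimate against psi gives phi(t) u(t) in
    terms of the same average and of a double integral over s <= r <= t
    ([last_value_le], [integral_triangle]). *)

Set Implicit Arguments.
Unset Strict Implicit.
Unset Printing Implicit Defensive.
Import Order.TTheory GRing.Theory Num.Theory.
Import numFieldNormedType.Exports.

Local Open Scope classical_set_scope.
Local Open Scope ring_scope.

(** * Euclidean geometry, spectral norm and smooth functions *)

Section Euclid.
Context {R : realType} {d : nat}.
Implicit Types u v w : 'cV[R]_d.

Lemma dotC u v : dot u v = dot v u.
Proof. by apply: eq_bigr => i _; rewrite mulrC. Qed.

Lemma dotDl u v w : dot (u + v) w = dot u w + dot v w.
Proof. by rewrite -big_split; apply: eq_bigr => i _; rewrite mxE mulrDl. Qed.

Lemma dotZl a u v : dot (a *: u) v = a * dot u v.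
Proof. by rewrite /dot mulr_sumr; apply: eq_bigr => i _; rewrite mxE mulrA. Qed.

Lemma dotNl u v : dot (- u) v = - dot u v.
Proof. by rewrite -scaleN1r dotZl mulN1r. Qed.

Lemma dotDr u v w : dot u (v + w) = dot u v + dot u w.
Proof. by rewrite dotC dotDl !(dotC u). Qed.

Lemma dotZr a u v : dot u (a *: v) = a * dot u v.
Proof. by rewrite dotC dotZl dotC. Qed.

Lemma dotNr u v : dot u (- v) = - dot u v.
Proof. by rewrite dotC dotNl dotC. Qed.

Definition dotE := (dotDl, dotDr, dotZl, dotZr, dotNl, dotNr).

Lemma dot_ge0 u : 0 <= dot u u.
Proof. by apply: sumr_ge0 => i _; rewrite -expr2 sqr_ge0. Qed.

Lemma enorm_sqr u : enorm u ^+ 2 = dot u u.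
Proof.
rewrite /enorm sqr_sqrtr; last first.
  by apply: sumr_ge0 => i _; apply: sumr_ge0 => j _; rewrite sqr_ge0.
by apply: eq_bigr => i _; rewrite big_ord1 expr2.
Qed.

Lemma enorm_ge0 m n (A : 'M[R]_(m, n)) : 0 <= enorm A.
Proof. exact: sqrtr_ge0. Qed.

Lemma dot_eq0 u : dot u u = 0 -> u = 0.
Proof.
move=> /eqP; rewrite psumr_eq0; last by move=> i _; rewrite -expr2 sqr_ge0.
move=> /allP u0; apply/matrixP => i j; rewrite ord1 mxE; apply/eqP.
by have := u0 i (mem_index_enum _); rewrite -expr2 sqrf_eq0.
Qed.

Lemma cauchy_schwarz u v : dot u v <= enorm u * enorm v.
Proof.
have [->|u0] := eqVneq u 0.
  by rewrite /dot big1 ?mulr_ge0 ?enorm_ge0// => i _; rewrite mxE mul0r.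
have [->|v0] := eqVneq v 0.
  by rewrite /dot big1 ?mulr_ge0 ?enorm_ge0// => i _; rewrite mxE mulr0.
have enorm_gt0 w : w != 0 -> 0 < enorm w.
  move=> w0; rewrite lt_neqAle enorm_ge0 andbT eq_sym; apply: contra w0.
  by move=> /eqP e0; rewrite (dot_eq0 (u := w))// -enorm_sqr e0 expr0n.
have := dot_ge0 (enorm v *: u - enorm u *: v).
rewrite !dotE -!enorm_sqr (dotC v u).
have := mulr_gt0 (enorm_gt0 _ u0) (enorm_gt0 _ v0).
move: (enorm u) (enorm v) (dot u v) => a b c ab0 H.
rewrite -(ler_pM2l ab0); nra.
Qed.

Lemma young e u v : 0 < e -> 2 * dot u v <= e * dot u u + e^-1 * dot v v.
Proof.
move=> e0; have := dot_ge0 (e *: u - v).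
rewrite !dotE (dotC v u) => H.
rewrite -(ler_pM2l e0) mulrDr !mulrA mulfV ?gt_eqF// mul1r; nra.
Qed.

Lemma enormD u v : enorm (u + v) <= enorm u + enorm v.
Proof.
rewrite -(ler_pXn2r (n := 2)) ?nnegrE ?enorm_ge0 ?addr_ge0 ?enorm_ge0//.
rewrite enorm_sqr !dotE (dotC v u) -!enorm_sqr.
have := cauchy_schwarz u v; nra.
Qed.

Lemma dot_sqrD e u v : 0 < e ->
  dot (u + v) (u + v) <= (1 + e^-1) * dot u u + (1 + e) * dot v v.
Proof.
move=> e0; rewrite !dotE (dotC v u).
have := @young e v u e0; rewrite (dotC v u); lra.
Qed.

Lemma enormZ a u : enorm (a *: u) = `|a| * enorm u.
Proof.
apply: (@pexpIrn _ 2) => //; rewrite ?nnegrE ?mulr_ge0 ?enorm_ge0//.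
by rewrite exprMn !enorm_sqr real_normK ?num_real// !dotE mulrA expr2.
Qed.

Lemma enorm_sum I (r : seq I) (F : I -> 'cV[R]_d) :
  enorm (\sum_(i <- r) F i) <= \sum_(i <- r) enorm (F i).
Proof.
elim/big_rec2: _ => [|i a u _ ua]; last exact: le_trans (enormD _ _) (lerD _ ua).
by rewrite -(scale0r 0) enormZ normr0 mul0r.
Qed.

End Euclid.

Section Spectral.
Context {R : realType} {d : nat}.

Lemma frobenius_sqr m n (A : 'M[R]_(m, n)) : enorm A ^+ 2 = \sum_i \sum_j A i j ^+ 2.
Proof.
rewrite sqr_sqrtr//.
by apply: sumr_ge0 => i _; apply: sumr_ge0 => j _; rewrite sqr_ge0.
Qed.

(** Splitting with the weights 1 + 1/e and 1 + e, rather than 2 and 2, loses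
    nothing in the limit when the energy of A is of smaller order than e. *)
Lemma enorm_sqrD m n e (A C : 'M[R]_(m, n)) : 0 < e ->
  enorm (A + C) ^+ 2 <= (1 + e^-1) * enorm A ^+ 2 + (1 + e) * enorm C ^+ 2.
Proof.
move=> e0; rewrite !frobenius_sqr !mulr_sumr -big_split; apply: ler_sum => i _ /=.
rewrite !mulr_sumr -big_split; apply: ler_sum => j _ /=; rewrite mxE.
move: (A i j) (C i j) => x y.
have H : 0 <= e^-1 * (x - e * y) ^+ 2 by rewrite mulr_ge0 ?sqr_ge0// invr_ge0 ltW.
rewrite -subr_ge0; apply: le_trans H _; rewrite le_eqVlt; apply/orP; left; apply/eqP.
by field; rewrite gt_eqF.
Qed.

Lemma entry_le_enorm m n (A : 'M[R]_(m, n)) i j : `|A i j| <= enorm A.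
Proof.
rewrite -(ler_pXn2r (n := 2)) ?nnegrE ?enorm_ge0// real_normK ?num_real//.
rewrite frobenius_sqr (bigD1 i)//= (bigD1 j)//= -addrA lerDl.
by rewrite addr_ge0 ?sumr_ge0// => *; rewrite ?sumr_ge0 ?sqr_ge0// => *; rewrite sqr_ge0.
Qed.

Lemma cauchy_schwarz_sqr (u v : 'cV[R]_d) : dot u v ^+ 2 <= dot u u * dot v v.
Proof.
have h1 := cauchy_schwarz u v.
have h2 := cauchy_schwarz (- u) v.
have e1 : enorm (- u) = enorm u by rewrite -scaleN1r enormZ normrN1 mul1r.
rewrite dotNl e1 in h2.
rewrite -!enorm_sqr -exprMn -[leLHS]real_normK ?num_real// ler_pXn2r ?nnegrE//.
  by rewrite ler_norml; apply/andP; split; lra.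
by rewrite mulr_ge0 ?enorm_ge0.
Qed.

Lemma enorm_mulmx (A : 'M[R]_d) (u : 'cV[R]_d) :
  enorm (A *m u) <= enorm A * enorm u.
Proof.
rewrite -(ler_pXn2r (n := 2)) ?nnegrE ?mulr_ge0 ?enorm_ge0//.
rewrite exprMn (frobenius_sqr A) !enorm_sqr mulr_suml; apply: ler_sum => i _.
have -> : \sum_j A i j ^+ 2 = dot (\col_j A i j) (\col_j A i j).
  by apply: eq_bigr => j _; rewrite !mxE expr2.
have -> : (A *m u) i 0 = dot (\col_j A i j) u.
  by rewrite mxE; apply: eq_bigr => j _; rewrite mxE.
by rewrite -expr2 cauchy_schwarz_sqr.
Qed.

Lemma enorm_delta (i : 'I_d) : enorm (delta_mx i 0 : 'cV[R]_d) = 1.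
Proof.
apply: (@pexpIrn _ 2) => //; rewrite ?nnegrE ?enorm_ge0//.
rewrite enorm_sqr expr1n /dot (bigD1 i)//= big1 => [|j ji]; rewrite !mxE ?eqxx ?mulr1 ?addr0//.
by rewrite (negbTE ji) mul0r.
Qed.

Lemma enorm_mulmx_spectral (A : 'M[R]_d) (u : 'cV[R]_d) :
  enorm u <= 1 -> enorm (A *m u) <= spectral_norm A.
Proof.
move=> u1; apply: ub_le_sup; last by exists u.
exists (enorm A) => _ [v /= v1 <-]; apply: le_trans (enorm_mulmx _ _) _.
by rewrite ler_piMr ?enorm_ge0.
Qed.

(** The squared Frobenius norm is the sum of the d diagonal entries
    <e_i, A A^T e_i>, and each of them is at most the spectral norm. *)
Lemma frobenius_spectral (A : 'M[R]_d) :
  enorm A ^+ 2 <= d%:R * spectral_norm (A *m A^T).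
Proof.
have -> : d%:R * spectral_norm (A *m A^T) = \sum_(i < d) spectral_norm (A *m A^T).
  by rewrite sumr_const card_ord mulr_natl.
rewrite frobenius_sqr; apply: ler_sum => i _.
have -> : \sum_j A i j ^+ 2 = dot (delta_mx i 0) ((A *m A^T) *m delta_mx i 0).
  rewrite /dot [RHS](bigD1 i)//= [X in _ + X]big1 ?addr0 => [|j ji]; last first.
    by rewrite [X in X * _]mxE (negbTE ji) mul0r.
  rewrite -colE !mxE !eqxx mul1r; apply: eq_bigr => j _.
  by rewrite mxE expr2.
apply: le_trans (cauchy_schwarz _ _) _; rewrite enorm_delta mul1r.
by apply: enorm_mulmx_spectral; rewrite enorm_delta.
Qed.

End Spectral.

Section Gradient.
Context {R : realType} {d : nat}.
Implicit Types (g : 'cV[R]_d -> R) (x y v : 'cV[R]_d).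

Lemma derive_grad g x v : differentiable g x -> 'D_v g x = dot (grad g x) v.
Proof.
move=> dg; rewrite deriveE// {1}(matrix_sum_delta v) linear_sum.
apply: eq_bigr => i _; rewrite big_ord1 linearZ /= mxE deriveE// mulrC.
by [].
Qed.

Lemma is_derive_line g x v (r : R) : differentiable g (x + r *: v) ->
  is_derive r 1 (fun s : R => g (x + s *: v)) (dot (grad g (x + r *: v)) v).
Proof.
move=> dg; rewrite -derive_grad//; set p := x + r *: v.
have E : (fun h : R => h^-1 *: (((fun s : R => g (x + s *: v)) \o shift r) (h *: 1) - g (x + r *: v)))
       = (fun h : R => h^-1 *: ((g \o shift p) (h *: v) - g p)).
  apply/funext => h /=; congr (_ *: (g _ - _)).
  by rewrite /p scalerDl addrCA /GRing.scale /= mulr1.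
have := @diff_derivable _ _ _ g p v dg; rewrite /derivable /derive -E => D.
by split.
Qed.

(** The difference of the two sides, with y replaced by x + r (y - x), has
    derivative <grad g (x + r v) - grad g x, v> - r K |v|^2 in r, which is
    nonpositive by Cauchy-Schwarz. *)
Lemma descent_lemma g (K : R) x y : (forall z, differentiable g z) ->
  (forall z z', enorm (grad g z - grad g z') <= K * enorm (z - z')) ->
  g y <= g x + dot (grad g x) (y - x) + K / 2 * dot (y - x) (y - x).
Proof.
move=> dg lg; have [v vE] : exists v, v = y - x by exists (y - x).
rewrite -vE.
pose k (r : R) := g (x + r *: v) - (r * dot (grad g x) v + r ^+ 2 * (K / 2 * dot v v)).
have dk (r : R) : is_derive r 1 k (dot (grad g (x + r *: v)) v
    - (dot (grad g x) v + r * (K * dot v v))).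
  have ? := is_derive_line (dg (x + r *: v)).
  rewrite /k; apply: is_derive_eq.
  rewrite /GRing.scale /= ; lra.
have kle : k 1 <= k 0.
  apply: (@ler0_derive1_le_cc _ k 0 1).
  - by move=> z _; apply: ex_derive.
  - move=> z; rewrite in_itv /= => /andP[z0 z1].
    rewrite derive1E derive_val.
    have := cauchy_schwarz (grad g (x + z *: v) - grad g x) v.
    have := lg (x + z *: v) x.
    rewrite addrAC subrr add0r enormZ (ger0_norm (ltW z0)) !dotE -enorm_sqr.
    have := enorm_ge0 v; nra.
  - apply: derivable_within_continuous => z _; apply: ex_derive.
  - by rewrite in_itv /= lexx ler01.
  - by rewrite in_itv /= lexx ler01.
  - exact: ler01.
move: kle; rewrite /k scale1r scale0r addr0 [x + v]addrC vE subrK; nra.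
Qed.

End Gradient.

Lemma grad_average {R : realType} {d N : nat} (f_ : 'I_N -> 'cV[R]_d -> R)
    (x : 'cV[R]_d) : (forall i x, differentiable (f_ i) x) ->
  differentiable (average f_) x /\
  grad (average f_) x = N%:R^-1 *: \sum_i grad (f_ i) x.
Proof.
move=> df.
have E : average f_ = N%:R^-1 *: \sum_i f_ i.
  by apply/funext => y; rewrite /average fctE fct_sumE.
have ds : differentiable (\sum_i f_ i) x by exact: differentiable_sum.
split; first by rewrite E; exact: differentiableZ.
apply/matrixP => j k; rewrite ord1 {k} !mxE E deriveZ /=; last exact: diff_derivable.
rewrite derive_sum; last by move=> i; exact: diff_derivable.
rewrite /GRing.scale /= summxE; congr (_ * _).
by apply: eq_bigr => i _; rewrite mxE.
Qed.

Lemma L_smooth_average {R : realType} {d N : nat} (f_ : 'I_N -> 'cV[R]_d -> R)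
    (L : R) : (0 < N)%N -> (forall i, L_smooth L (f_ i)) ->
  L_smooth L (average f_).
Proof.
move=> N0 Lf; have df i x : differentiable (f_ i) x by have [] := Lf i.
split=> [x|x y]; first by have [] := grad_average x df.
have [_ ->] := grad_average x df; have [_ ->] := grad_average y df.
rewrite -scalerBr -sumrB enormZ ger0_norm ?invr_ge0//.
rewrite mulrC ler_pdivrMr ?ltr0n//.
apply: le_trans (enorm_sum _ _) _.
have -> : L * enorm (x - y) * N%:R = \sum_(i < N) L * enorm (x - y).
  by rewrite sumr_const card_ord mulr_natr.
by apply: ler_sum => i _; have [_] := Lf i; apply.
Qed.

(** Two points at distance 1 force the sign of L; a space of dimension 0 has
    no such points. *)
Lemma L_smooth_ge0 {R : realType} {d : nat} (g : 'cV[R]_d -> R) (L : R) :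
  (0 < d)%N -> L_smooth L g -> 0 <= L.
Proof.
case: d g => // d g _ [_ /(_ (delta_mx ord0 0) 0)].
by rewrite subr0 enorm_delta mulr1; apply: le_trans; exact: enorm_ge0.
Qed.

Lemma continuous_grad_average {R : realType} {d N : nat}
    (f_ : 'I_N -> 'cV[R]_d -> R) j : (forall i, Ck 3 (f_ i)) ->
  continuous (fun x => grad (average f_) x j 0).
Proof.
move=> C x; have df i y : differentiable (f_ i) y by have [] := C i.
have -> : (fun x => grad (average f_) x j 0) =
    \sum_i (N%:R^-1 *: (fun y => 'D_(delta_mx j 0) (f_ i) y)).
  apply/funext => y; have [_ ->] := grad_average y df.
  rewrite !mxE summxE fct_sumE mulr_sumr.
  by apply: eq_bigr => i _; rewrite mxE.
apply: differentiable_continuous; apply: differentiable_sum => i.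
by apply: differentiableZ; have [_ /(_ (delta_mx j 0)) []] := C i.
Qed.

(** * Measurability by rounding *)

Section Rounding.
Context {R : realType}.

Definition grid (n : nat) (x : R) : R := (Num.floor (n.+1%:R * x))%:~R / n.+1%:R.

Lemma grid_bounds n x : grid n x <= x < grid n x + n.+1%:R^-1.
Proof.
have n0 : (0 : R) < n.+1%:R by rewrite ltr0n.
rewrite /grid -[X in _ < _ + X]mul1r -mulrDl ler_pdivrMr// ltr_pdivlMr// mulrC.
by rewrite -[X in _ + X](_ : 1%:~R = 1)// -intrD floor_itv.
Qed.

Lemma grid_ge0 n x : 0 <= x -> 0 <= grid n x.
Proof.
move=> x0; rewrite /grid mulr_ge0 ?invr_ge0// ler0z floor_ge0.
by rewrite mulr_ge0.
Qed.

Lemma cvg_grid x : grid n x @[n --> \oo] --> x.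
Proof.
have H : x - n.+1%:R^-1 @[n --> \oo] --> x.
  rewrite -[X in _ --> X]subr0; apply: cvgB; first exact: cvg_cst.
  exact: cvg_harmonic.
apply: squeeze_cvgr H (cvg_cst x); apply: nearW => n.
by have /andP[-> h] := grid_bounds n x; rewrite lerBlDr ltW.
Qed.

Lemma measurable_grid_fiber n (m : int) :
  measurable [set x : R | Num.floor (n.+1%:R * x) = m].
Proof.
have n0 : (0 : R) < n.+1%:R by rewrite ltr0n.
suff -> : [set x : R | Num.floor (n.+1%:R * x) = m] =
    `[m%:~R / n.+1%:R, (m + 1)%:~R / n.+1%:R[%classic by [].
apply/seteqP; split => x /=; rewrite in_itv /= ler_pdivrMr// ltr_pdivlMr// (mulrC x).
  by move=> <-; exact: floor_itv.
by move=> /floor_def.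
Qed.

(** A function that is continuous in some of its arguments and measurable in
    the others is measurable: round the former to countably many values, so
    that the rounded function is measurable piece by piece, and let the mesh
    tend to 0. *)
Lemma measurable_fun_rounding dS (S : measurableType dS) (C : countType)
    (r : nat -> S -> C) (h : nat -> C -> S -> R) (f : S -> R) :
  (forall n c, measurable (r n @^-1` [set c])) ->
  (forall n c, measurable_fun setT (h n c)) ->
  (forall x, h n (r n x) x @[n --> \oo] --> f x) -> measurable_fun setT f.
Proof.
move=> mr mh hf; apply: (@measurable_fun_cvg _ _ _ _ (fun n x => h n (r n x) x)) => // n.
move=> _ A mA; rewrite setTI.
have -> : (fun x => h n (r n x) x) @^-1` A =
    \bigcup_c (r n @^-1` [set c] `&` (h n c @^-1` A)).
  apply/seteqP; split => [x Ax|x [c _ [/= <-]]//].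
  by exists (r n x).
apply: countable_bigcupT_measurable => // c; apply: measurableI => //.
by rewrite -[X in measurable X]setTI; exact: mh.
Qed.

Lemma cvg_mx_entries m k (u : nat -> 'M[R]_(m, k)) (l : 'M[R]_(m, k)) :
  (forall i j, u n i j @[n --> \oo] --> l i j) -> u n @[n --> \oo] --> l.
Proof.
move=> ul; apply/cvg_ballP => e e0.
have H : \forall n \near \oo, forall p : 'I_m * 'I_k, ball (l p.1 p.2) e (u n p.1 p.2).
  by apply: filter_forall => p; have /cvg_ballP /(_ e e0) := ul p.1 p.2.
by apply: filterS H => n H; split => // i j; exact: (H (i, j)).
Qed.

(** Column vectors carry a topology but no sigma-algebra here, so that
    measurability of a random vector means measurability of its entries. *)
Lemma measurable_continuous_comp dS (S : measurableType dS) d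
    (g : 'cV[R]_d -> R) (X : S -> 'cV[R]_d) : continuous g ->
  (forall i, measurable_fun setT (fun w => X w i 0)) ->
  measurable_fun setT (fun w => g (X w)).
Proof.
move=> cg mX.
pose r n w : {ffun 'I_d -> int} := [ffun i => Num.floor (n.+1%:R * X w i 0)].
pose h n (c : {ffun 'I_d -> int}) (w : S) := g (\col_i ((c i)%:~R / n.+1%:R)).
apply: (@measurable_fun_rounding _ _ _ r h) => [n c|n c|w].
- have -> : r n @^-1` [set c] =
      \bigcap_(i in [set: 'I_d]) ((fun w => X w i 0) @^-1`
          [set x | Num.floor (n.+1%:R * x) = c i]).
    apply/seteqP; split => [w /= <- i _|w H]; first by rewrite /= ffunE.
    by apply/ffunP => i; rewrite ffunE; exact: (H i).
  apply: fin_bigcap_measurable => [|i _]; first exact: finite_finset.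
  rewrite -[X in measurable X]setTI; apply: mX => //.
  exact: measurable_grid_fiber.
- exact: measurable_cst.
- apply: (@cvg_comp _ _ _ (fun n => \col_i (((r n w) i)%:~R / n.+1%:R)) g _ (nbhs (X w))).
    apply: cvg_mx_entries => i j; rewrite ord1.
    under eq_fun do rewrite mxE ffunE.
    exact: cvg_grid.
  exact: cg.
Qed.

(** The time is clamped at 0 because nothing is assumed about the process at
    negative times. *)
Lemma measurable_continuous_paths dS (S : measurableType dS) (X : R -> S -> R) :
  (forall w, {within `[0, +oo[, continuous (fun s => X s w)}) ->
  (forall s, 0 <= s -> measurable_fun setT (X s)) ->
  measurable_fun setT (fun p : measurableTypeR R * S => X (Num.max 0 p.1) p.2).
Proof.
move=> cX mX.
pose r n (p : measurableTypeR R * S) : int := Num.floor (n.+1%:R * Num.max 0 p.1).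
pose h n (c : int) (p : measurableTypeR R * S) :=
  if 0 <= c then X (c%:~R / n.+1%:R) p.2 else 0.
have m1 : measurable_fun setT (fun p : measurableTypeR R * S => Num.max 0 p.1).
  by apply: measurable_maxr => //; exact: measurable_fst.
apply: (@measurable_fun_rounding _ _ _ r h) => [n c|n c|[s w]].
- rewrite -[X in measurable X]setTI.
  by apply: (m1 measurableT _ (measurable_grid_fiber n c)).
- rewrite /h; have [c0|c0] := boolP (0 <= c); last exact: measurable_cst.
  apply: (measurableT_comp (f := X (c%:~R / n.+1%:R))); last exact: measurable_snd.
  by apply: mX; rewrite divr_ge0// ler0z.
- rewrite /h/r /=; set s0 := Num.max 0 s.
  have s00 : 0 <= s0 by rewrite le_max lexx.
  have -> : (fun n => if 0 <= Num.floor (n.+1%:R * s0) then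
       X ((Num.floor (n.+1%:R * s0))%:~R / n.+1%:R) w else 0) =
       (fun n => X (grid n s0) w).
    by apply/funext => n; rewrite floor_ge0 mulr_ge0.
  have := cX w; rewrite continuous_subspace_in => /(_ s0).
  rewrite inE /= in_itv /= andbT => /(_ s00) cXw.
  apply: (@cvg_comp _ _ _ (fun n => grid n s0) (fun s => X s w) _ (within `[0, +oo[ (nbhs s0))).
    move=> A wA; have wA' : nbhs s0 [set x | `[0, +oo[%classic x -> A x] := wA.
    have H : \forall n \near \oo, `[0, +oo[%classic (grid n s0) -> A (grid n s0) := cvg_grid wA'.
    by apply: filterS H => n; apply; rewrite /= in_itv /= andbT grid_ge0.
  move: cXw; rewrite /continuous_at /= nbhs_subspace_in//=.
  by rewrite in_itv /= andbT.
Qed.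

End Rounding.

(** * Square-integrable random variables *)

Section SquareIntegrable.
Context {R : realType} {disp : measure_display} {T : measurableType disp}.
Variable P : probability T R.
Implicit Types X Y : T -> R.

Local Notation integ X := (P.-integrable [set: T] (fun w => (X w)%:E)).

Lemma integrable_measurable X : integ X -> measurable_fun setT X.
Proof. by move=> /measurable_int /measurable_EFinP. Qed.

Lemma integrable_dominated X Y : measurable_fun setT X -> integ Y ->
  (forall w, `|X w| <= Y w) -> integ X.
Proof.
move=> mX iY XY; apply: le_integrable iY => //; first exact/measurable_EFinP.
by move=> w _ /=; rewrite lee_fin (le_trans (XY w))// ler_norm.
Qed.

Lemma integrable_bounded X M : measurable_fun setT X ->
  (forall w, `|X w| <= M) -> integ X.
Proof.
move=> mX XM; apply: (integrable_dominated mX _ XM).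
exact: finite_measure_integrable_cst.
Qed.

Lemma integrable_sumr I (r : seq I) (F : I -> T -> R) :
  (forall i, integ (F i)) -> integ (fun w => \sum_(i <- r) F i w).
Proof.
move=> iF; under eq_fun do rewrite -sumEFin.
by apply: integrable_sum => // i _; exact: iF.
Qed.

Lemma Rintegral_sumr I (r : seq I) (F : I -> T -> R) :
  (forall i, integ (F i)) ->
  \int[P]_w (\sum_(i <- r) F i w) = \sum_(i <- r) \int[P]_w F i w.
Proof.
move=> iF; elim: r => [|i r IH].
  under eq_Rintegral do rewrite big_nil.
  by rewrite big_nil Rintegral_cst// mul0r.
under eq_Rintegral do rewrite big_cons.
rewrite RintegralD//= ?IH ?big_cons//; first exact: iF.
exact: (integrable_sumr r iF).
Qed.

Definition sqint X := measurable_fun setT X /\ integ (fun w => X w ^+ 2).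

Lemma sqint_mul X Y : sqint X -> sqint Y -> integ (fun w => X w * Y w).
Proof.
move=> [mX iX] [mY iY]; apply: integrable_dominated (integrableD _ iX iY) _ => //.
  exact: measurable_funM.
move=> w /=; rewrite ler_norml; apply/andP; split; nra.
Qed.

Lemma sqint_bounded_mul X Y M : measurable_fun setT X -> (forall w, `|X w| <= M) ->
  sqint Y -> sqint (fun w => X w * Y w).
Proof.
move=> mX XM [mY iY]; split; first exact: measurable_funM.
apply: integrable_dominated (integrableZl measurableT (M ^+ 2) iY) _.
  by apply: measurable_funX; exact: measurable_funM.
move=> w /=; rewrite exprMn ger0_norm; last by rewrite mulr_ge0 ?sqr_ge0.
rewrite ler_wpM2r ?sqr_ge0// -[leLHS]real_normK ?num_real//.
by rewrite ler_pXn2r ?nnegrE// (le_trans _ (XM w)).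
Qed.

Lemma sqint_bounded X M : measurable_fun setT X -> (forall w, `|X w| <= M) -> sqint X.
Proof.
move=> mX XM; split => //; apply: (@integrable_bounded _ (M ^+ 2)).
  exact: measurable_funX.
move=> w; rewrite normrX ler_pXn2r ?nnegrE// (le_trans _ (XM w))//.
Qed.

Lemma sqint_integrable X : sqint X -> integ X.
Proof.
move=> sX; under eq_fun do rewrite -[X _]mul1r.
apply: sqint_mul sX; apply: (@sqint_bounded _ 1) => // w.
by rewrite normr1.
Qed.

Lemma sqintD X Y : sqint X -> sqint Y -> sqint (fun w => X w + Y w).
Proof.
move=> [mX iX] [mY iY]; split; first exact: measurable_funD.
apply: integrable_dominated (integrableZl measurableT 2 (integrableD _ iX iY)) _ => //.
  by apply: measurable_funX; exact: measurable_funD.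
move=> w; rewrite ger0_norm ?sqr_ge0//.
by have := sqr_ge0 (X w - Y w); rewrite !expr2; lra.
Qed.

Lemma sqint_sum I (r : seq I) (F : I -> T -> R) :
  (forall i, sqint (F i)) -> sqint (fun w => \sum_(i <- r) F i w).
Proof.
move=> sF; elim: r => [|i r IH].
  under eq_fun do rewrite big_nil.
  by apply: (@sqint_bounded _ 0) => // w; rewrite normr0.
under eq_fun do rewrite big_cons.
exact: sqintD.
Qed.

Lemma sqint_le X Y : measurable_fun setT X -> integ Y ->
  (forall w, X w ^+ 2 <= Y w) -> sqint X.
Proof.
move=> mX iY XY; split => //; apply: integrable_dominated iY _.
  exact: measurable_funX.
by move=> w; rewrite ger0_norm ?sqr_ge0.
Qed.

(** The law of the pair (X, Y) and the product of the two laws agree on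
    rectangles, hence everywhere; Fubini's theorem then factors the integral
    of x y. *)
Lemma Rintegral_independentM X Y :
  measurable_fun setT X -> measurable_fun setT Y ->
  (forall A B, measurable A -> measurable B ->
    P (X @^-1` A `&` Y @^-1` B) = (P (X @^-1` A) * P (Y @^-1` B))%E) ->
  integ X -> integ Y -> integ (fun w => X w * Y w) ->
  \int[P]_w (X w * Y w) = \int[P]_w X w * \int[P]_w Y w.
Proof.
move=> mX mY XY iX iY iXY.
pose X' : {RV P >-> R} := MeasurableFun.Pack (MeasurableFun.Class (isMeasurableFun.Build _ _ _ _ X mX)).
pose Y' : {RV P >-> R} := MeasurableFun.Pack (MeasurableFun.Class (isMeasurableFun.Build _ _ _ _ Y mY)).
have mZ : measurable_fun setT (fun w => (X w, Y w)) by exact/measurable_fun_pair.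
pose Z' : {RV P >-> (R * R)%type} :=
  MeasurableFun.Pack (MeasurableFun.Class (isMeasurableFun.Build _ _ _ _ _ mZ)).
pose m1 := distribution P X'; pose m2 := distribution P Y'.
pose f (z : (R * R)%type) := (z.1 * z.2)%:E.
have mf : measurable_fun setT f.
  apply/measurable_EFinP; apply: measurable_funM.
    exact: measurable_fst.
  exact: measurable_snd.
have jE : forall A, measurable A -> (m1 \x m2)%E A = distribution P Z' A.
  apply: product_measure_unique => A B mA mB.
  by rewrite /m1 /m2 /distribution /pushforward /= -XY.
have intE : (\int[P]_w (X w * Y w)%:E = \int[m1 \x m2]_z f z)%E.
  rewrite (eq_measure_integral (distribution P Z')); last by move=> A mA _; exact: jE.
  by rewrite integral_distribution.
have fin : (m1 \x m2)%E.-integrable setT f.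
  apply/integrableP; split => //.
  rewrite (eq_measure_integral (distribution P Z')); last by move=> A mA _; exact: jE.
  rewrite ge0_integral_distribution//; last exact: measurableT_comp.
  by move/integrableP : iXY => [].
have iY' : m2.-integrable setT (EFin : R -> _).
  apply/integrableP; split; first exact/measurable_EFinP.
  rewrite ge0_integral_distribution//; last by apply: measurableT_comp => //; exact/measurable_EFinP.
  by move/integrableP : iY => [].
have EX : (\int[P]_w (X w)%:E = \int[m1]_x x%:E)%E.
  by rewrite integral_distribution//; exact/measurable_EFinP.
have EY : (\int[P]_w (Y w)%:E = \int[m2]_x x%:E)%E.
  by rewrite integral_distribution//; exact/measurable_EFinP.
have iX' : m1.-integrable setT (EFin : R -> _).
  apply/integrableP; split; first exact/measurable_EFinP.
  rewrite ge0_integral_distribution//; last by apply: measurableT_comp => //; exact/measurable_EFinP.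
  by move/integrableP : iX => [].
have fY : (\int[m2]_x x%:E)%E \is a fin_num by exact: integrable_fin_num.
rewrite /Rintegral intE -integral12_prod_meas1// /fubini_F EX EY.
transitivity (fine (\int[m1]_x (x%:E * \int[m2]_y y%:E))%E).
  congr fine; apply: eq_integral => x _.
  by under eq_integral do rewrite /f EFinM; rewrite integralZl.
rewrite -(fineK fY) integralZr// fineM//.
exact: integrable_fin_num.
Qed.

End SquareIntegrable.

(** * Gaussian moments *)

Section GaussianMoments.
Context {R : realType}.
Local Notation mu := (@lebesgue_measure R).

(** The density p coincides almost everywhere with the Radon-Nikodym
    derivative, since both have the same integral over every set. *)
Lemma ge0_integral_density (nu : {finite_measure set (measurableTypeR R) -> \bar R})
    (p : measurableTypeR R -> R) (f : measurableTypeR R -> \bar R) :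
  measurable_fun setT p -> (forall x, 0 <= p x) ->
  (forall A, measurable A -> nu A = (\int[mu]_(x in A) (p x)%:E)%E) ->
  measurable_fun setT f -> (forall x, 0 <= f x)%E ->
  (\int[nu]_x f x = \int[mu]_x (f x * (p x)%:E))%E.
Proof.
move=> mp p0 nuE mf f0.
have dom : nu `<< mu.
  apply/null_content_dominatesP => A mA muA0; rewrite nuE//.
  by apply: null_set_integral => //; apply: measurable_funTS; exact/measurable_EFinP.
rewrite -(Radon_Nikodym_SigmaFinite.change_of_variables dom f0 measurableT mf)//.
apply: ae_eq_integral => //.
- apply: emeasurable_funM => //.
  by have /integrableP[] := Radon_Nikodym_SigmaFinite.f_integrable dom.
- by apply: emeasurable_funM => //; exact/measurable_EFinP.
- apply: ae_eqe_mul2l => /=.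
  apply: integral_ae_eq => //.
  + exact: Radon_Nikodym_SigmaFinite.f_integrable.
  + exact/measurable_EFinP.
  + by move=> E _ mE; rewrite -Radon_Nikodym_SigmaFinite.f_integral// nuE.
Qed.

Variable s : R.
Hypothesis s0 : 0 < s.
Local Notation p := (normal_pdf 0 s).

Let sN0 : s != 0. Proof. by rewrite gt_eqF. Qed.

Let pE (x : R) : p x = normal_peak s * expR (- x ^+ 2 / (s ^+ 2 *+ 2)).
Proof. by rewrite normal_pdfE// /normal_fun subr0. Qed.

(** An antiderivative of (x^2 - s^2) p(x) that vanishes at 0 and at infinity:
    this is why the second moment of p is s^2. *)
Let F (x : R) : R := - (s ^+ 2 * (x * p x)).

Let is_derive_F (x : R) : is_derive x 1 F ((x ^+ 2 - s ^+ 2) * p x).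
Proof.
have -> : F = (fun x => - (s ^+ 2 * (x * (normal_peak s * expR (- x ^+ 2 / (s ^+ 2 *+ 2)))))).
  by apply/funext => y; rewrite /F pE.
apply: is_derive_eq; rewrite pE /GRing.scale /=.
by field.
Qed.

Let derivable_F x : derivable F x 1. Proof. by case: (is_derive_F x). Qed.

Let derive1_F x : F^`()%classic x = (x ^+ 2 - s ^+ 2) * p x.
Proof. by rewrite derive1E; case: (is_derive_F x). Qed.

Let continuous_p : continuous (p : R -> R).
Proof. exact: continuous_normal_pdf. Qed.

Let cvgF : F x @[x --> +oo%R] --> 0.
Proof.
rewrite -oppr0; apply: cvgN.
pose c := s ^+ 2 * normal_peak s * (s ^+ 2 *+ 2).
have H : c * x^-1 @[x --> +oo%R] --> 0.
  rewrite -(mulr0 c); apply: cvgM; first exact: cvg_cst.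
  by apply/(@gtr0_cvgV0 R _ _ _ id); [near=> x|exact: cvg_id].
apply: squeeze_cvgr (cvg_cst 0) H; near=> x.
have x0 : 0 < x by [].
rewrite pE; apply/andP; split.
  by rewrite !mulr_ge0 ?sqr_ge0 ?normal_peak_ge0 ?expR_ge0// ltW.
have y0 : 0 < x ^+ 2 / (s ^+ 2 *+ 2).
  by rewrite divr_gt0 ?exprn_gt0// pmulrn_lgt0// exprn_gt0.
have : expR (- x ^+ 2 / (s ^+ 2 *+ 2)) <= (x ^+ 2 / (s ^+ 2 *+ 2))^-1.
  rewrite mulNr expRN lef_pV2 ?posrE ?expR_gt0//.
  by apply: le_trans (expR_ge1Dx _); rewrite lerDr.
move=> /(ler_wpM2l (normal_peak_ge0 s)) /(ler_wpM2l (ltW x0)).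
move=> /(ler_wpM2l (sqr_ge0 s)) /le_trans; apply.
rewrite le_eqVlt; apply/orP; left; apply/eqP; rewrite /c.
field.
by rewrite sN0 gt_eqF.
Unshelve. all: by end_near. Qed.

Let continuous_xp : continuous (fun x : R => (x ^+ 2 - s ^+ 2) * p x).
Proof.
move=> x; apply: cvgM; last exact: continuous_p.
by apply: cvgB; [exact: exprn_continuous|exact: cvg_cst].
Qed.

Let mp : measurable_fun setT (p : R -> R).
Proof. exact: measurable_normal_pdf. Qed.

Let mx2 : measurable_fun setT (fun x : R => x ^+ 2).
Proof. exact: exprn_measurable. Qed.

Let p0 x : 0 <= p x. Proof. exact: normal_pdf_ge0. Qed.

Let continuous_F : continuous F.
Proof.
by move=> x; apply: differentiable_continuous; apply/derivable1_diffP; exact: derivable_F.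
Qed.

Let I (A : set R) (g : R -> R) : \bar R := (\int[mu]_(x in A) (g x)%:E)%E.

Let far : I `[s, +oo[ (fun x => (x ^+ 2 - s ^+ 2) * p x) = (- F s)%:E.
Proof.
rewrite /I (@ge0_continuous_FTC2y _ _ F s 0) ?add0e//.
- move=> x sx; rewrite mulr_ge0// subr_ge0 ler_pXn2r ?nnegrE// ?(ltW s0)//.
  exact: le_trans (ltW s0) sx.
- exact: continuous_subspaceT.
- exact/cvg_at_right_filter/continuous_F.
Qed.

Let near0 : I `[0, s] (fun x => (s ^+ 2 - x ^+ 2) * p x) = (- F s)%:E.
Proof.
rewrite /I (@continuous_FTC2 _ _ (fun x => - F x) 0 s)//.
- by rewrite -EFinB /F mul0r mulr0 !oppr0 addr0.
- apply: continuous_subspaceT => x.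
  have -> : (fun x => (s ^+ 2 - x ^+ 2) * p x) = (fun x => - ((x ^+ 2 - s ^+ 2) * p x)).
    by apply/funext => y; ring.
  by apply: cvgN; exact: continuous_xp.
- split => [x _||]; first by apply: derivableN; exact: derivable_F.
  + by apply: cvg_at_right_filter; apply: cvgN; exact: continuous_F.
  + by apply: cvg_at_left_filter; apply: cvgN; exact: continuous_F.
- move=> x _; rewrite derive1E deriveN; last exact: derivable_F.
  by rewrite -derive1E derive1_F -mulNr; congr (_ * _); ring.
Qed.

Let mI (A : set R) (g : R -> R) : measurable_fun setT g -> measurable_fun A (EFin \o g).
Proof. by move=> mg; apply: measurable_funTS; exact/measurable_EFinP. Qed.

Let mx2p : measurable_fun setT (fun x : R => x ^+ 2 * p x).
Proof. exact: measurable_funM. Qed.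

Let ms2p : measurable_fun setT (fun x => s ^+ 2 * p x).
Proof. by apply: measurable_funM => //; exact: measurable_cst. Qed.

(** The fundamental theorem on an unbounded interval applies to functions of
    constant sign, and x^2 - s^2 changes sign at s. The half-line is cut there,
    and the two pieces contribute F s with opposite signs. *)
Let half_second_moment :
  I `[0, +oo[ (fun x => x ^+ 2 * p x) = I `[0, +oo[ (fun x => s ^+ 2 * p x).
Proof.
have split (g : R -> R) : measurable_fun setT g -> (forall x, 0 <= g x) ->
    I `[0, +oo[ g = (I `[0%R, s[ g + I `[s, +oo[ g)%E.
  move=> mg g0; rewrite /I (@itv_bndbnd_setU _ _ _ (BLeft s)) ?bnd_simp ?(ltW s0)//.
  rewrite ge0_integral_setU//; [exact: mI|by move=> y _; rewrite lee_fin|].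
  apply/disj_setPS => y [/=]; rewrite !in_itv /= andbT => /andP[_ ys].
  by rewrite leNgt ys.
rewrite !split//; last 2 first.
- by move=> x; rewrite mulr_ge0 ?sqr_ge0.
- by move=> x; rewrite mulr_ge0 ?sqr_ge0.
have e1 : I `[s, +oo[ (fun x => x ^+ 2 * p x) =
    (I `[s, +oo[ (fun x => s ^+ 2 * p x)%R + (- F s)%:E)%E.
  rewrite -far /I -ge0_integralD//; last 4 first.
  - by move=> x _; rewrite lee_fin mulr_ge0 ?sqr_ge0.
  - exact: mI.
  - move=> x /=; rewrite in_itv /= andbT lee_fin => sx; rewrite mulr_ge0//.
    by rewrite subr_ge0 ler_pXn2r ?nnegrE// ?(ltW s0)// (le_trans (ltW s0)).
  - by apply: mI; apply: continuous_measurable_fun.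
  by apply: eq_integral => x _; rewrite -EFinD -mulrDl addrC subrK.
have near0' : I `[0, s[ (fun x => (s ^+ 2 - x ^+ 2) * p x) = (- F s)%:E.
  rewrite -near0 /I integral_itv_bndo_bndc//; apply: mI.
  by apply: measurable_funM => //; apply: measurable_funB.
have e2 : I `[0, s[ (fun x => s ^+ 2 * p x) =
    (I `[0%R, s[ (fun x => x ^+ 2 * p x)%R + (- F s)%:E)%E.
  rewrite -near0' /I -ge0_integralD//; last 4 first.
  - by move=> x _; rewrite lee_fin mulr_ge0 ?sqr_ge0.
  - exact: mI.
  - move=> x /=; rewrite in_itv /= lee_fin => /andP[x0 xs]; rewrite mulr_ge0//.
    by rewrite subr_ge0 ler_pXn2r ?nnegrE// ltW.
  - by apply: mI; apply: measurable_funM => //; apply: measurable_funB.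
  by apply: eq_integral => x _; rewrite -EFinD -mulrDl addrC subrK.
by rewrite e1 e2 addeA addeAC.
Qed.

Let opp_half (g : R -> R) : measurable_fun setT g -> (forall x, 0 <= g x) ->
  I `]-oo, 0] g = I `[0, +oo[ (fun x => g (- x)).
Proof.
move=> mg g0; rewrite /I (@ge0_integration_by_substitution0 R (fun x => (g (- x))%:E)).
- by apply: eq_integral => x _; rewrite opprK.
- by apply/measurable_EFinP; apply: measurableT_comp.
- by move=> r; rewrite lee_fin.
Qed.

Let split0 (g : R -> R) : measurable_fun setT g -> (forall x, 0 <= g x) ->
  I setT g = (I `]-oo, 0%R] g + I `[0%R, +oo[ g)%E.
Proof.
move=> mg g0; have -> : I `[0, +oo[ g = I `]0, +oo[ g.
  by rewrite /I integral_itv_obnd_cbnd//; exact: mI.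
rewrite /I -set_itvNyy (@itv_bndbnd_setU _ _ _ (BRight 0)) ?bnd_simp//.
rewrite ge0_integral_setU//; [exact: mI|by move=> y _; rewrite lee_fin|].
apply/disj_setPS => y [/=]; rewrite !in_itv /= andbT => y0.
by rewrite ltNge y0.
Qed.

Let p_even x : p (- x) = p x. Proof. by rewrite !pE sqrrN. Qed.

Lemma normal_second_moment :
  (\int[mu]_x (x ^+ 2 * p x)%:E = (s ^+ 2)%:E)%E.
Proof.
have -> : (s ^+ 2)%:E = I setT (fun x => s ^+ 2 * p x).
  rewrite /I; under eq_integral do rewrite EFinM.
  rewrite ge0_integralZl//; last 3 first.
  - exact/measurable_EFinP.
  - by move=> x _; rewrite lee_fin.
  - by rewrite lee_fin sqr_ge0.
  by rewrite integral_normal_pdf mule1.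
have g1 x : 0 <= x ^+ 2 * p x by rewrite mulr_ge0 ?sqr_ge0.
have g2 x : 0 <= s ^+ 2 * p x by rewrite mulr_ge0 ?sqr_ge0.
rewrite -/(I setT (fun x => x ^+ 2 * p x)) (split0 mx2p g1) (split0 ms2p g2).
rewrite (opp_half mx2p g1) (opp_half ms2p g2) half_second_moment; congr (_ + _)%E.
transitivity (I `[0, +oo[ (fun x => x ^+ 2 * p x)).
  by congr I; apply/funext => x; rewrite sqrrN p_even.
by rewrite half_second_moment; congr I; apply/funext => x; rewrite p_even.
Qed.

(** By symmetry of the density; this is how the mean of a centred Gaussian
    variable is seen to vanish. *)
Lemma normal_positive_part :
  (\int[mu]_x (Num.max x 0 * p x)%:E = \int[mu]_x (Num.max (- x) 0 * p x)%:E)%E.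
Proof.
have m1 : measurable_fun setT (fun x : R => Num.max x 0 * p x).
  by apply: measurable_funM => //; exact: measurable_maxr.
have m2 : measurable_fun setT (fun x : R => Num.max (- x) 0 * p x).
  by apply: measurable_funM => //; apply: measurable_maxr => //; exact: measurableT_comp.
have g1 x : 0 <= Num.max x 0 * p x by rewrite mulr_ge0// le_max lexx orbT.
have g2 x : 0 <= Num.max (- x) 0 * p x by rewrite mulr_ge0// le_max lexx orbT.
rewrite -/(I setT (fun x => Num.max x 0 * p x)) -/(I setT (fun x => Num.max (- x) 0 * p x)).
rewrite (split0 m1 g1) (split0 m2 g2) addeC (opp_half m1 g1) (opp_half m2 g2).
have -> : (fun x => Num.max (- x) 0 * p (- x)) = (fun x => Num.max (- x) 0 * p x).
  by apply/funext => x; rewrite p_even.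
have -> : (fun x => Num.max (- - x) 0 * p (- x)) = (fun x => Num.max x 0 * p x).
  by apply/funext => x; rewrite opprK p_even.
by [].
Qed.

End GaussianMoments.

(** * Increments of Brownian motion *)

Section MeasurableWrt.
Context {R : realType} {T : pointedType}.
Variable G : set (set T).
Hypothesis sG : sigma_algebra setT G.
Implicit Types X Y : T -> R.

(** Measurability with respect to G is measurability on the type equipped with
    the sigma-algebra G, and inherits all closure properties from there. *)
Lemma measurable_wrtP Y : measurable_wrt G Y <->
  measurable_fun (setT : set (g_sigma_algebraType G)) (Y : g_sigma_algebraType G -> R).
Proof.
have E : (measurable : set (set (g_sigma_algebraType G))) = G.
  exact: measurable_g_measurableTypeE.
split => [H _ A mA|H _ [A mA <-]].
  by rewrite [X in X _]E; apply: H; exists A.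
by rewrite -E; apply: H.
Qed.

Lemma measurable_wrt_cst (c : R) : measurable_wrt G (fun=> c).
Proof. by apply/measurable_wrtP. Qed.

Lemma measurable_wrtM X Y : measurable_wrt G X -> measurable_wrt G Y ->
  measurable_wrt G (fun w => X w * Y w).
Proof. by move=> /measurable_wrtP mX /measurable_wrtP mY; apply/measurable_wrtP/measurable_funM. Qed.

Lemma measurable_wrtB X Y : measurable_wrt G X -> measurable_wrt G Y ->
  measurable_wrt G (fun w => X w - Y w).
Proof. by move=> /measurable_wrtP mX /measurable_wrtP mY; apply/measurable_wrtP/measurable_funB. Qed.

Lemma measurable_wrt_comp d (g : 'cV[R]_d -> R) (X : T -> 'cV[R]_d) :
  continuous g -> (forall i, measurable_wrt G (fun w => X w i 0)) ->
  measurable_wrt G (fun w => g (X w)).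
Proof.
move=> cg mX; apply/measurable_wrtP.
apply: (@measurable_continuous_comp R _ (g_sigma_algebraType G)) => // i.
by have /measurable_wrtP := mX i.
Qed.

End MeasurableWrt.

Lemma measurable_wrtS {R : realType} {T : Type} (G H : set (set T)) (Y : T -> R) :
  G `<=` H -> measurable_wrt G Y -> measurable_wrt H Y.
Proof. by move=> GH YG A /YG /GH. Qed.

Section Independence.
Context {R : realType} {disp : measure_display} {T : measurableType disp}.
Variable P : probability T R.
Local Notation integ X := (P.-integrable [set: T] (fun w => (X w)%:E)).

Lemma measurable_wrt_fun (G : set (set T)) (Y : T -> R) :
  G `<=` measurable -> measurable_wrt G Y -> measurable_fun setT Y.
Proof. by move=> Gm YG _ A mA; apply: Gm; apply: YG; exists A. Qed.

Lemma Rintegral_independent (G H : set (set T)) (X Y : T -> R) :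
  G `<=` measurable -> H `<=` measurable -> independent P G H ->
  measurable_wrt G X -> measurable_wrt H Y ->
  integ X -> integ Y -> integ (fun w => X w * Y w) ->
  \int[P]_w (X w * Y w) = \int[P]_w X w * \int[P]_w Y w.
Proof.
move=> Gm Hm GH XG YH iX iY iXY; apply: Rintegral_independentM => //.
- exact: measurable_wrt_fun XG.
- exact: measurable_wrt_fun YH.
- move=> A B mA mB; apply: GH.
    by rewrite -[X in G X]setTI; apply: XG; exists A.
  by rewrite -[X in H X]setTI; apply: YH; exists B.
Qed.

End Independence.

Section NormalLaw.
Context {R : realType} {disp : measure_display} {T : measurableType disp}.
Variable P : probability T R.
Variables (s : R) (X : T -> R).
Hypothesis s0 : 0 < s.
Hypothesis mX : measurable_fun setT X.
Hypothesis lawX : forall A, measurable A -> P (X @^-1` A) = normal_prob 0 s A.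
Local Notation integ X := (P.-integrable [set: T] (fun w => (X w)%:E)).

Let ge0_integral_law (f : R -> R) : measurable_fun setT f -> (forall x, 0 <= f x) ->
  (\int[P]_w (f (X w))%:E =
   \int[lebesgue_measure]_x (f x * normal_pdf 0 s x)%:E)%E.
Proof.
move=> mf f0.
pose X' : {RV P >-> measurableTypeR R} :=
  MeasurableFun.Pack (MeasurableFun.Class (isMeasurableFun.Build _ _ _ (measurableTypeR R) X mX)).
have mf' : measurable_fun (setT : set (measurableTypeR R)) (fun x => (f x)%:E).
  exact/measurable_EFinP.
transitivity (\int[distribution P X']_x (f x)%:E)%E.
  by rewrite ge0_integral_distribution// => x; rewrite lee_fin.
rewrite (@ge0_integral_density R _ (normal_pdf 0 s))//.
- exact: measurable_normal_pdf.
- by move=> x; exact: normal_pdf_ge0.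
Qed.

Let integral_sqr : (\int[P]_w (X w ^+ 2)%:E = (s ^+ 2)%:E)%E.
Proof.
rewrite (@ge0_integral_law (fun x => x ^+ 2)) ?normal_second_moment//.
- by move=> x; exact: sqr_ge0.
Qed.

Lemma sqint_normal : sqint P X.
Proof.
split => //; apply/integrableP; split.
  by apply/measurable_EFinP; exact: measurable_funX.
under eq_integral do rewrite gee0_abs ?lee_fin ?sqr_ge0//.
by rewrite integral_sqr ltry.
Qed.

Lemma Rintegral_normal_sqr : \int[P]_w (X w ^+ 2) = s ^+ 2.
Proof. by rewrite /Rintegral integral_sqr. Qed.

Lemma Rintegral_normal : \int[P]_w X w = 0.
Proof.
have iX : integ X by exact: sqint_integrable sqint_normal.
have m1 : measurable_fun setT (fun w => Num.max (X w) 0) by exact: measurable_maxr.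
have m2 : measurable_fun setT (fun w => Num.max (- X w) 0).
  by apply: measurable_maxr => //; exact: measurableT_comp.
have iN : integ (fun w => `|X w|).
  apply: integrable_dominated (integrable_norm iX) _ => //; first exact: measurableT_comp.
  by move=> w /=; rewrite normr_id.
have i1 : integ (fun w => Num.max (X w) 0).
  apply: integrable_dominated iN _ => // w.
  by rewrite ger0_norm ?le_max ?lexx ?orbT// ge_max ler_norm normr_ge0.
have i2 : integ (fun w => Num.max (- X w) 0).
  apply: integrable_dominated iN _ => // w.
  by rewrite ger0_norm ?le_max ?lexx ?orbT// ge_max normr_ge0 andbT -normrN ler_norm.
transitivity (\int[P]_w (Num.max (X w) 0 - Num.max (- X w) 0)).
  apply: eq_Rintegral => w _; case: (leP 0 (X w)) => h.
    by rewrite max_r ?subr0// lerNl oppr0.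
  by rewrite max_l ?sub0r ?opprK// lerNr oppr0 ltW.
rewrite RintegralB//; apply/eqP; rewrite subr_eq0; apply/eqP.
rewrite /Rintegral (@ge0_integral_law (fun x => Num.max x 0)); last 2 first.
- exact: measurable_maxr.
- by move=> x; rewrite le_max lexx orbT.
rewrite normal_positive_part// (@ge0_integral_law (fun x => Num.max (- x) 0))//.
- by apply: measurable_maxr => //; exact: measurableT_comp.
- by move=> x; rewrite le_max lexx orbT.
Qed.

End NormalLaw.

Section BrownianIncrements.
Context {R : realType} {disp : measure_display} {T : measurableType disp}.
Variables (P : probability T R) (F : R -> set (set T)).
Hypothesis hF : filtration F.
Context {d : nat}.
Variable B : R -> T -> 'cV[R]_d.
Hypothesis hB : brownian_motion P F B.
Local Notation integ X := (P.-integrable [set: T] (fun w => (X w)%:E)).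

Definition increment (s t : R) (i : 'I_d) (w : T) : R := (B t w - B s w) i 0.

Lemma filtration_sub_measurable s : 0 <= s -> F s `<=` measurable.
Proof. by have [_ H _] := hF; exact: H. Qed.

Lemma sigma_algebra_filtration s : 0 <= s -> sigma_algebra setT (F s).
Proof. by have [H _ _] := hF; exact: H. Qed.

Lemma measurable_wrt_filtration s t (Y : T -> R) : 0 <= s -> s <= t ->
  measurable_wrt (F s) Y -> measurable_wrt (F t) Y.
Proof. by move=> s0 st; apply: measurable_wrtS; have [_ _] := hF; apply. Qed.

Lemma measurable_wrt_increment s t i : 0 <= s -> s <= t ->
  measurable_wrt (F t) (increment s t i).
Proof.
move=> s0 st; have [aB _ _ _ _] := hB; have t0 := le_trans s0 st.
have -> : increment s t i = (fun w => B t w i 0 - B s w i 0).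
  by apply/funext => w; rewrite /increment !mxE.
apply: measurable_wrtB; [exact: sigma_algebra_filtration|exact: aB|].
by apply: measurable_wrt_filtration st _ => //; exact: aB.
Qed.

Lemma measurable_increment s t i : 0 <= s -> s <= t ->
  measurable_fun setT (increment s t i).
Proof.
move=> s0 st; apply: (@measurable_wrt_fun R disp T (F t)); last exact: measurable_wrt_increment.
by apply: filtration_sub_measurable; exact: le_trans st.
Qed.

Let increment_law s t (A : 'I_d -> set R) : 0 <= s -> s < t ->
  (forall i, measurable (A i)) ->
  P [set w | forall i, A i (increment s t i w)] =
  (\prod_(i < d) normal_prob 0 (Num.sqrt (t - s)) (A i))%E.
Proof. by have [_ _ _ _ H] := hB => *; exact: H. Qed.

(** The law of one coordinate, obtained by leaving the other ones
    unconstrained. *)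
Lemma increment_law1 s t i A : 0 <= s -> s < t -> measurable A ->
  P (increment s t i @^-1` A) = normal_prob 0 (Num.sqrt (t - s)) A.
Proof.
move=> s0 st mA.
have := @increment_law s t (fun j => if j == i then A else setT) s0 st.
rewrite (bigD1 i)//= eqxx big1 ?mule1 => [<-|j /negbTE ->]; last 2 first.
- by move=> j; case: ifP.
- exact: probability_setT.
congr (P _); apply/seteqP; split => w /= H; last by have := H i; rewrite eqxx.
by move=> j; case: eqP => // ->.
Qed.

Lemma increment_indep s t i j A C : 0 <= s -> s < t -> i != j ->
  measurable A -> measurable C ->
  P (increment s t i @^-1` A `&` increment s t j @^-1` C) =
  (P (increment s t i @^-1` A) * P (increment s t j @^-1` C))%E.
Proof.
move=> s0 st ij mA mC; rewrite !increment_law1//.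
have := @increment_law s t (fun k => if k == i then A else if k == j then C else setT) s0 st.
have ji : j != i by rewrite eq_sym.
rewrite (bigD1 i)//= eqxx (bigD1 j)//= eqxx (negbTE ji) big1 ?mule1; last first.
  by move=> k /andP[/negbTE -> /negbTE ->]; exact: probability_setT.
move=> <-; last by move=> k; do 2 (case: ifP => // _).
congr (P _); apply/seteqP; split => w /= => [[wA wC] k|H].
  by case: eqP => [->//|_]; case: eqP => [->|].
split; first by have := H i; rewrite eqxx.
by have := H j; rewrite (negbTE ji) eqxx.
Qed.

Lemma sqint_increment s t i : 0 <= s -> s <= t -> sqint P (increment s t i).
Proof.
move=> s0; rewrite le_eqVlt => /predU1P[<-|st].
  apply: (@sqint_bounded _ _ _ _ _ 0); first exact: measurable_increment.
  by move=> w; rewrite /increment subrr mxE normr0.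
apply: (@sqint_normal _ _ _ P (Num.sqrt (t - s))).
- by rewrite sqrtr_gt0 subr_gt0.
- by apply: measurable_increment => //; exact: ltW.
- by move=> A mA; exact: increment_law1.
Qed.

Lemma Rintegral_increment s t i : 0 <= s -> s <= t -> \int[P]_w increment s t i w = 0.
Proof.
move=> s0; rewrite le_eqVlt => /predU1P[<-|st].
  under eq_Rintegral do rewrite /increment subrr mxE.
  by rewrite Rintegral_cst// mul0r.
apply: (@Rintegral_normal _ _ _ P (Num.sqrt (t - s))).
- by rewrite sqrtr_gt0 subr_gt0.
- by apply: measurable_increment => //; exact: ltW.
- by move=> A mA; exact: increment_law1.
Qed.

Lemma Rintegral_incrementM s t i j : 0 <= s -> s <= t ->
  \int[P]_w (increment s t i w * increment s t j w) = (i == j)%:R * (t - s).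
Proof.
move=> s0 st'; move: (st'); rewrite le_eqVlt => /predU1P[<-|st].
  under eq_Rintegral do rewrite /increment subrr mxE mul0r.
  by rewrite Rintegral_cst// mul0r subrr mulr0.
have [<-|ij] := eqVneq i j.
  under eq_Rintegral do rewrite -expr2.
  rewrite (@Rintegral_normal_sqr _ _ _ P (Num.sqrt (t - s))).
  - by rewrite sqr_sqrtr ?mul1r// subr_ge0.
  - by rewrite sqrtr_gt0 subr_gt0.
  - exact: measurable_increment.
  - by move=> A mA; exact: increment_law1.
rewrite mul0r (@Rintegral_independentM _ _ _ P (increment s t i) (increment s t j)).
- by rewrite Rintegral_increment// mul0r.
- exact: measurable_increment.
- exact: measurable_increment.
- by move=> A C mA mC; exact: increment_indep.
- by apply: sqint_integrable; exact: sqint_increment.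
- by apply: sqint_integrable; exact: sqint_increment.
- by apply: sqint_mul; exact: sqint_increment.
Qed.

Let future s t := sigma_generated setT (increment s t).

Let measurable_wrt_future s t i : measurable_wrt (future s t) (increment s t i).
Proof.
move=> A AI; apply: sub_sigma_algebra; exists i => //.
Qed.

Let sigma_algebra_future s t : sigma_algebra setT (future s t).
Proof. exact: smallest_sigma_algebra. Qed.

Let future_sub_measurable s t : 0 <= s -> s <= t -> future s t `<=` measurable.
Proof.
move=> s0 st; apply: smallest_sub; first exact: sigma_algebra_measurable.
by move=> A [i _ [C mC <-]]; exact: (measurable_increment i s0 st).
Qed.

Let future_indep s t : 0 <= s -> s < t -> independent P (F s) (future s t).
Proof. by have [_ _ _ H _] := hB => *; exact: H. Qed.

(** The next two lemmas stand for the conditional mean and covariance of an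
    increment given the past. *)
Lemma Rintegral_adapted_increment s t i (Y : T -> R) : 0 <= s -> s <= t ->
  measurable_wrt (F s) Y -> sqint P Y ->
  \int[P]_w (Y w * increment s t i w) = 0.
Proof.
move=> s0 st' mY sY; move: (st'); rewrite le_eqVlt => /predU1P[<-|st].
  under eq_Rintegral do rewrite /increment subrr mxE mulr0.
  by rewrite Rintegral_cst// mul0r.
rewrite (@Rintegral_independent _ _ _ P (F s) (future s t))//.
- by rewrite Rintegral_increment// mulr0.
- exact: filtration_sub_measurable.
- exact: future_sub_measurable.
- exact: future_indep.
- exact: sqint_integrable.
- by apply: sqint_integrable; exact: sqint_increment.
- by apply: sqint_mul => //; exact: sqint_increment.
Qed.

Lemma Rintegral_adapted_incrementM s t i j (Y : T -> R) M : 0 <= s -> s <= t ->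
  measurable_wrt (F s) Y -> (forall w, `|Y w| <= M) ->
  \int[P]_w (Y w * (increment s t i w * increment s t j w)) =
  \int[P]_w Y w * ((i == j)%:R * (t - s)).
Proof.
move=> s0 st' mY YM; have mY' := measurable_wrt_fun (filtration_sub_measurable s0) mY.
move: (st'); rewrite le_eqVlt => /predU1P[<-|st].
  under eq_Rintegral do rewrite /increment subrr mxE mul0r mulr0.
  by rewrite Rintegral_cst// mul0r subrr !mulr0.
rewrite (@Rintegral_independent _ _ _ P (F s) (future s t))//.
- by rewrite Rintegral_incrementM.
- exact: filtration_sub_measurable.
- exact: future_sub_measurable.
- exact: future_indep.
- by apply: measurable_wrtM; [exact: sigma_algebra_future| |]; exact: measurable_wrt_future.
- exact: integrable_bounded YM.
- by apply: sqint_mul; exact: sqint_increment.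
- under eq_fun do rewrite mulrA.
  apply: sqint_mul; last exact: sqint_increment.
  by apply: sqint_bounded_mul YM _ => //; exact: sqint_increment.
Qed.

End BrownianIncrements.

(** * Elementary stochastic integrals *)

Section Elementary.
Context {R : realType} {disp : measure_display} {T : measurableType disp}.
Variables (P : probability T R) (F : R -> set (set T)).
Hypothesis hF : filtration F.
Context {d : nat}.
Variable B : R -> T -> 'cV[R]_d.
Hypothesis hB : brownian_motion P F B.
Local Notation integ X := (P.-integrable [set: T] (fun w => (X w)%:E)).
Local Notation increment := (increment B).

Lemma incrementD a b c i w : increment a b i w + increment b c i w = increment a c i w.
Proof. by rewrite /increment !mxE; ring. Qed.

Let bounded_inc_sqint a b (Y : T -> R) (M : R) i : 0 <= a -> a <= b ->
  measurable_fun setT Y -> (forall w, `|Y w| <= M) ->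
  sqint P (fun w => Y w * increment a b i w).
Proof. by move=> a0 ab mY YM; apply: sqint_bounded_mul YM _ => //; exact: (sqint_increment hF hB). Qed.

Let same_left c b e j k (Y : T -> R) (M : R) : 0 <= c -> c <= b -> b <= e ->
  measurable_wrt (F c) Y -> (forall w, `|Y w| <= M) ->
  \int[P]_w (Y w * (increment c b j w * increment c e k w)) =
  \int[P]_w Y w * ((j == k)%:R * (b - c)).
Proof.
move=> c0 cb be mY YM.
have b0 := le_trans c0 cb; have ce := le_trans cb be.
have mY' := measurable_wrt_fun (filtration_sub_measurable hF c0) mY.
have s1 : sqint P (fun w => Y w * increment c b j w) by exact: bounded_inc_sqint YM.
transitivity (\int[P]_w (Y w * (increment c b j w * increment c b k w)
    + (Y w * increment c b j w) * increment b e k w)).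
  by apply: eq_Rintegral => w _; rewrite -(incrementD c b e); ring.
rewrite RintegralD//; last 2 first.
- under eq_fun do rewrite mulrA.
  by apply: sqint_mul => //; exact: (sqint_increment hF hB).
- by apply: sqint_mul => //; exact: (sqint_increment hF hB).
rewrite (Rintegral_adapted_incrementM hF hB _ _ c0 cb mY YM).
rewrite (Rintegral_adapted_increment hF hB) ?addr0//.
apply: measurable_wrtM; first exact: (sigma_algebra_filtration hF).
  exact: (measurable_wrt_filtration hF c0 cb).
exact: (measurable_wrt_increment hF hB).
Qed.

(** The length of the intersection of the intervals ]a, b] and ]c, e]. *)
Definition overlap (a b c e : R) := Num.max 0 (Num.min b e - Num.max a c).

Lemma overlapC a b c e : overlap a b c e = overlap c e a b.
Proof. by rewrite /overlap [Num.min b e]minC [Num.max a c]maxC. Qed.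

(** If a <= c, the part of the increment over ]a, b] that lies before c is known
    at time c, where the other increment starts, and is orthogonal to it; the
    remaining part shares its left end point with ]c, e], and only the common
    interval contributes. *)
Lemma Rintegral_increment_pair a b c e j k (p q : T -> R) (M : R) :
  0 <= a -> a <= b -> 0 <= c -> c <= e ->
  measurable_wrt (F a) p -> measurable_wrt (F c) q ->
  (forall w, `|p w| <= M) -> (forall w, `|q w| <= M) ->
  \int[P]_w ((p w * increment a b j w) * (q w * increment c e k w)) =
  \int[P]_w (p w * q w) * ((j == k)%:R * overlap a b c e).
Proof.
wlog ac : a b c e j k p q / a <= c.
  move=> H a0 ab c0 ce mp mq pM qM; case: (leP a c) => [ac|/ltW ca]; first exact: H.
  have := H c e a b k j q p ca c0 ce a0 ab mq mp qM pM.
  rewrite overlapC [k == j]eq_sym.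
  under [in RHS]eq_Rintegral do rewrite mulrC.
  by move=> <-; apply: eq_Rintegral => w _; rewrite mulrC.
move=> a0 ab c0 ce mp mq pM qM; have e0 := le_trans c0 ce.
have mp' := measurable_wrt_fun (filtration_sub_measurable hF a0) mp.
have mq' := measurable_wrt_fun (filtration_sub_measurable hF c0) mq.
have mpc := measurable_wrt_filtration hF a0 ac mp.
have mpq : measurable_wrt (F c) (fun w => p w * q w).
  by apply: measurable_wrtM => //; exact: (sigma_algebra_filtration hF).
have mpq' := measurable_wrt_fun (filtration_sub_measurable hF c0) mpq.
have M0 : 0 <= M by apply: le_trans (pM point).
have pqM w : `|p w * q w| <= M ^+ 2 by rewrite normrM expr2 ler_pM.
have mac := measurable_wrt_increment hF hB.
have past b' : a <= b' -> b' <= c ->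
    \int[P]_w ((p w * q w * increment a b' j w) * increment c e k w) = 0.
  move=> ab' b'c; apply: (Rintegral_adapted_increment hF hB) => //; last exact: bounded_inc_sqint pqM.
  apply: measurable_wrtM => //; first exact: (sigma_algebra_filtration hF).
  by apply: (measurable_wrt_filtration hF _ b'c); [exact: le_trans ab'|exact: mac].
case: (leP b c) => [bc|/ltW cb].
  have -> : overlap a b c e = 0.
    rewrite /overlap (max_r ac); apply/max_idPl; rewrite subr_le0.
    by rewrite ge_min bc.
  rewrite !mulr0 -[RHS](past b)//.
  by apply: eq_Rintegral => w _; ring.
transitivity (\int[P]_w ((p w * q w * increment a c j w) * increment c e k w +
   p w * q w * (increment c b j w * increment c e k w))).
  by apply: eq_Rintegral => w _; rewrite -(incrementD a c b); ring.
rewrite RintegralD//; last 2 first.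
- by apply: sqint_mul; [exact: bounded_inc_sqint pqM|exact: (sqint_increment hF hB)].
- under eq_fun do rewrite mulrA.
  by apply: sqint_mul; [exact: bounded_inc_sqint pqM|exact: (sqint_increment hF hB)].
rewrite past// add0r /overlap (max_r ac).
have -> : Num.max 0 (Num.min b e - c) = Num.min b e - c.
  by apply: max_r; rewrite subr_ge0 le_min cb ce.
case: (leP b e) => [be|/ltW eb]; first exact: same_left pqM.
rewrite [j == k]eq_sym -(@same_left c e b k j _ (M ^+ 2))//.
by apply: eq_Rintegral => w _; congr (_ * _); rewrite mulrC.
Qed.

Section Family.
Context {I : finType}.
Variables (a b : I -> R) (xi : I -> T -> 'M[R]_d) (t M : R).
Hypothesis a0 : forall i, 0 <= a i.
Hypothesis ab : forall i, a i <= b i.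
Hypothesis bt : forall i, b i <= t.
Hypothesis mxi : forall i j k, measurable_wrt (F (a i)) (fun w => xi i w j k).
Hypothesis xiM : forall i w j k, `|xi i w j k| <= M.

(** The intervals ]a i, b i] may overlap and come in any order. This makes the
    difference of two simple processes on unrelated partitions a process of the
    same kind, with no common refinement of the partitions. *)
Definition family_eval (s : R) (w : T) : 'M[R]_d :=
  \sum_i (a i < s <= b i)%R%:R *: xi i w.

Definition family_integral (w : T) : 'cV[R]_d :=
  \sum_i xi i w *m (B (b i) w - B (a i) w).

Let mxi' i j k : measurable_fun setT (fun w => xi i w j k).
Proof.
by apply: (@measurable_wrt_fun R disp T (F (a i))) => //; exact: (filtration_sub_measurable hF).
Qed.

Let term (q : 'I_d) (x : I * 'I_d) (w : T) :=
  xi x.1 w q x.2 * increment (a x.1) (b x.1) x.2 w.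

Let family_integralE w q : family_integral w q 0 = \sum_x term q x w.
Proof.
rewrite /family_integral summxE -(pair_bigA _ (fun i j => term q (i, j) w)) /=.
by apply: eq_bigr => i _; rewrite !mxE; apply: eq_bigr.
Qed.

Let sqint_term q x : sqint P (term q x).
Proof. by apply: (@bounded_inc_sqint _ _ _ M). Qed.

Lemma sqint_family_integral q : sqint P (fun w => family_integral w q 0).
Proof.
by under eq_fun do rewrite family_integralE; apply: sqint_sum.
Qed.

(** The integral over time of the squared process, as a double sum over the
    overlaps of the intervals; the moments of the increments turn the expected
    square of the stochastic integral into the expectation of the same sum. *)
Definition family_energy (w : T) : R :=
  \sum_i \sum_j overlap (a i) (b i) (a j) (b j) *
    \sum_q \sum_k (xi i w q k * xi j w q k).

Let integ_xixi i j q k l : integ (fun w => xi i w q k * xi j w q l).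
Proof. by apply: sqint_mul; apply: (@sqint_bounded _ _ _ _ _ M). Qed.

Let integ_frob i j : integ (fun w => \sum_q \sum_k (xi i w q k * xi j w q k)).
Proof. by apply: integrable_sumr => q; apply: integrable_sumr => k. Qed.

Let integ_scaled_frob i j : integ (fun w =>
  overlap (a i) (b i) (a j) (b j) * \sum_q \sum_k (xi i w q k * xi j w q k)).
Proof. exact: (integrableZl measurableT _ (integ_frob i j)). Qed.

Lemma integrable_family_energy : integ family_energy.
Proof. by apply: integrable_sumr => i; apply: integrable_sumr => j. Qed.

Lemma family_isometry :
  \int[P]_w dot (family_integral w) (family_integral w) = \int[P]_w family_energy w.
Proof.
have itt q x y : integ (fun w => term q x w * term q y w) by exact: sqint_mul.
transitivity (\sum_q \sum_x \sum_y \int[P]_w (term q x w * term q y w)).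
  transitivity (\int[P]_w (\sum_q \sum_x \sum_y term q x w * term q y w)).
    apply: eq_Rintegral => w _; apply: eq_bigr => q _.
    by rewrite family_integralE mulr_suml; apply: eq_bigr => x _; rewrite mulr_sumr.
  rewrite Rintegral_sumr => [|q]; last first.
    by apply: integrable_sumr => x; exact: integrable_sumr.
  apply: eq_bigr => q _; rewrite Rintegral_sumr => [|x]; last exact: integrable_sumr.
  by apply: eq_bigr => x _; rewrite Rintegral_sumr.
pose e q i j k := \int[P]_w (xi i w q k * xi j w q k).
pose ov i j := overlap (a i) (b i) (a j) (b j).
transitivity (\sum_i \sum_j ov i j * \sum_q \sum_k e q i j k); last first.
  rewrite Rintegral_sumr => [|i]; last by apply: integrable_sumr => j.
  apply: eq_bigr => i _; rewrite Rintegral_sumr//; apply: eq_bigr => j _.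
  transitivity (ov i j * \int[P]_w (\sum_q \sum_k (xi i w q k * xi j w q k))); last first.
    exact: (esym (RintegralZl _ measurableT (integ_frob i j))).
  congr (_ * _); rewrite Rintegral_sumr => [|q]; last by apply: integrable_sumr => k.
  by apply: eq_bigr => q _; rewrite Rintegral_sumr.
transitivity (\sum_q \sum_i \sum_k \sum_j (ov i j * e q i j k)).
  apply: eq_bigr => q _; rewrite [RHS]pair_bigA; apply: eq_bigr => -[i k] _ /=.
  rewrite -(pair_bigA _ (fun j l => \int[P]_w (term q (i, k) w * term q (j, l) w))) /=.
  apply: eq_bigr => j _; rewrite (bigD1 k)//= big1 => [|l lk].
    rewrite addr0 /term /= (@Rintegral_increment_pair _ _ _ _ _ _ _ _ M)//.
    by rewrite eqxx mul1r mulrC.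
  rewrite /term /= (@Rintegral_increment_pair _ _ _ _ _ _ _ _ M)//.
  by rewrite eq_sym (negbTE lk) mul0r mulr0.
rewrite exchange_big; apply: eq_bigr => i _.
under eq_bigr do rewrite exchange_big.
rewrite exchange_big; apply: eq_bigr => j _; rewrite mulr_sumr.
by apply: eq_bigr => q _; rewrite mulr_sumr.
Qed.

Lemma integral_family_eval (w : T) :
  (\int[lebesgue_measure]_(s in `[0%R, t]) (enorm (family_eval s w) ^+ 2)%:E =
   (family_energy w)%:E)%E.
Proof.
pose frob i j := \sum_q \sum_k (xi i w q k * xi j w q k).
pose J i j := `]Num.max (a i) (a j), Num.min (b i) (b j)]%classic.
have evalE s : enorm (family_eval s w) ^+ 2 = \sum_i \sum_j frob i j * \1_(J i j) s.
  rewrite frobenius_sqr.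
  transitivity (\sum_q \sum_k \sum_i \sum_j
      (xi i w q k * xi j w q k) * \1_(J i j) s).
    apply: eq_bigr => q _; apply: eq_bigr => k _.
    rewrite summxE expr2 mulr_suml; apply: eq_bigr => i _.
    rewrite mulr_sumr; apply: eq_bigr => j _; rewrite !mxE indicE.
    have -> : (s \in J i j) = (a i < s <= b i) && (a j < s <= b j).
      by rewrite /J mem_setE in_itv /= gt_max le_min andbACA.
    by case: (a i < s <= b i); case: (a j < s <= b j) => /=; rewrite ?mul0r ?mulr0 ?mul1r ?mulr1.
  under eq_bigr do rewrite exchange_big.
  rewrite exchange_big; apply: eq_bigr => i _.
  under eq_bigr do rewrite exchange_big.
  rewrite exchange_big; apply: eq_bigr => j _; rewrite mulr_suml.
  by apply: eq_bigr => q _; rewrite mulr_suml.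
have bw i j : J i j `<=` `[0, t].
  move=> s; rewrite /J /= !in_itv /= gt_max le_min => /andP[/andP[as_ _] /andP[sb _]].
  by rewrite (ltW (le_lt_trans (a0 i) as_)) (le_trans sb (bt i)).
have iJ i j : lebesgue_measure.-integrable (`[0, t] : set (measurableTypeR R))
    (fun s => (frob i j * \1_(J i j) s)%:E).
  have mI : measurable (`[0, t]%classic : set (measurableTypeR R)) by exact: measurable_itv.
  have i1 := integrableS measurableT mI (@subsetT _ _) (integrable_indic_itv
    (Num.max (a i) (a j)) (Num.min (b i) (b j)) false false).
  exact: eq_integrable (integrableZl mI (frob i j) i1).
have intJ i j : (\int[lebesgue_measure]_(s in `[0%R, t]) (frob i j * \1_(J i j) s)%:E =
    (overlap (a i) (b i) (a j) (b j) * frob i j)%:E)%E.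
  under eq_integral do rewrite EFinM.
  rewrite integralZl//; last first.
    by apply: (@integrableS _ _ _ _ setT) => //; exact: integrable_indic_itv.
  rewrite integral_indic//; last exact: measurable_itv.
  rewrite /= (setIidl (@bw i j)) /J lebesgue_measure_itv /= lte_fin mulrC EFinM /overlap; congr (_ * _)%E.
  case: ltP => h.
    by rewrite -EFinB; congr EFin; apply/esym/max_r; rewrite subr_ge0 ltW.
  by congr EFin; apply/esym/max_l; rewrite subr_le0.
transitivity (\int[lebesgue_measure]_(s in `[0%R, t])
    \sum_i \sum_j (frob i j * \1_(J i j) s)%:E)%E.
  by apply: eq_integral => s _; rewrite evalE -sumEFin; apply: eq_bigr => i _; rewrite sumEFin.
rewrite integral_sum//; last first.
  by move=> i; apply: integrable_sum => // j _; exact: iJ.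
rewrite /family_energy -sumEFin; apply: eq_bigr => i _.
rewrite integral_sum//.
by rewrite -sumEFin; apply: eq_bigr => j _; exact: intJ.
Qed.

Lemma ge0_family_isometry :
  (\int[P]_w (enorm (family_integral w) ^+ 2)%:E =
   \int[P]_w \int[lebesgue_measure]_(s in `[0%R, t]) (enorm (family_eval s w) ^+ 2)%:E)%E.
Proof.
under [RHS]eq_integral do rewrite integral_family_eval.
under [LHS]eq_integral do rewrite enorm_sqr.
have iI : integ (fun w => dot (family_integral w) (family_integral w)).
  apply: integrable_sumr => q.
  by apply: sqint_mul; exact: sqint_family_integral.
rewrite -(fineK (integrable_fin_num measurableT iI)).
rewrite -(fineK (integrable_fin_num measurableT integrable_family_energy)).
by congr EFin; exact: family_isometry.
Qed.

(** All the increments lie after s, hence are centred given Z. *)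
Lemma family_integral_orthogonal (Z : T -> 'cV[R]_d) (s : R) : 0 <= s ->
  (forall i, s <= a i) ->
  (forall q, measurable_wrt (F s) (fun w => Z w q 0)) ->
  (forall q, sqint P (fun w => Z w q 0)) ->
  \int[P]_w dot (Z w) (family_integral w) = 0.
Proof.
move=> s0 sa mZ sZ.
have szx q i k : sqint P (fun w => Z w q 0 * xi i w q k).
  by under eq_fun do rewrite mulrC; apply: (@sqint_bounded_mul _ _ _ _ _ _ M).
have iz q x : integ (fun w => Z w q 0 * term q x w).
  by apply: sqint_mul.
transitivity (\sum_q \sum_x \int[P]_w (Z w q 0 * term q x w)).
  transitivity (\int[P]_w (\sum_q \sum_x Z w q 0 * term q x w)).
    apply: eq_Rintegral => w _; apply: eq_bigr => q _.
    by rewrite family_integralE mulr_sumr.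
  rewrite Rintegral_sumr => [|q]; last exact: integrable_sumr.
  by apply: eq_bigr => q _; rewrite Rintegral_sumr.
apply: big1 => q _; apply: big1 => -[i k] _.
under eq_Rintegral do rewrite /term /= mulrA.
apply: (Rintegral_adapted_increment hF hB) => //.
apply: measurable_wrtM => //; first exact: (sigma_algebra_filtration hF).
exact: (measurable_wrt_filtration hF s0 (sa i)).
Qed.

End Family.

End Elementary.

(** * Iterated integrals over a strip *)

Section IteratedIntegrals.
Local Open Scope ereal_scope.

Lemma ge0_integral_le2 {R : realType} {d : measure_display} {T : measurableType d}
    (mu : {measure set T -> \bar R}) (D : set T) (f g1 g2 : T -> \bar R) (c e : R) :
  measurable D -> measurable_fun D f -> measurable_fun D g1 -> measurable_fun D g2 ->
  (forall x, D x -> 0 <= f x) -> (forall x, D x -> 0 <= g1 x) ->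
  (forall x, D x -> 0 <= g2 x) -> (0 <= c)%R -> (0 <= e)%R ->
  (forall x, D x -> f x <= c%:E * g1 x + e%:E * g2 x) ->
  \int[mu]_(x in D) f x <= c%:E * \int[mu]_(x in D) g1 x + e%:E * \int[mu]_(x in D) g2 x.
Proof.
move=> mD mf m1 m2 f0 g10 g20 c0 e0 fg.
rewrite -ge0_integralZl ?lee_fin//.
rewrite -ge0_integralZl ?lee_fin//.
rewrite -ge0_integralD//.
- apply: ge0_le_integral => //.
  by apply: emeasurable_funD; exact: measurable_funeM.
- by move=> x Dx; rewrite mule_ge0 ?lee_fin// g10.
- exact: measurable_funeM.
- by move=> x Dx; rewrite mule_ge0 ?lee_fin// g20.
- exact: measurable_funeM.
Qed.

Context {R : realType} {disp : measure_display} {T : measurableType disp}.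
Variable P : probability T R.
Local Notation mu := (@lebesgue_measure R).
Variable D : set (measurableTypeR R).
Hypothesis mD : measurable D.

Definition jointly_measurable (Phi : R -> T -> R) :=
  measurable_fun (D `*` setT) (fun p : measurableTypeR R * T => Phi p.1 p.2).

(** Measurability is only available on the strip over D, whereas the theorems
    of Tonelli concern functions on the whole product: extend by 0. *)
Let ext (Phi : R -> T -> R) : measurableTypeR R * T -> \bar R :=
  (fun p => (Phi p.1 p.2)%:E) \_ (D `*` setT).

Let mext Phi : jointly_measurable Phi -> measurable_fun setT (ext Phi).
Proof.
move=> mPhi; apply/(measurable_restrictT _ _).1; first exact: measurableX.
exact/measurable_EFinP.
Qed.

Let ext_ge0 (Phi : R -> T -> R) p : (forall s w, D s -> (0 <= Phi s w)%R) -> 0 <= ext Phi p.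
Proof.
move=> H; apply: erestrict_ge0 => -[s w] [/= Ds _].
by rewrite lee_fin H.
Qed.

Let extE Phi w : \int[mu]_(s in D) (Phi s w)%:E = \int[mu]_s ext Phi (s, w).
Proof.
rewrite integral_mkcond; apply: eq_integral => s _; rewrite /ext !patchE.
by rewrite in_setX /= in_setT andbT.
Qed.

Lemma measurable_section Phi w : jointly_measurable Phi ->
  measurable_fun D (Phi ^~ w : measurableTypeR R -> R).
Proof.
move=> /mext mPhi.
have : measurable_fun setT (fun s : measurableTypeR R => ext Phi (s, w)).
  apply: (measurableT_comp mPhi); exact: measurable_pair2.
have -> : (fun s : measurableTypeR R => ext Phi (s, w)) = ((fun s => (Phi s w)%:E) \_ D).
  by apply/funext => s; rewrite /ext !patchE in_setX /= in_setT andbT.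
by move=> /(measurable_restrictT _ mD) /measurable_EFinP.
Qed.

Lemma measurable_inner_integral (Phi : R -> T -> R) : jointly_measurable Phi ->
  (forall s w, D s -> (0 <= Phi s w)%R) ->
  measurable_fun setT (fun w => \int[mu]_(s in D) (Phi s w)%:E).
Proof.
move=> mPhi Phi0; under eq_fun do rewrite extE.
apply: (@measurable_fun_fubini_tonelli_G _ _ _ _ _ mu (ext Phi)); first exact: mext.
by move=> p; exact: ext_ge0.
Qed.

Lemma tonelli_strip (Phi : R -> T -> R) : jointly_measurable Phi ->
  (forall s w, D s -> (0 <= Phi s w)%R) ->
  \int[P]_w \int[mu]_(s in D) (Phi s w)%:E = \int[mu]_(s in D) \int[P]_w (Phi s w)%:E.
Proof.
move=> mPhi Phi0; under eq_integral do rewrite extE.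
rewrite -(@fubini_tonelli _ _ _ _ _ mu P (ext Phi)); last 2 first.
- exact: mext.
- by move=> p; exact: ext_ge0.
rewrite [RHS]integral_mkcond; apply: eq_integral => s _; rewrite patchE /ext.
case: ifPn => sD; first by apply: eq_integral => w _; rewrite patchE in_setX /= sD in_setT.
by rewrite integral0_eq// => w _; rewrite patchE in_setX /= (negbTE sD).
Qed.

Lemma iterated_integral_le2 (Phi Psi1 Psi2 : R -> T -> R) (c e : R) :
  jointly_measurable Phi -> jointly_measurable Psi1 -> jointly_measurable Psi2 ->
  (forall s w, D s -> (0 <= Phi s w)%R) -> (forall s w, D s -> (0 <= Psi1 s w)%R) ->
  (forall s w, D s -> (0 <= Psi2 s w)%R) -> (0 <= c)%R -> (0 <= e)%R ->
  (forall s w, D s -> (Phi s w <= c * Psi1 s w + e * Psi2 s w)%R) ->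
  \int[P]_w \int[mu]_(s in D) (Phi s w)%:E <=
  c%:E * \int[P]_w \int[mu]_(s in D) (Psi1 s w)%:E +
  e%:E * \int[P]_w \int[mu]_(s in D) (Psi2 s w)%:E.
Proof.
move=> m0 m1 m2 p0 p1 p2 c0 e0 H.
have ms Phi0 w : jointly_measurable Phi0 -> measurable_fun D (fun s => (Phi0 s w)%:E).
  by move=> mm; apply/measurable_EFinP; exact: measurable_section.
apply: ge0_integral_le2 => //; try exact: measurable_inner_integral.
- by move=> w _; apply: integral_ge0 => s Ds; rewrite lee_fin p0.
- by move=> w _; apply: integral_ge0 => s Ds; rewrite lee_fin p1.
- by move=> w _; apply: integral_ge0 => s Ds; rewrite lee_fin p2.
- move=> w _; apply: ge0_integral_le2 => //; try exact: ms.
  + by move=> s Ds; rewrite lee_fin p0.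
  + by move=> s Ds; rewrite lee_fin p1.
  + by move=> s Ds; rewrite lee_fin p2.
  + by move=> s Ds; rewrite -!EFinM -EFinD lee_fin H.
Qed.

Lemma iterated_integral_le_cst (Phi : R -> T -> R) (k : R -> R) :
  jointly_measurable Phi -> measurable_fun D (k : measurableTypeR R -> R) ->
  (forall s w, D s -> (0 <= Phi s w <= k s)%R) ->
  \int[P]_w \int[mu]_(s in D) (Phi s w)%:E <= \int[mu]_(s in D) (k s)%:E.
Proof.
move=> mPhi mk H.
have k0 s : D s -> (0 <= k s)%R.
  by move=> /(H s point) /andP[a b]; exact: le_trans b.
apply: (@le_trans _ _ (\int[P]_w \int[mu]_(s in D) (k s)%:E)).
  apply: ge0_le_integral => //.
  - by move=> w _; apply: integral_ge0 => s Ds; rewrite lee_fin; case/andP: (H s w Ds).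
  - by apply: measurable_inner_integral => // s w Ds; case/andP: (H s w Ds).
  - move=> w _; apply: ge0_le_integral => //.
    + by move=> s Ds; rewrite lee_fin; case/andP: (H s w Ds).
    + by apply/measurable_EFinP; exact: measurable_section.
    + exact/measurable_EFinP.
    + by move=> s Ds; rewrite lee_fin; case/andP: (H s w Ds).
rewrite integral_cst//= probability_setT mule1//.
Qed.

End IteratedIntegrals.

(** * Increments of the stochastic integral *)

Section ItoIncrement.
Context {R : realType} {disp : measure_display} {T : measurableType disp}.
Variables (P : probability T R) (F : R -> set (set T)).
Hypothesis hF : filtration F.
Context {d : nat}.
Variable B : R -> T -> 'cV[R]_d.
Hypothesis hB : brownian_motion P F B.
Local Notation integ X := (P.-integrable [set: T] (fun w => (X w)%:E)).
Local Notation mu := (@lebesgue_measure R).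

Section SimpleFamily.
Variables (t : R) (S : simple_process R T d).
Hypothesis hS : is_simple F t S.
Let time_mono j : (j <= sp_size S)%N -> forall i, (i <= j)%N ->
  sp_time S i <= sp_time S j.
Proof.
have [_ _ H _ _] := hS.
elim: j => [_ i|j IH jn i]; first by rewrite leqn0 => /eqP ->.
rewrite leq_eqVlt => /predU1P[->//|]; rewrite ltnS => ij.
by apply: le_trans (IH (ltnW jn) _ ij) _; exact/ltW/H.
Qed.

Lemma simple_start_ge0 (k : 'I_(sp_size S)) : 0 <= sp_time S k.
Proof. by have [<- _ _ _ _] := hS; apply: time_mono => //; exact: ltnW. Qed.

Lemma simple_start_le_end (k : 'I_(sp_size S)) : sp_time S k <= sp_time S k.+1.
Proof. by apply: time_mono => //; exact: ltn_ord. Qed.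

Lemma simple_end_le (k : 'I_(sp_size S)) : sp_time S k.+1 <= t.
Proof. by have [_ <- _ _ _] := hS; apply: time_mono => //; exact: ltn_ord. Qed.

Lemma simple_value_adapted (k : 'I_(sp_size S)) i j :
  measurable_wrt (F (sp_time S k)) (fun w => sp_val S k w i j).
Proof. by have [_ _ _ H _] := hS; exact: H. Qed.

Lemma simple_value_bounded :
  exists M, forall (k : 'I_(sp_size S)) w i j, `|sp_val S k w i j| <= M.
Proof.
have [_ _ _ _ [M H]] := hS; exists M => k w i j.
by apply: le_trans (entry_le_enorm _ _ _) _; exact: H.
Qed.

Lemma sp_evalE s w : sp_eval S s w =
  family_eval (fun k : 'I_(sp_size S) => sp_time S k) (fun k => sp_time S k.+1)
    (fun k => sp_val S k) s w.
Proof.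
rewrite /sp_eval /family_eval big_mkcond; apply: eq_bigr => k _ /=.
by case: ifP => _; rewrite ?scale1r ?scale0r.
Qed.

End SimpleFamily.

Lemma measurable_family_eval (D : set (measurableTypeR R)) (I : finType) (a b : I -> R)
    (xi : I -> T -> 'M[R]_d) i j :
  (forall k, measurable_fun setT (fun w => xi k w i j)) ->
  jointly_measurable D (fun s w => family_eval a b xi s w i j).
Proof.
move=> mxi; apply: measurable_funTS.
have -> : (fun p : measurableTypeR R * T => family_eval a b xi p.1 p.2 i j) =
    (fun p => \sum_k \1_(`]a k, b k]%classic) p.1 * xi k p.2 i j).
  apply/funext => p; rewrite /family_eval summxE; apply: eq_bigr => k _.
  by rewrite mxE indicE mem_setE in_itv.
apply: measurable_sum => k; apply: measurable_funM.
  have m1 : measurable_fun (setT : set (measurableTypeR R))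
      (\1_(`]a k, b k]%classic) : measurableTypeR R -> R) by exact: measurable_indic.
  exact: (measurableT_comp m1 measurable_fst).
by apply: (measurableT_comp (mxi k)); exact: measurable_snd.
Qed.

Lemma jointly_measurable_enorm_sqr (D : set (measurableTypeR R)) m n
    (H : R -> T -> 'M[R]_(m, n)) :
  (forall i j, jointly_measurable D (fun s w => H s w i j)) ->
  jointly_measurable D (fun s w => enorm (H s w) ^+ 2).
Proof.
move=> mH; rewrite /jointly_measurable; under eq_fun do rewrite frobenius_sqr.
apply: measurable_sum => i; apply: measurable_sum => j.
by apply: measurable_funX; exact: mH.
Qed.

Lemma measurable_enorm_sqr (Y : T -> 'cV[R]_d) :
  (forall i, measurable_fun setT (fun w => Y w i 0)) ->
  measurable_fun setT (fun w => enorm (Y w) ^+ 2).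
Proof.
move=> mY; under eq_fun do rewrite frobenius_sqr.
by apply: measurable_sum => i; apply: measurable_sum => j; apply: measurable_funX; rewrite ord1.
Qed.

Lemma second_moment_le (Y : T -> 'cV[R]_d) (c : R) :
  (forall i, measurable_fun setT (fun w => Y w i 0)) ->
  (\int[P]_w (enorm (Y w) ^+ 2)%:E <= c%:E)%E ->
  (forall i, sqint P (fun w => Y w i 0)) /\ \int[P]_w dot (Y w) (Y w) <= c.
Proof.
move=> mY Yc.
have iY : integ (fun w => enorm (Y w) ^+ 2).
  apply/integrableP; split; first by apply/measurable_EFinP; exact: measurable_enorm_sqr.
  apply: le_lt_trans (ltry c); apply: le_trans Yc; apply: ge0_le_integral => //.
  - by do 2 apply: measurableT_comp => //; apply: measurable_enorm_sqr.
  - by apply/measurable_EFinP; exact: measurable_enorm_sqr.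
  - by move=> w _; rewrite /= ger0_norm ?sqr_ge0.
split.
  move=> i; apply: (sqint_le (mY i) iY) => w.
  by rewrite -real_normK ?num_real// ler_pXn2r ?nnegrE ?enorm_ge0// entry_le_enorm.
rewrite -lee_fin; apply: le_trans Yc.
rewrite /Rintegral fineK; last first.
  by under eq_fun do rewrite -enorm_sqr; exact: integrable_fin_num iY.
by under eq_integral do rewrite -enorm_sqr.
Qed.

Lemma integrable_addr (X Y : T -> R) : integ X -> integ Y -> integ (fun w => X w + Y w).
Proof. by move=> iX iY; under eq_fun do rewrite EFinD; exact: integrableD. Qed.

Lemma integrable_scaler (c : R) (X : T -> R) : integ X -> integ (fun w => c * X w).
Proof. by move=> iX; under eq_fun do rewrite EFinM; exact: integrableZl. Qed.

Lemma integrable_dot (Y Z : T -> 'cV[R]_d) :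
  (forall i, sqint P (fun w => Y w i 0)) -> (forall i, sqint P (fun w => Z w i 0)) ->
  integ (fun w => dot (Y w) (Z w)).
Proof. by move=> sY sZ; apply: integrable_sumr => i; exact: sqint_mul. Qed.

(** Let S0 and S1 be simple processes approximating H on [0, s] and on [0, t].
    The difference of their integrals splits into V, the integral of S1 over
    ]s, t], and W, the integral of S1 - S0 over ]0, s]. Since S0 and S1 are both
    close to H before s, the energy of W is small, and V approximates I1 - I0.
    Each of the four given approximation errors is
    at most eps^2. *)
Section Increment.
Variables (s t : R) (H : R -> T -> 'M[R]_d) (I0 I1 : T -> 'cV[R]_d).
Hypothesis s0 : 0 <= s.
Hypothesis st : s <= t.
Hypothesis hI0 : is_ito_integral P F B s H I0.
Hypothesis hI1 : is_ito_integral P F B t H I1.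
Variables (k : R -> R).
Hypothesis mk : measurable_fun (`[0, t] : set (measurableTypeR R)) (k : measurableTypeR R -> R).
Hypothesis Hk : forall r w, 0 <= r <= t -> enorm (H r w) ^+ 2 <= k r.
Variable K : R.
Hypothesis kK : (\int[mu]_(r in `[0%R, t]) (k r * (s < r)%R%:R)%:E <= K%:E)%E.

Let sqE (Y : T -> 'cV[R]_d) := (\int[P]_w (enorm (Y w) ^+ 2)%:E)%E.
Let J w := I1 w - I0 w.

Let mI0 i : measurable_fun setT (fun w => I0 w i 0).
Proof. by have [_ H0 _] := hI0; exact: H0. Qed.
Let mI1 i : measurable_fun setT (fun w => I1 w i 0).
Proof. by have [_ H0 _] := hI1; exact: H0. Qed.

Let mJ i : measurable_fun setT (fun w => J w i 0).
Proof. by under eq_fun do rewrite !mxE; exact: measurable_funB. Qed.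

Let measurable_sq (Y : T -> 'cV[R]_d) : (forall i, measurable_fun setT (fun w => Y w i 0)) ->
  measurable_fun setT (fun w => (enorm (Y w) ^+ 2)%:E).
Proof.
move=> mY; apply/measurable_EFinP; under eq_fun do rewrite frobenius_sqr.
by apply: measurable_sum => i; apply: measurable_sum => j; apply: measurable_funX; rewrite ord1.
Qed.

Let sqE_le2 (Y Y1 Y2 : T -> 'cV[R]_d) c e :
  (forall i, measurable_fun setT (fun w => Y w i 0)) ->
  (forall i, measurable_fun setT (fun w => Y1 w i 0)) ->
  (forall i, measurable_fun setT (fun w => Y2 w i 0)) -> 0 <= c -> 0 <= e ->
  (forall w, enorm (Y w) ^+ 2 <= c * enorm (Y1 w) ^+ 2 + e * enorm (Y2 w) ^+ 2) ->
  (sqE Y <= c%:E * sqE Y1 + e%:E * sqE Y2)%E.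
Proof.
move=> m0 m1 m2 c0 e0 le; apply: ge0_integral_le2 => //; try exact: measurable_sq.
- by move=> w _; rewrite lee_fin sqr_ge0.
- by move=> w _; rewrite lee_fin sqr_ge0.
- by move=> w _; rewrite lee_fin sqr_ge0.
by move=> w _; rewrite -!EFinM -EFinD lee_fin.
Qed.

Let DI (u : R) (Phi : R -> T -> 'M[R]_d) :=
  (\int[P]_w \int[mu]_(r in `[0%R, u]) (enorm (Phi r w) ^+ 2)%:E)%E.

Let mH i j : jointly_measurable `[0, t] (fun s w => H s w i j).
Proof. by have [[H0 _ _] _ _] := hI1; exact: H0. Qed.

Variables (S0 S1 : simple_process R T d) (eps : R).
Hypothesis hS0 : is_simple F s S0.
Hypothesis hS1 : is_simple F t S1.
Hypothesis eps0 : 0 < eps.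
Hypothesis eps1 : eps <= 1.
Local Notation delta := (eps ^+ 2)%:E.
Hypothesis e1 : (DI s (fun r w => sp_eval S0 r w - H r w)%R <= delta)%E.
Hypothesis e2 : (DI t (fun r w => sp_eval S1 r w - H r w)%R <= delta)%E.
Hypothesis e3 : (sqE (fun w => sp_integral S0 B w - I0 w)%R <= delta)%E.
Hypothesis e4 : (sqE (fun w => sp_integral S1 B w - I1 w)%R <= delta)%E.

Let n1 := sp_size S1.
Let n0 := sp_size S0.
Let a1 (i : 'I_n1) := Num.max s (sp_time S1 i).
Let b1 (i : 'I_n1) := Num.max s (sp_time S1 i.+1).
Let V := family_integral B a1 b1 (fun i : 'I_n1 => sp_val S1 i).
(* an interval of S1 that starts after s is truncated to ]s, s]; its value,
   which is not known at time s, is replaced by 0 *)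
Let a2 (i : 'I_n1 + 'I_n0) :=
  match i with inl i => Num.min s (sp_time S1 i) | inr i => sp_time S0 i end.
Let b2 (i : 'I_n1 + 'I_n0) :=
  match i with inl i => Num.min s (sp_time S1 i.+1) | inr i => sp_time S0 i.+1 end.
Let xi2 (i : 'I_n1 + 'I_n0) :=
  match i with inl i => (fun w => (sp_time S1 i <= s)%R%:R *: sp_val S1 i w) | inr i => (fun w => - sp_val S0 i w) end.
Let W := family_integral B a2 b2 xi2.

Let splitVW w : sp_integral S1 B w - sp_integral S0 B w = V w + W w.
Proof.
rewrite /W /V /family_integral big_sumType /= addrA -big_split /=; congr (_ + _).
  apply: eq_bigr => i _; rewrite /a1 /b1.
  have ii : sp_time S1 i <= sp_time S1 i.+1 := simple_start_le_end hS1 i.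
  case: (leP (sp_time S1 i) s) => h; rewrite ?scale1r ?scale0r.
    rewrite -mulmxDr; congr (_ *m _).
    case: (leP s (sp_time S1 i.+1)) => _; rewrite ?subrr ?add0r //.
    by rewrite addrA subrK.
  by rewrite mul0mx addr0 (max_r (le_trans (ltW h) ii)).
by rewrite /sp_integral -sumrN; apply: eq_bigr => i _; rewrite mulNmx.
Qed.

Let evalV r w : family_eval a1 b1 (fun i : 'I_n1 => sp_val S1 i) r w =
  (s < r)%R%:R *: sp_eval S1 r w.
Proof.
rewrite sp_evalE /family_eval scaler_sumr; apply: eq_bigr => i _.
rewrite scalerA -natrM mulnb; congr ((_ : bool)%:R *: _).
by rewrite /a1 /b1 gt_max le_max; case: ltP => //= sr.
Qed.

Let evalW r w : r <= s ->
  family_eval a2 b2 xi2 r w = sp_eval S1 r w - sp_eval S0 r w.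
Proof.
move=> rs; rewrite !sp_evalE /family_eval big_sumType /=; congr (_ + _); last first.
  by rewrite -sumrN; apply: eq_bigr => i _; rewrite scalerN.
apply: eq_bigr => i _; rewrite scalerA -natrM mulnb; congr ((_ : bool)%:R *: _).
rewrite gt_min le_min rs /= ltNge rs /=.
case: (ltP (sp_time S1 i) r) => //= h.
by rewrite (ltW (lt_le_trans h rs)) andbT.
Qed.

Let a1_ge0 i : 0 <= a1 i. Proof. by rewrite /a1 le_max s0. Qed.
Let a1_ge i : s <= a1 i. Proof. by rewrite /a1 le_max lexx. Qed.
Let ab1 i : a1 i <= b1 i.
Proof. by rewrite /a1 /b1 ge_max !le_max lexx (simple_start_le_end hS1 i) orbT. Qed.
Let b1_le i : b1 i <= t.
Proof. by rewrite /b1 ge_max st (simple_end_le hS1 i). Qed.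
Let adapted1 i j l : measurable_wrt (F (a1 i)) (fun w => sp_val S1 i w j l).
Proof.
apply: (@measurable_wrt_filtration _ _ _ _ hF (sp_time S1 i)).
- exact: (simple_start_ge0 hS1 i).
- by rewrite /a1 le_max lexx orbT.
- exact: (simple_value_adapted hS1).
Qed.

Let a2_ge0 i : 0 <= a2 i.
Proof.
case: i => i /=; last exact: (simple_start_ge0 hS0 i).
by rewrite le_min s0 (simple_start_ge0 hS1 i).
Qed.
Let ab2 i : a2 i <= b2 i.
Proof.
case: i => i /=; last exact: (simple_start_le_end hS0 i).
by rewrite le_min !ge_min lexx (simple_start_le_end hS1 i) orbT.
Qed.
Let b2_le i : b2 i <= s.
Proof.
case: i => i /=; last exact: (simple_end_le hS0 i).
by rewrite ge_min lexx.
Qed.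
Let adapted2 i j l : measurable_wrt (F (a2 i)) (fun w => xi2 i w j l).
Proof.
have sg x : 0 <= x -> sigma_algebra setT (F x) by exact: (sigma_algebra_filtration hF).
case: i => i; rewrite /xi2 /a2.
  have t0 := simple_start_ge0 hS1 i.
  case: (leP (sp_time S1 i) s) => h.
    under eq_fun do rewrite mxE.
    apply: measurable_wrtM; first exact: sg.
      by apply: measurable_wrt_cst; exact: sg.
    exact: (simple_value_adapted hS1).
  under eq_fun do rewrite mxE mul0r.
  by apply: measurable_wrt_cst; apply: sg; exact: s0.
under eq_fun do rewrite mxE -mulN1r.
have si : sigma_algebra [set: T] (F (sp_time S0 i)).
  by apply: sg; exact: (simple_start_ge0 hS0 i).
have m1 : measurable_wrt (F (sp_time S0 i)) (fun _ : T => -1 : R) by exact: (measurable_wrt_cst si).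
have m2 : measurable_wrt (F (sp_time S0 i)) (fun w => sp_val S0 i w j l).
  exact: (@simple_value_adapted _ _ hS0).
exact: (@measurable_wrtM _ _ _ si _ _ m1 m2).
Qed.

Let bounded2 : exists M, forall i w j l, `|xi2 i w j l| <= M.
Proof.
have [M1 H1] := simple_value_bounded hS1; have [M0 H0] := simple_value_bounded hS0.
exists (Num.max M0 M1) => -[i|i] w j l; rewrite /xi2 mxE.
  rewrite le_max; apply/orP; right; have Hi := H1 i w j l.
  case: (_ <= s); rewrite /= ?mul1r ?mul0r ?normr0 //.
  exact: le_trans (normr_ge0 _) Hi.
by rewrite normrN le_max (H0 i).
Qed.

Let measurable1 i j l : measurable_fun setT (fun w => sp_val S1 (i : 'I_n1) w j l).
Proof.
apply: (@measurable_wrt_fun R disp T (F (a1 i))); last exact: adapted1.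
exact: (filtration_sub_measurable hF).
Qed.

Let measurable0' i j l : measurable_fun setT (fun w => sp_val S0 (i : 'I_n0) w j l).
Proof.
apply: (@measurable_wrt_fun R disp T (F (sp_time S0 i))).
  by apply: (filtration_sub_measurable hF); exact: (simple_start_ge0 hS0 i).
exact: (simple_value_adapted hS0).
Qed.

Let joint1 D i j : jointly_measurable D (fun r w => sp_eval S1 r w i j).
Proof.
rewrite /jointly_measurable; under eq_fun do rewrite sp_evalE.
by apply: (@measurable_family_eval D _ _ _ (fun i : 'I_n1 => sp_val S1 i)) => k'; exact: measurable1.
Qed.

Let joint0 D i j : jointly_measurable D (fun r w => sp_eval S0 r w i j).
Proof.
rewrite /jointly_measurable; under eq_fun do rewrite sp_evalE.
by apply: (@measurable_family_eval D _ _ _ (fun i : 'I_n0 => sp_val S0 i)) => k'; exact: measurable0'.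
Qed.

Let jointB (D : set (measurableTypeR R)) (X Y : R -> T -> 'M[R]_d) :
  (forall i j, jointly_measurable D (fun r w => X r w i j)) ->
  (forall i j, jointly_measurable D (fun r w => Y r w i j)) ->
  jointly_measurable D (fun r w => enorm (X r w - Y r w) ^+ 2).
Proof.
move=> mX mY; apply: jointly_measurable_enorm_sqr => i j.
rewrite /jointly_measurable; under eq_fun do rewrite !mxE.
by apply: measurable_funB; [exact: mX|exact: mY].
Qed.

Let mHs i j : jointly_measurable `[0, s] (fun s w => H s w i j).
Proof.
apply: measurable_funS (mH i j); first exact: measurableX.
by move=> [r w] [/= ]; rewrite !in_itv /= => /andP[r0 rs] _; split => //; rewrite r0 (le_trans rs).
Qed.

Lemma enormN m n (A : 'M[R]_(m, n)) : enorm (- A) = enorm A.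
Proof.
by congr Num.sqrt; apply: eq_bigr => i _; apply: eq_bigr => j _; rewrite mxE sqrrN.
Qed.

(** Before s, the process integrated by W is S1 - S0, and S0 and S1 differ from
    H by little. *)
Let energyW : (sqE W <= (4 * eps ^+ 2)%:E)%E.
Proof.
have [M HM] := bounded2.
rewrite /sqE /W (ge0_family_isometry hF hB a2_ge0 ab2 b2_le adapted2 HM).
have e2' : (DI s (fun r w => sp_eval S1 r w - H r w)%R <= delta)%E.
  apply: le_trans e2; apply: ge0_le_integral => //.
  - by move=> w _; apply: integral_ge0 => r _; rewrite lee_fin sqr_ge0.
  - by apply: measurable_inner_integral => // [|r w _]; [exact: jointB|exact: sqr_ge0].
  - by apply: measurable_inner_integral => // [|r w _]; [exact: jointB|exact: sqr_ge0].
  - move=> w _; apply: ge0_subset_integral => //=.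
    + apply/measurable_EFinP.
      apply: (@measurable_section _ _ _ _ _ (fun r w => enorm (sp_eval S1 r w - H r w) ^+ 2)) => //.
      exact: jointB.
    + by move=> r _; rewrite lee_fin sqr_ge0.
    + by move=> r /=; rewrite !in_itv /= => /andP[-> /le_trans]; apply.
apply: (@le_trans _ _ (2%:E * DI s (fun r w => sp_eval S1 r w - H r w)%R +
    2%:E * DI s (fun r w => sp_eval S0 r w - H r w)%R)%E).
  apply: iterated_integral_le2 => //.
  - apply: jointly_measurable_enorm_sqr => i j; apply: measurable_family_eval => -[k'|k'].
      by rewrite /xi2; under eq_fun do rewrite mxE; apply: measurable_funM => //; exact: measurable1.
    by rewrite /xi2; under eq_fun do rewrite mxE; apply: measurableT_comp => //; exact: measurable0'.
  - exact: jointB.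
  - exact: jointB.
  - by move=> r w _; exact: sqr_ge0.
  - by move=> r w _; exact: sqr_ge0.
  - by move=> r w _; exact: sqr_ge0.
  move=> r w; rewrite /= in_itv /= => /andP[_ rs]; rewrite evalW//.
  have -> : sp_eval S1 r w - sp_eval S0 r w =
      (sp_eval S1 r w - H r w) + - (sp_eval S0 r w - H r w).
    by rewrite opprB addrA subrK.
  apply: le_trans (enorm_sqrD _ _ ltr01) _.
  by rewrite enormN invr1.
have -> : (4 * eps ^+ 2)%:E = (2%:E * delta + 2%:E * delta)%E.
  by rewrite -!EFinM -EFinD; congr EFin; lra.
have p2 : (0 <= 2%:E :> \bar R)%E by rewrite lee_fin.
exact: (leeD (lee_wpmul2l p2 e2') (lee_wpmul2l p2 e1)).
Qed.

Let k_ge0 r : 0 <= r <= t -> 0 <= k r.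
Proof. by move=> h; apply: le_trans (Hk point h); exact: sqr_ge0. Qed.

(** The parameter of the splitting is eps itself: the error of order eps^2 is
    multiplied by 1/eps, and the main term by 1 + eps only. *)
Let energyV : (sqE V <= (2 * eps + (1 + eps) * K)%:E)%E.
Proof.
have [M HM] := simple_value_bounded hS1.
rewrite /sqE /V (ge0_family_isometry hF hB a1_ge0 ab1 b1_le adapted1 HM).
have ei0 : 0 <= 1 + eps^-1 by rewrite addr_ge0// invr_ge0 ltW.
have e10 : 0 <= 1 + eps by rewrite addr_ge0// ltW.
have mi : measurable_fun (setT : set (measurableTypeR R)) (fun r : measurableTypeR R => (s < r)%R%:R : R).
  have -> : (fun r : measurableTypeR R => (s < r)%R%:R : R) = \1_(`]s, +oo[%classic).
    by apply/funext => r; rewrite indicE mem_setE in_itv /= andbT.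
  exact: measurable_indic.
have mH2 : jointly_measurable `[0, t] (fun r w => enorm (H r w) ^+ 2 * (s < r)%R%:R).
  apply: measurable_funM; first by apply: jointly_measurable_enorm_sqr; exact: mH.
  by apply: measurable_funTS; apply: (measurableT_comp mi measurable_fst).
apply: (@le_trans _ _ ((1 + eps^-1)%:E * DI t (fun r w => sp_eval S1 r w - H r w)%R +
    (1 + eps)%:E * \int[P]_w \int[mu]_(r in `[0%R, t]) (enorm (H r w) ^+ 2 * (s < r)%R%:R)%:E)%E).
  apply: iterated_integral_le2 => //.
  - apply: jointly_measurable_enorm_sqr => i j.
    by apply: measurable_family_eval => k'; exact: measurable1.
  - exact: jointB.
  - by move=> r w _; exact: sqr_ge0.
  - by move=> r w _; exact: sqr_ge0.
  - by move=> r w _; rewrite mulr_ge0 ?sqr_ge0.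
  move=> r w _; rewrite evalV; case: ltP => sr; rewrite ?scale1r ?scale0r ?mulr1 ?mulr0 ?addr0.
    by rewrite -{1}(subrK (H r w) (sp_eval S1 r w)); exact: enorm_sqrD.
  have -> : enorm (0 : 'M[R]_d) = 0.
    by rewrite /enorm big1 ?sqrtr0// => i _; rewrite big1// => j _; rewrite mxE expr0n.
  by rewrite expr0n mulr_ge0 ?sqr_ge0.
have h1 : (\int[P]_w \int[mu]_(r in `[0%R, t]) (enorm (H r w) ^+ 2 * (s < r)%R%:R)%:E <= K%:E)%E.
  apply: le_trans kK; apply: iterated_integral_le_cst => //.
    by apply: measurable_funM => //; exact: measurable_funTS.
  move=> r w; rewrite /= in_itv /= => rt.
  by rewrite mulr_ge0 ?sqr_ge0//= ler_wpM2r// Hk.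
apply: (@le_trans _ _ ((1 + eps^-1)%:E * delta + (1 + eps)%:E * K%:E)%E).
  by apply: leeD; apply: lee_wpmul2l => //; rewrite lee_fin.
rewrite -!EFinM -EFinD lee_fin lerD2r mulrDl mul1r [eps ^+ 2 in X in _ + X]expr2 mulKf ?gt_eqF//.
have e0 := eps0; have ee : eps ^+ 2 <= eps by rewrite expr2 ler_piMr// ltW.
lra.
Qed.

Let K_ge0 : 0 <= K.
Proof.
rewrite -lee_fin; apply: le_trans kK; apply: integral_ge0 => r /=.
by rewrite in_itv /= => /k_ge0 r0; rewrite lee_fin mulr_ge0.
Qed.

Let sqint_V i : sqint P (fun w => V w i 0).
Proof.
have [M HM] := simple_value_bounded hS1.
exact: (sqint_family_integral hF hB a1_ge0 ab1 adapted1 HM).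
Qed.

Let sqint_W i : sqint P (fun w => W w i 0).
Proof.
have [M HM] := bounded2.
exact: (sqint_family_integral hF hB a2_ge0 ab2 adapted2 HM).
Qed.

Let measurable_simple_integral u S i : is_simple F u S ->
  measurable_fun setT (fun w => sp_integral S B w i 0).
Proof.
move=> hS; have [M HM] := simple_value_bounded hS.
have [mI _] := sqint_family_integral hF hB (simple_start_ge0 hS) (simple_start_le_end hS)
  (@simple_value_adapted u S hS) HM i.
exact: mI.
Qed.

Let energyJV : (sqE (fun w => J w - V w)%R <= (16 * eps ^+ 2)%:E)%E.
Proof.
pose D0 w := sp_integral S0 B w - I0 w; pose D1 w := sp_integral S1 B w - I1 w.
have mD0 i : measurable_fun setT (fun w => D0 w i 0).
  by under eq_fun do rewrite !mxE; apply: measurable_funB => //; exact: measurable_simple_integral hS0.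
have mD1 i : measurable_fun setT (fun w => D1 w i 0).
  by under eq_fun do rewrite !mxE; apply: measurable_funB => //; exact: measurable_simple_integral hS1.
have mV i : measurable_fun setT (fun w => V w i 0) by have [] := sqint_V i.
have mW i : measurable_fun setT (fun w => W w i 0) by have [] := sqint_W i.
have mB (X Y : T -> 'cV[R]_d) i : measurable_fun setT (fun w => X w i 0) ->
    measurable_fun setT (fun w => Y w i 0) -> measurable_fun setT (fun w => (X w - Y w) i 0).
  by move=> mX mY; under eq_fun do rewrite !mxE; exact: measurable_funB.
have p2 : (0 <= 2 :> R) by [].
have E2 : (0 <= 2%:E :> \bar R)%E by rewrite lee_fin.
have sq2 (x y : 'cV[R]_d) : enorm (x + y) ^+ 2 <= 2 * enorm x ^+ 2 + 2 * enorm y ^+ 2.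
  by apply: le_trans (enorm_sqrD _ _ ltr01) _; rewrite invr1.
have h1 : (sqE (fun w => D0 w - D1 w)%R <= 2%:E * delta + 2%:E * delta)%E.
  apply: (@le_trans _ _ (2%:E * sqE D0 + 2%:E * sqE D1)%E).
    apply: sqE_le2 => // [i|w]; first exact: mB.
    by rewrite -(enormN (D1 w)); exact: sq2.
  exact: (leeD (lee_wpmul2l E2 e3) (lee_wpmul2l E2 e4)).
apply: (@le_trans _ _ (2%:E * sqE W + 2%:E * sqE (fun w => D0 w - D1 w)%R)%E).
  apply: sqE_le2 => // [i|i|w]; [exact: mB|exact: mB|].
  have -> : J w - V w = W w + (D0 w - D1 w); last exact: sq2.
  have := splitVW w; rewrite /J /D0 /D1 => /(canLR (addrK _)); rewrite -addrA => VW.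
  by apply/matrixP => i j; have /matrixP/(_ i j) := splitVW w; rewrite !mxE => E; lra.
apply: (@le_trans _ _ (2%:E * (4 * eps ^+ 2)%:E + 2%:E * (2%:E * delta + 2%:E * delta))%E).
  exact: (leeD (lee_wpmul2l E2 energyW) (lee_wpmul2l E2 h1)).
suff : 2 * (4 * eps ^+ 2) + 2 * (2 * eps ^+ 2 + 2 * eps ^+ 2) <= 16 * eps ^+ 2 by rewrite -lee_fin.
lra.
Qed.

Let mJV i : measurable_fun setT (fun w => (J w - V w) i 0).
Proof.
have [mV _] := sqint_V i; have -> : (fun w => (J w - V w) i 0) = (fun w => J w i 0 - V w i 0).
  by apply/funext => w; rewrite mxE [(- _ : 'cV__) _ _]mxE.
exact: measurable_funB.
Qed.

Lemma increment_energy_approx : (sqE J <= (K + eps * (36 + 3 * K))%:E)%E.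
Proof.
have e0 := eps0; have ei0 : 0 <= 1 + eps^-1 by rewrite addr_ge0// invr_ge0 ltW.
have e10 : 0 <= 1 + eps by rewrite addr_ge0// ltW.
apply: (@le_trans _ _ ((1 + eps^-1)%:E * sqE (fun w => J w - V w)%R + (1 + eps)%:E * sqE V)%E).
  apply: sqE_le2 => // [i|w]; first by have [] := sqint_V i.
  by rewrite -{1}(subrK (V w) (J w)); exact: enorm_sqrD.
have l1 : (0 <= (1 + eps^-1)%:E)%E by rewrite lee_fin.
have l2 : (0 <= (1 + eps)%:E)%E by rewrite lee_fin.
apply: (@le_trans _ _ ((1 + eps^-1)%:E * (16 * eps ^+ 2)%:E +
    (1 + eps)%:E * (2 * eps + (1 + eps) * K)%:E)%E).
  exact: (leeD (lee_wpmul2l l1 energyJV) (lee_wpmul2l l2 energyV)).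
rewrite -!EFinM -EFinD lee_fin.
have -> : (1 + eps^-1) * (16 * eps ^+ 2) = 16 * eps ^+ 2 + 16 * eps.
  by rewrite mulrDl mul1r expr2 mulrCA mulKf ?gt_eqF.
have ee : eps ^+ 2 <= eps by rewrite expr2 ler_piMr// ltW.
have k0 := K_ge0; have : K * eps ^+ 2 <= K * eps by rewrite ler_wpM2l.
move=> kk; have -> : (1 + eps) * (2 * eps + (1 + eps) * K) =
  2 * eps + 2 * eps ^+ 2 + K + 2 * (K * eps) + K * eps ^+ 2 by ring.
lra.
Qed.

(** V is exactly orthogonal to Z, and Young's inequality with parameter eps
    controls the pairing of Z with the difference of I1 - I0 and V. *)
Lemma increment_orthogonal_approx (Z : T -> 'cV[R]_d) :
  (forall q, measurable_wrt (F s) (fun w => Z w q 0)) ->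
  (forall q, sqint P (fun w => Z w q 0)) ->
  \int[P]_w dot (Z w) (J w) <= eps * (\int[P]_w dot (Z w) (Z w) + 16) / 2.
Proof.
move=> aZ sZ; have e0 := eps0.
have [M HM] := simple_value_bounded hS1.
have [sJV EJV] := second_moment_le mJV energyJV.
have iZV : integ (fun w => dot (Z w) (V w)) by exact: integrable_dot.
have iZJV : integ (fun w => dot (Z w) (J w - V w)) by exact: integrable_dot.
have -> : \int[P]_w dot (Z w) (J w) = \int[P]_w dot (Z w) (J w - V w).
  have -> : (fun w => dot (Z w) (J w)) = (fun w => dot (Z w) (J w - V w) + dot (Z w) (V w)).
    by apply/funext => w; rewrite -dotDr subrK.
  rewrite RintegralD//.
  rewrite (family_integral_orthogonal hF hB a1_ge0 ab1 adapted1 HM s0 a1_ge aZ sZ).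
  by rewrite addr0.
have iZZ : integ (fun w => dot (Z w) (Z w)) by exact: integrable_dot.
have iJV2 : integ (fun w => dot (J w - V w) (J w - V w)) by exact: integrable_dot.
apply: (@le_trans _ _ (\int[P]_w (eps / 2 * dot (Z w) (Z w) + eps^-1 / 2 * dot (J w - V w) (J w - V w)))).
  apply: le_Rintegral => //.
    by apply: integrable_addr; exact: integrable_scaler.
  move=> w _; have := young (Z w) (J w - V w) e0; lra.
rewrite RintegralD//; last 2 first.
- exact: integrable_scaler.
- exact: integrable_scaler.
rewrite !RintegralZl//.
have : eps^-1 / 2 * \int[P]_w dot (J w - V w) (J w - V w) <= eps^-1 / 2 * (16 * eps ^+ 2).
  by rewrite ler_wpM2l// divr_ge0// invr_ge0 ltW.
have -> : eps^-1 / 2 * (16 * eps ^+ 2) = 8 * eps by field; rewrite gt_eqF.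
lra.
Qed.

End Increment.

Lemma ito_approximation (t eps : R) (H : R -> T -> 'M[R]_d) (I : T -> 'cV[R]_d) :
  is_ito_integral P F B t H I -> 0 < eps ->
  exists S, [/\ is_simple F t S,
    (\int[P]_w \int[mu]_(r in `[0%R, t]) (enorm (sp_eval S r w - H r w) ^+ 2)%:E <= eps%:E)%E &
    (\int[P]_w (enorm (sp_integral S B w - I w) ^+ 2)%:E <= eps%:E)%E].
Proof.
move=> [_ _ [S [simS c1 c2]]] e0.
have near0 (u : nat -> \bar R) : u @ \oo --> 0%E -> \forall n \near \oo, (u n <= eps%:E)%E.
  move=> cu; have : nbhs (0%E : \bar R) [set x | (x < eps%:E)%E].
    by apply: open_nbhs_nbhs; split; [exact: open_ereal_lt_ereal|rewrite /= lte_fin].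
  move=> nb; have un : \forall n \near \oo, (u n < eps%:E)%E := cu _ nb.
  by apply: filterS un => n; exact: ltW.
have [n [h1 h2]] := @filter_ex _ _ _ _ (filterI (near0 _ c1) (near0 _ c2)).
by exists (S n).
Qed.

(** Letting eps tend to 0 in the two approximate statements: K bounds the energy
    of the increment, and the increment is not positively correlated with the
    past. *)
Section IncrementLimit.
Variables (s t : R) (H : R -> T -> 'M[R]_d) (I0 I1 : T -> 'cV[R]_d).
Hypothesis s0 : 0 <= s.
Hypothesis st : s <= t.
Hypothesis hI0 : is_ito_integral P F B s H I0.
Hypothesis hI1 : is_ito_integral P F B t H I1.
Variables (k : R -> R) (K : R).
Hypothesis mk : measurable_fun (`[0, t] : set (measurableTypeR R)) (k : measurableTypeR R -> R).
Hypothesis Hk : forall r w, 0 <= r <= t -> enorm (H r w) ^+ 2 <= k r.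
Hypothesis kK : (\int[mu]_(r in `[0%R, t]) (k r * (s < r)%R%:R)%:E <= K%:E)%E.

Let J w := I1 w - I0 w.

Let mJ i : measurable_fun setT (fun w => J w i 0).
Proof.
have [_ m0 _] := hI0; have [_ m1 _] := hI1.
by under eq_fun do rewrite !mxE; exact: measurable_funB.
Qed.

Let energy_approx eps : 0 < eps -> eps <= 1 ->
  (\int[P]_w (enorm (J w) ^+ 2)%:E <= (K + eps * (36 + 3 * K))%:E)%E.
Proof.
move=> e0 e1; have ee : 0 < eps ^+ 2 by rewrite exprn_gt0.
have [S0 [hS0 a0 b0]] := ito_approximation hI0 ee.
have [S1 [hS1 a1 b1]] := ito_approximation hI1 ee.
exact: (increment_energy_approx s0 st hI0 hI1 mk Hk kK hS0 hS1 e0 e1 a0 a1 b0 b1).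
Qed.

Let orthogonal_approx eps (Z : T -> 'cV[R]_d) : 0 < eps -> eps <= 1 ->
  (forall q, measurable_wrt (F s) (fun w => Z w q 0)) ->
  (forall q, sqint P (fun w => Z w q 0)) ->
  \int[P]_w dot (Z w) (J w) <= eps * (\int[P]_w dot (Z w) (Z w) + 16) / 2.
Proof.
move=> e0 e1; have ee : 0 < eps ^+ 2 by rewrite exprn_gt0.
have [S0 [hS0 a0 b0]] := ito_approximation hI0 ee.
have [S1 [hS1 a1 b1]] := ito_approximation hI1 ee.
exact: (increment_orthogonal_approx s0 st hI0 hI1 hS0 hS1 e0 a0 a1 b0 b1).
Qed.

Let small (c x y : R) : 0 <= c -> (forall eps, 0 < eps -> eps <= 1 -> x <= y + eps * c) -> x <= y.
Proof.
move=> c0 h; apply/ler_addgt0Pr => e e0.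
have c1 : 0 < c + 1 by lra.
pose eps := Num.min 1 (e / (c + 1)).
have p0 : 0 < eps by rewrite lt_min ltr01 divr_gt0.
have p1 : eps <= 1 by rewrite ge_min lexx.
apply: le_trans (h _ p0 p1) _; rewrite lerD2l.
apply: (@le_trans _ _ (e / (c + 1) * c)); first by rewrite ler_wpM2r// ge_min lexx orbT.
by rewrite mulrAC ler_pdivrMr// ler_pM2l//; lra.
Qed.

Lemma ito_increment_sqint i : sqint P (fun w => (I1 w - I0 w) i 0).
Proof. by have [+ _] := second_moment_le mJ (energy_approx ltr01 (lexx _)); exact. Qed.

Lemma ito_increment_energy : \int[P]_w dot (I1 w - I0 w) (I1 w - I0 w) <= K.
Proof.
apply: (@small `|36 + 3 * K|) => // eps e0 e1.
have [_ h] := second_moment_le mJ (energy_approx e0 e1).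
by apply: le_trans h _; rewrite lerD2l ler_wpM2l ?ler_norm// ltW.
Qed.

Lemma ito_increment_orthogonal (Z : T -> 'cV[R]_d) :
  (forall q, measurable_wrt (F s) (fun w => Z w q 0)) ->
  (forall q, sqint P (fun w => Z w q 0)) ->
  \int[P]_w dot (Z w) (I1 w - I0 w) <= 0.
Proof.
move=> aZ sZ; apply: (@small (`|\int[P]_w dot (Z w) (Z w) + 16| / 2)).
  by rewrite divr_ge0.
move=> eps e0 e1; rewrite add0r; apply: le_trans (orthogonal_approx e0 e1 aZ sZ) _.
by rewrite mulrA ler_wpM2r// ler_wpM2l ?ler_norm// ltW.
Qed.

End IncrementLimit.
End ItoIncrement.

(** * Integrals of continuous functions on intervals *)

Section ContinuousIntegrals.
Context {R : realType}.
Local Notation mu := (@lebesgue_measure R).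
Implicit Types f g : R -> R.

(** Extending a function on [0, +oo[ by its value at 0 makes it continuous on
    the line, so that the point 0 needs no special treatment in integrals. *)
Lemma continuous_extension {U : topologicalType} (g : R -> U) :
  {within `[0, +oo[, continuous g} -> continuous (fun r : R => g (Num.max 0 r)).
Proof.
move=> cg r; set s := Num.max 0 r.
have s0 : 0 <= s by rewrite le_max lexx.
have [sA cgs] : `[0, +oo[%classic s /\ g x @[x --> within `[0, +oo[ (nbhs s)] --> g s.
  have sA : `[0, +oo[%classic s by rewrite /= in_itv /= s0.
  by split => //; have /subspace_continuousP := cg; exact.
apply: (@cvg_comp _ _ _ (fun r => Num.max 0 r) g _ (within `[0, +oo[ (nbhs s))) => //.
move=> A wA; have wA' : nbhs s [set x | `[0, +oo[%classic x -> A x] := wA.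
have cm : {for r, continuous (fun r : R => Num.max 0 r)}.
  by apply: continuous_max; [exact: cvg_cst|exact: cvg_id].
have H : \forall x \near r, `[0, +oo[%classic (Num.max 0 x) -> A (Num.max 0 x) := cm _ wA'.
by apply: filterS H => x; apply; rewrite /= in_itv /= le_max lexx.
Qed.

Lemma C1_nonneg_continuous g : C1_nonneg g -> {within `[0, +oo[, continuous g}.
Proof.
move=> [g' _ dg]; apply/subspace_continuousP => x /=; rewrite in_itv /= andbT => x0.
have c1 : (fun y => (g y - g x) / (y - x)) @ within `[0, +oo[ (x^') --> g' x := dg x x0.
have c2 : (fun y => y - x) @ within `[0, +oo[ (x^') --> (0 : R).
  have c : (fun y => y - x) @ nbhs x --> (0 : R).
    by rewrite -(subrr x); apply: cvgB; [exact: cvg_id|exact: cvg_cst].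
  move=> A nA; have nb : \forall y \near x, A (y - x) := c A nA.
  by apply: filterS nb => y Ay _ _.
have c3 : (fun y => (g y - g x) / (y - x) * (y - x) + g x) @ within `[0, +oo[ (x^') --> g x.
  rewrite -[X in _ --> X]add0r -[X in _ --> X + _](mulr0 (g' x)).
  by apply: cvgD; [exact: cvgM|exact: cvg_cst].
move=> A nA; have nbA : \forall y \near x, y != x -> `[0, +oo[%classic y ->
    A ((g y - g x) / (y - x) * (y - x) + g x) := c3 A nA.
apply: filterS nbA => y Hy /= y0; have [->|yx] := eqVneq y x; first exact: nbhs_singleton.
by have := Hy yx y0; rewrite divfK ?subr_eq0// subrK.
Qed.

Lemma continuous_integrable f a b : continuous f -> mu.-integrable `[a, b] (EFin \o f).
Proof.
move=> cf; apply: continuous_compact_integrable; first exact: segment_compact.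
exact: continuous_subspaceT.
Qed.

Lemma integral_split f (a b c : R) : continuous f -> a <= b -> b <= c ->
  \int[mu]_(r in `[a, c]) f r =
  \int[mu]_(r in `[a, b]) f r + \int[mu]_(r in `[b, c]) f r.
Proof.
move=> cf ab bc; have ic := continuous_integrable a c cf.
have := @Rintegral_itvB R f (BLeft a) (BRight c) b ic.
rewrite !bnd_simp => /(_ ab bc) E.
rewrite -(@Rintegral_itv_obnd_cbnd R b (BRight c)); last first.
  by apply: integrableS (continuous_integrable b c cf) => //; exact: subset_itv_oc_cc.
rewrite -E; lra.
Qed.

Lemma le_integral_itv f g (a b : R) : continuous f -> continuous g ->
  (forall r, a <= r <= b -> f r <= g r) ->
  \int[mu]_(r in `[a, b]) f r <= \int[mu]_(r in `[a, b]) g r.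
Proof.
move=> cf cg fg; apply: le_Rintegral => //; exact: continuous_integrable.
Qed.

Lemma integral_itv_cst (M a b : R) : a <= b -> \int[mu]_(r in `[a, b]) M = M * (b - a).
Proof.
move=> ab; rewrite Rintegral_cst//= lebesgue_measure_itv /= lte_fin.
by rewrite lt_neqAle ab andbT; case: eqVneq => [->|_] //=; rewrite subrr !mulr0.
Qed.

Lemma integral_itv_le f (M a b : R) : continuous f -> a <= b ->
  (forall r, a <= r <= b -> f r <= M) -> \int[mu]_(r in `[a, b]) f r <= M * (b - a).
Proof.
move=> cf ab fM; rewrite -integral_itv_cst//.
by apply: le_integral_itv => //; exact: cst_continuous.
Qed.

Lemma integral_itv_ge0 f (a b : R) : (forall r, a <= r <= b -> 0 <= f r) ->
  0 <= \int[mu]_(r in `[a, b]) f r.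
Proof. by move=> f0; apply: Rintegral_ge0 => r /=; rewrite in_itv /=; exact: f0. Qed.

Lemma integralD_itv f g (a b : R) : continuous f -> continuous g ->
  \int[mu]_(r in `[a, b]) (f r + g r) =
  \int[mu]_(r in `[a, b]) f r + \int[mu]_(r in `[a, b]) g r.
Proof. by move=> cf cg; rewrite RintegralD//; exact: continuous_integrable. Qed.

Lemma integralZ_itv f (c a b : R) : continuous f ->
  \int[mu]_(r in `[a, b]) (c * f r) = c * \int[mu]_(r in `[a, b]) f r.
Proof. by move=> cf; rewrite RintegralZl//; exact: continuous_integrable. Qed.

Lemma is_derive_primitive f (a x : R) : continuous f -> a < x ->
  is_derive x 1 (fun y => \int[mu]_(r in `[a, y]) f r) (f x).
Proof.
move=> cf ax.
have x1 : x < x + 1 by rewrite ltrDl.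
have [d1 d2] := @continuous_FTC1_closed R f a x (x + 1) x1
  (continuous_integrable a (x + 1) cf) ax (cf x).
by split; [exact: d1|rewrite -derive1E; exact: d2].
Qed.

(** Primitives are based at -1 to be differentiable at 0 as well. *)
Lemma primitive_shift f x : continuous f -> 0 <= x ->
  \int[mu]_(r in `[0, x]) f r = \int[mu]_(r in `[-1, x]) f r - \int[mu]_(r in `[-1, 0]) f r.
Proof.
move=> cf x0; rewrite (@integral_split f (-1) 0 x)// ?oppr_le0//.
by rewrite addrAC subrr add0r.
Qed.

Lemma continuous_primitive f : continuous f ->
  continuous (fun x : R => \int[mu]_(r in `[0, Num.max 0 x]) f r).
Proof.
move=> cf; apply: (@continuous_extension _ (fun x => \int[mu]_(r in `[0, x]) f r)).
apply/subspace_continuousP => x /=; rewrite in_itv /= andbT => x0.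
have x1 : -1 < x by rewrite (lt_le_trans _ x0)// ltrN10.
have c1 : {for x, continuous (fun y : R => \int[mu]_(r in `[-1, y]) f r - \int[mu]_(r in `[-1, 0]) f r)}.
  apply: continuousB; last exact: cvg_cst.
  have [d _] := is_derive_primitive cf x1.
  by apply: differentiable_continuous; exact/derivable1_diffP.
have E y : 0 <= y -> \int[mu]_(r in `[0, y]) f r =
    \int[mu]_(r in `[-1, y]) f r - \int[mu]_(r in `[-1, 0]) f r.
  exact: primitive_shift.
have {x0}Ex := E x x0.
move=> A; rewrite /from_subspace /= Ex => nA; have nb : \forall y \near x, A _ := c1 A nA.
by apply: filterS nb => y Ay; rewrite /= in_itv /= andbT => y0; rewrite E.
Qed.

Lemma is_derive_nonincreasing (Q q : R -> R) (a b : R) :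
  (forall x, a <= x <= b -> is_derive x 1 Q (q x)) ->
  (forall x, a <= x <= b -> q x <= 0) -> a <= b -> Q b <= Q a.
Proof.
move=> dQ q0 ab.
have sub x : x \in `]a, b[%R -> a <= x <= b by rewrite in_itv /= => /andP[/ltW -> /ltW ->].
apply: (@ler0_derive1_le_cc R Q a b); rewrite ?in_itv /= ?lexx ?ab //.
- by move=> x /sub /dQ [].
- by move=> x /sub h; rewrite derive1E; have [_ ->] := dQ x h; exact: q0.
- apply: derivable_within_continuous => x; rewrite in_itv /= => /dQ [] //.
Qed.

(** Let Y and A be the primitives of y and alpha. The function
    exp(- k x) Y(x) - A(x) is nonincreasing, because
    exp(- k x) (y - k Y) <= exp(- k x) alpha <= alpha. *)
Lemma integral_gronwall (y alpha : R -> R) (k T : R) :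
  continuous y -> continuous alpha -> 0 <= k -> 0 <= T ->
  (forall t, 0 <= t <= T -> 0 <= alpha t) ->
  (forall t, 0 <= t <= T -> y t <= alpha t + k * \int[mu]_(r in `[0, t]) y r) ->
  \int[mu]_(r in `[0, T]) y r <= expR (k * T) * \int[mu]_(r in `[0, T]) alpha r.
Proof.
move=> cy ca k0 T0 a0 H.
pose Y x := \int[mu]_(r in `[-1, x]) y r - \int[mu]_(r in `[-1, 0]) y r.
pose A x := \int[mu]_(r in `[-1, x]) alpha r - \int[mu]_(r in `[-1, 0]) alpha r.
have E f x : continuous f -> 0 <= x -> \int[mu]_(r in `[0, x]) f r =
    \int[mu]_(r in `[-1, x]) f r - \int[mu]_(r in `[-1, 0]) f r.
  exact: primitive_shift.
have dY (x : R) : 0 <= x -> is_derive x 1 Y (y x).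
  move=> x0; have := @is_derive_primitive y (-1) x cy; rewrite (lt_le_trans _ x0)// => /(_ isT) d.
  by rewrite -[y x]subr0; apply: is_deriveB.
have dA (x : R) : 0 <= x -> is_derive x 1 A (alpha x).
  move=> x0; have := @is_derive_primitive alpha (-1) x ca; rewrite (lt_le_trans _ x0)// => /(_ isT) d.
  by rewrite -[alpha x]subr0; apply: is_deriveB.
pose Q x := expR (- k * x) * Y x - A x.
have : Q T <= Q 0.
  apply: (@is_derive_nonincreasing Q (fun x => expR (- k * x) * (y x - k * Y x) - alpha x)) => //.
    move=> x /andP[x0 _]; have d1 := dY x x0; have d2 := dA x x0.
    rewrite /Q; apply: is_derive_eq; rewrite /GRing.scale /=; ring.
  move=> x xT; have /andP[x0 _] := xT; have := H x xT; rewrite E// -/(Y x) => h.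
  have e1 : expR (- k * x) <= 1 by rewrite -expR0 ler_expR mulNr oppr_le0 mulr_ge0.
  have e0 : 0 < expR (- k * x) by exact: expR_gt0.
  have al := a0 x xT.
  have : expR (- k * x) * (y x - k * Y x) <= expR (- k * x) * alpha x by rewrite ler_pM2l//; lra.
  have : expR (- k * x) * alpha x <= 1 * alpha x by rewrite ler_wpM2r.
  lra.
rewrite /Q /Y /A !subrr mulr0 subrr -!E// subr_le0 => h.
have e0 : 0 < expR (k * T) by exact: expR_gt0.
by rewrite -(ler_pM2l (expR_gt0 (- k * T))) mulrA -expRD mulNr addNr expR0 mul1r -mulNr.
Qed.

(** Exchange of the order of integration over the triangle 0 <= s <= r <= t. For
    continuous functions this is integration by parts: the product of the two
    primitives has derivative p b1 + p1 beta. *)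
Lemma integral_triangle (p beta : R -> R) (t : R) : continuous p -> continuous beta -> 0 <= t ->
  \int[mu]_(s in `[0, t]) (p s * \int[mu]_(r in `[s, t]) beta r) =
  \int[mu]_(r in `[0, t]) ((\int[mu]_(s in `[0, r]) p s) * beta r).
Proof.
move=> cp cb t0.
pose prim (f : R -> R) x := \int[mu]_(r in `[-1, x]) f r - \int[mu]_(r in `[-1, 0]) f r.
pose p1 x := \int[mu]_(r in `[0, Num.max 0 x]) p r.
pose b1 x := \int[mu]_(r in `[0, Num.max 0 x]) beta r.
have cp1 : continuous p1 by exact: continuous_primitive.
have cb1 : continuous b1 by exact: continuous_primitive.
have c1 : continuous (fun r => p r * b1 r) by move=> r; apply: cvgM; [exact: cp|exact: cb1].
have c2 : continuous (fun r => p1 r * beta r) by move=> r; apply: cvgM; [exact: cp1|exact: cb].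
have c12 : continuous (fun r => p r * b1 r + p1 r * beta r).
  by move=> r; apply: cvgD; [exact: c1|exact: c2].
have E f x : continuous f -> 0 <= x -> \int[mu]_(r in `[0, x]) f r = prim f x.
  exact: primitive_shift.
have Em x : 0 <= x -> Num.max 0 x = x by move=> x0; rewrite max_r.
have dprim f (x : R) : continuous f -> 0 <= x -> is_derive x 1 (prim f) (f x).
  move=> cf x0; have := @is_derive_primitive f (-1) x cf; rewrite (lt_le_trans _ x0)// => /(_ isT) d.
  by rewrite -[f x]subr0; apply: is_deriveB.
pose D x := prim (fun r => p r * b1 r + p1 r * beta r) x - prim p x * prim beta x.
have dD (x : R) : 0 <= x <= t -> is_derive x 1 D 0.
  move=> /andP[x0 _]; have d1 := dprim _ x c12 x0; have d2 := dprim _ x cp x0.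
  have d3 := dprim _ x cb x0; rewrite /D; apply: is_derive_eq.
  rewrite /p1 /b1 Em// (E p)// (E beta)// /GRing.scale /=; ring.
have D0 : D 0 = 0 by rewrite /D /prim !subrr mulr0 subrr.
have Dt : D t = 0.
  apply/eqP; rewrite eq_le -D0; apply/andP; split.
    exact: (@is_derive_nonincreasing D (fun=> 0) 0 t).
  rewrite -lerN2; apply: (@is_derive_nonincreasing (fun x => - D x) (fun=> 0) 0 t) => //.
  by move=> x /dD d; rewrite -oppr0; apply: is_deriveN.
move: Dt; rewrite /D -!E// (integralD_itv _ _ c1 c2) => Dt.
transitivity (\int[mu]_(s in `[0, t]) (b1 t * p s + (-1) * (p s * b1 s))).
  apply: eq_Rintegral => s; rewrite inE /= in_itv /= => /andP[s0 st].
  rewrite /b1 !Em// (@integral_split beta 0 s t)//; ring.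
have c3 : continuous (fun r => b1 t * p r) by move=> r; apply: cvgM; [exact: cvg_cst|exact: cp].
have c4 : continuous (fun r => (-1) * (p r * b1 r)) by move=> r; apply: cvgM; [exact: cvg_cst|exact: c1].
rewrite (integralD_itv _ _ c3 c4) (integralZ_itv _ _ _ cp) (integralZ_itv _ _ _ c1).
transitivity (\int[mu]_(r in `[0, t]) (p1 r * beta r)); first by rewrite {1}/b1 Em//; lra.
by apply: eq_Rintegral => r; rewrite inE /= in_itv /= => /andP[r0 _]; rewrite /p1 Em.
Qed.

(** Along a partition of mesh delta the errors add up to e (t - s), and e is
    arbitrary. *)
Lemma le_of_local_increments (u A : R -> R) (s t : R) : s <= t ->
  (forall e, 0 < e -> exists2 delta, 0 < delta &
    forall r r', s <= r -> r <= r' -> r' <= t -> r' - r <= delta ->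
      u r' - u r <= A r' - A r + e * (r' - r)) ->
  u t - u s <= A t - A s.
Proof.
move=> st H; apply/ler_addgt0Pr => e e0.
have d0 : 0 < t - s + 1 by lra.
have [delta p0 {}H] := H (e / (t - s + 1)) (divr_gt0 e0 d0).
pose n := (Num.truncn ((t - s) / delta)).+1; pose h := (t - s) / n%:R.
have n0 : 0 < n%:R :> R by rewrite ltr0n.
have h0 : 0 <= h by rewrite divr_ge0// subr_ge0.
have hd : h <= delta.
  rewrite ler_pdivrMr// mulrC -ler_pdivrMr//; apply/ltW; exact: truncnS_gt.
have nh : n%:R * h = t - s by rewrite mulrC divfK// gt_eqF.
have K i : (i <= n)%N -> u (s + i%:R * h) - u s <=
    A (s + i%:R * h) - A s + e / (t - s + 1) * (i%:R * h).
  elim: i => [_|i IH i_n]; first by rewrite mul0r addr0 !subrr mulr0 addr0.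
  have ih : i.+1%:R * h <= t - s by rewrite -nh ler_wpM2r// ler_nat.
  have i0 : 0 <= i%:R * h by rewrite mulr_ge0.
  have E : i.+1%:R * h = i%:R * h + h by rewrite -natr1 mulrDl mul1r.
  have := H (s + i%:R * h) (s + i.+1%:R * h).
  rewrite E in ih *; rewrite (_ : s + (i%:R * h + h) - (s + i%:R * h) = h); last by lra.
  have -> : s <= s + i%:R * h by lra.
  have -> : s + i%:R * h <= s + (i%:R * h + h) by lra.
  have -> : s + (i%:R * h + h) <= t by lra.
  move=> /(_ isT isT isT hd) h1; have := IH (ltnW i_n); rewrite mulrDr; lra.
have := K n (leqnn _); rewrite nh (_ : s + (t - s) = t); last by lra.
move=> /le_trans; apply; rewrite lerD2l mulrAC ler_pdivrMr// ler_pM2l//; lra.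
Qed.

End ContinuousIntegrals.

(** * Path integrals and vector-valued integrals *)

Section PathIntegrals.
Context {R : realType} {disp : measure_display} {T : measurableType disp}.
Variable P : probability T R.
Local Notation mu := (@lebesgue_measure R).
Local Notation integ X := (P.-integrable [set: T] (fun w => (X w)%:E)).
Variable Phi : R -> T -> R.
Hypothesis cPhi : forall w, continuous (Phi^~ w : R -> R).
Hypothesis mPhi : forall r, 0 <= r -> measurable_fun setT (Phi r).
Variables a b : R.
Hypothesis a0 : 0 <= a.

Lemma jointly_measurable_paths : jointly_measurable `[a, b] Phi.
Proof.
have m1 := @measurable_continuous_paths R _ T Phi
  (fun w => continuous_subspaceT (@cPhi w)) mPhi.
apply: (@eq_measurable_fun _ _ _ _ _ (fun p : measurableTypeR R * T => Phi (Num.max 0 p.1) p.2)).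
  move=> [r w]; rewrite inE => -[/= + _]; rewrite in_itv /= => /andP[ar _].
  by rewrite max_r// (le_trans a0).
exact: measurable_funTS.
Qed.

(** Paths are continuous, hence integrable on bounded intervals, and the real
    integral agrees with the extended one used by Tonelli's theorem. *)
Lemma path_integralE w : (\int[mu]_(r in `[a, b]) Phi r w)%:E =
  (\int[mu]_(r in `[a, b]) (Phi r w)%:E)%E.
Proof.
rewrite /Rintegral fineK//; apply: (integrable_fin_num (mu := mu)) => //.
exact: continuous_integrable.
Qed.

Lemma measurable_path_integral :
  measurable_fun setT (fun w => \int[mu]_(r in `[a, b]) Phi r w).
Proof.
have jp : jointly_measurable `[a, b] (fun r w => Num.max (Phi r w) 0).
  by apply: measurable_maxr; [exact: jointly_measurable_paths|exact: measurable_cst].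
have jn : jointly_measurable `[a, b] (fun r w => Num.max (- Phi r w) 0).
  apply: measurable_maxr; last exact: measurable_cst.
  by apply: measurableT_comp => //; exact: jointly_measurable_paths.
have ge0 (x : R) : 0 <= Num.max x 0 by rewrite le_max lexx orbT.
apply/measurable_EFinP.
have E w : (\int[mu]_(r in `[a, b]) Phi r w)%:E =
    (\int[mu]_(r in `[a, b]) (Num.max (Phi r w) 0)%:E -
      \int[mu]_(r in `[a, b]) (Num.max (- Phi r w) 0)%:E)%E.
  rewrite path_integralE integralE; congr (_ - _)%E; apply: eq_integral => r _.
    by rewrite funeposE EFin_max.
  by rewrite funenegE EFin_max.
apply: (eq_measurable_fun _ (fun w _ => esym (E w))).
apply: emeasurable_funB; apply: measurable_inner_integral => //.
Qed.

Hypothesis Phi0 : forall r w, a <= r <= b -> 0 <= Phi r w.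

Let Phi0' r w : `[a, b]%classic r -> 0 <= Phi r w.
Proof. by rewrite /= in_itv /=; exact: Phi0. Qed.

Hypothesis ab : a <= b.
Variable C : R.
Hypothesis iPhi : forall r, a <= r <= b -> integ (Phi r).
Hypothesis PhiC : forall r, a <= r <= b -> \int[P]_w Phi r w <= C.

Let tonelli : (\int[P]_w (\int[mu]_(r in `[a, b]) Phi r w)%:E =
  \int[mu]_(r in `[a, b]) (\int[P]_w Phi r w)%:E)%E.
Proof.
under eq_integral do rewrite path_integralE.
rewrite tonelli_strip//; last exact: jointly_measurable_paths.
apply: eq_integral => r; rewrite inE /= in_itv /= => /iPhi ir.
by rewrite /Rintegral fineK//; exact: (integrable_fin_num measurableT ir).
Qed.

Lemma measurable_expectation :
  measurable_fun (`[a, b] : set (measurableTypeR R)) (fun r => \int[P]_w Phi r w).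
Proof.
pose D : set (measurableTypeR R) := `[a, b]%classic.
have mX : measurable (D `*` [set: T]) by apply: measurableX => //; exact: measurable_itv.
pose f : measurableTypeR R * T -> \bar R := (fun p => (Phi p.1 p.2)%:E) \_ (D `*` setT).
have mf : measurable_fun setT f.
  by apply/(measurable_restrictT _ mX); apply/measurable_EFinP; exact: jointly_measurable_paths.
have f0 p : (0 <= f p)%E.
  by apply: erestrict_ge0 => -[r w] [/= Dr _]; rewrite lee_fin Phi0'.
have m1 : measurable_fun setT (fun r : measurableTypeR R => \int[P]_w f (r, w))%E.
  exact: (@measurable_fun_fubini_tonelli_F _ _ _ _ _ P f).
have m2 := measurable_funTS (D := D) m1.
have m3 : measurable_fun D (fun r => fine (\int[P]_w f (r, w))%E).
  exact: measurableT_comp.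
apply: eq_measurable_fun m3 => r Dr; rewrite /Rintegral; congr fine.
by apply: eq_integral => w _; rewrite /f patchE in_setX /= Dr in_setT.
Qed.

Lemma path_integral_le : integ (fun w => \int[mu]_(r in `[a, b]) Phi r w) /\
  \int[P]_w \int[mu]_(r in `[a, b]) Phi r w <= C * (b - a).
Proof.
have ge0 w : 0 <= \int[mu]_(r in `[a, b]) Phi r w.
  by apply: integral_itv_ge0 => r; exact: Phi0.
have le : (\int[P]_w (\int[mu]_(r in `[a, b]) Phi r w)%:E <= (C * (b - a))%:E)%E.
  rewrite tonelli; apply: (@le_trans _ _ (\int[mu]_(r in `[a, b]) C%:E)%E).
    apply: ge0_le_integral => //.
    - by move=> r; rewrite /= in_itv /= => rab; rewrite lee_fin Rintegral_ge0// => w _; exact: Phi0.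
    - by apply/measurable_EFinP; exact: measurable_expectation.
  rewrite integral_cst//= lebesgue_measure_itv /= lte_fin.
  by rewrite lt_neqAle ab andbT; case: eqVneq => [->|_] //=; rewrite ?subrr ?mulr0 ?mule0.
have ii : integ (fun w => \int[mu]_(r in `[a, b]) Phi r w).
  apply/integrableP; split; first by apply/measurable_EFinP; exact: measurable_path_integral.
  apply: le_lt_trans (ltry (C * (b - a))); apply: le_trans le.
  by under eq_integral do rewrite gee0_abs ?lee_fin//.
split => //; rewrite -lee_fin; apply: le_trans le.
by rewrite /Rintegral fineK//; exact: (integrable_fin_num measurableT ii).
Qed.

Lemma path_integral_expectation :
  \int[P]_w \int[mu]_(r in `[a, b]) Phi r w = \int[mu]_(r in `[a, b]) \int[P]_w Phi r w.
Proof. by rewrite {1}/Rintegral [RHS]/Rintegral tonelli. Qed.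

End PathIntegrals.

Section ContinuousCombinations.
Context {R : realType} {d : nat} {U : topologicalType}.

Lemma continuous_sum I (r : seq I) (f : I -> U -> R) : (forall i, continuous (f i)) ->
  continuous (fun x => \sum_(i <- r) f i x).
Proof.
move=> cf; elim: r => [|i r IH].
  by under eq_fun do rewrite big_nil; exact: cst_continuous.
by under eq_fun do rewrite big_cons; move=> x; apply: cvgD; [exact: cf|exact: IH].
Qed.

Lemma continuous_mulr (f g : U -> R) : continuous f -> continuous g -> continuous (fun x => f x * g x).
Proof. by move=> cf cg x; apply: cvgM; [exact: cf|exact: cg]. Qed.

Lemma continuous_addr (f g : U -> R) : continuous f -> continuous g -> continuous (fun x => f x + g x).
Proof. by move=> cf cg x; apply: cvgD; [exact: cf|exact: cg]. Qed.

Lemma continuous_scaler (c : R) (f : U -> R) : continuous f -> continuous (fun x => c * f x).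
Proof. by move=> cf; apply: continuous_mulr => //; exact: cst_continuous. Qed.

Lemma continuous_dot (v1 v2 : U -> 'cV[R]_d) : (forall i, continuous (fun r => v1 r i 0)) ->
  (forall i, continuous (fun r => v2 r i 0)) -> continuous (fun r => dot (v1 r) (v2 r)).
Proof. by move=> c1 c2; apply: continuous_sum => i; exact: continuous_mulr. Qed.

End ContinuousCombinations.

Section VectorIntegral.
Context {R : realType} {d : nat}.
Local Notation mu := (@lebesgue_measure R).
Implicit Types (v : R -> 'cV[R]_d).

Definition vector_integral (a b : R) v : 'cV[R]_d := \col_i \int[mu]_(r in `[a, b]) v r i 0.

Lemma dot_vector_integral (a b : R) v (u : 'cV[R]_d) : (forall i, continuous (fun r => v r i 0)) ->
  dot u (vector_integral a b v) = \int[mu]_(r in `[a, b]) dot u (v r).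
Proof.
move=> cv; rewrite /dot.
have -> : (fun r => \sum_i u i 0 * v r i 0) = (fun r => \sum_(i <- index_enum 'I_d) u i 0 * v r i 0) by [].
elim: (index_enum 'I_d) => [|i s IH].
  rewrite big_nil; under [RHS]eq_Rintegral do rewrite big_nil.
  by rewrite Rintegral_cst// mul0r.
rewrite big_cons IH; under [RHS]eq_Rintegral do rewrite big_cons.
rewrite integralD_itv; last 2 first.
- exact: continuous_scaler.
- by apply: continuous_sum => j; exact: continuous_scaler.
by rewrite integralZ_itv// mxE.
Qed.

(** With D the integral of v, integrate
    2 <D, v(r)> <= |D|^2 / (b - a) + (b - a) |v(r)|^2. *)
Lemma vector_integral_sqr (a b : R) v : a <= b -> (forall i, continuous (fun r => v r i 0)) ->
  dot (vector_integral a b v) (vector_integral a b v) <=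
  (b - a) * \int[mu]_(r in `[a, b]) dot (v r) (v r).
Proof.
rewrite le_eqVlt => /predU1P[<- cv|ab cv].
  rewrite subrr mul0r /dot big1// => i _; rewrite mxE set_itv1.
  by rewrite Rintegral_set1 mul0r.
set D := vector_integral a b v.
have c0 : continuous (fun r => dot (v r) (v r)) by exact: continuous_dot.
have ba : 0 < b - a by lra.
have e0 : 0 < (b - a)^-1 by rewrite invr_gt0.
have h : 2 * dot D D <= \int[mu]_(r in `[a, b]) ((b - a)^-1 * dot D D + (b - a) * dot (v r) (v r)).
  have DD : dot D D = \int[mu]_(r in `[a, b]) dot D (v r) by rewrite -dot_vector_integral.
  have c1 : continuous (fun r => dot D (v r)).
    by apply: continuous_dot => // i; exact: cst_continuous.
  rewrite {1}DD -(integralZ_itv 2 a b c1).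
  apply: le_integral_itv.
  - by apply: continuous_scaler; apply: continuous_dot => // i; exact: cst_continuous.
  - by apply: continuous_addr; [exact: cst_continuous|exact: continuous_scaler].
  - by move=> r _; have := young D (v r) e0; rewrite invrK.
move: h; rewrite integralD_itv; last 2 first.
- exact: cst_continuous.
- exact: continuous_scaler.
have E1 : \int[mu]_(r in `[a, b]) ((b - a) * dot (v r) (v r)) =
    (b - a) * \int[mu]_(r in `[a, b]) dot (v r) (v r) by exact: integralZ_itv.
have E2 : \int[mu]_(r in `[a, b]) ((b - a)^-1 * dot D D) = dot D D.
  by rewrite integral_itv_cst ?ltW// mulrAC mulVf ?gt_eqF// mul1r.
rewrite E1 E2; lra.
Qed.

End VectorIntegral.

(** * Moments and energy inequality of a diffusion *)

Section AlmostSure.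
Context {R : realType} {disp : measure_display} {T : measurableType disp}.
Variable P : probability T R.
Local Notation integ X := (P.-integrable [set: T] (fun w => (X w)%:E)).
Implicit Types X Y : T -> R.

Lemma ae_integrable X Y : measurable_fun setT X -> measurable_fun setT Y ->
  {ae P, forall w, X w = Y w} -> integ X -> integ Y.
Proof.
move=> mX mY XY /integrableP[_ iX]; apply/integrableP; split; first exact/measurable_EFinP.
apply: le_lt_trans iX; rewrite le_eqVlt; apply/orP; left; apply/eqP.
apply: ae_eq_integral => //.
- by apply: measurableT_comp => //; exact/measurable_EFinP.
- by apply: measurableT_comp => //; exact/measurable_EFinP.
- by apply: filterS XY => w E _; rewrite E.
Qed.

Lemma ae_Rintegral X Y : measurable_fun setT X -> measurable_fun setT Y ->
  {ae P, forall w, X w = Y w} -> \int[P]_w X w = \int[P]_w Y w.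
Proof.
move=> mX mY XY; congr fine; apply: ae_eq_integral => //; [exact/measurable_EFinP|exact/measurable_EFinP|].
by apply: filterS XY => w E _; rewrite E.
Qed.

Lemma ae_sqint X Y : measurable_fun setT X -> measurable_fun setT Y ->
  {ae P, forall w, X w = Y w} -> sqint P X -> sqint P Y.
Proof.
move=> mX mY XY [_ iX]; split => //; apply: ae_integrable iX.
- exact: measurable_funX.
- exact: measurable_funX.
- by apply: filterS XY => w E; rewrite E.
Qed.

End AlmostSure.

Section Growth.
Context {R : realType} {d : nat}.
Implicit Types (G : 'cV[R]_d -> 'cV[R]_d) (K : R).

Lemma lipschitz_dot G K x y : 0 <= K -> enorm (G x - G y) <= K * enorm (x - y) ->
  dot (G x - G y) (G x - G y) <= K ^+ 2 * dot (x - y) (x - y).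
Proof.
move=> K0 lG; rewrite -!enorm_sqr -exprMn.
by rewrite ler_pXn2r ?nnegrE ?mulr_ge0 ?enorm_ge0.
Qed.

Lemma lipschitz_growth G K xs x : 0 <= K ->
  (forall x y, enorm (G x - G y) <= K * enorm (x - y)) ->
  dot (G x) (G x) <= 2 * dot (G xs) (G xs) + 2 * K ^+ 2 * dot (x - xs) (x - xs).
Proof.
move=> K0 lG; have := lipschitz_dot K0 (lG x xs).
have := @dot_sqrD R d 1 (G xs) (G x - G xs) ltr01.
rewrite invr1 addrC subrK; set a := dot (G x) _; lra.
Qed.

Lemma dot_sqrD3 (u v w : 'cV[R]_d) :
  dot (u + v + w) (u + v + w) <= 3 * dot u u + 3 * dot v v + 3 * dot w w.
Proof.
have h1 := dot_ge0 (u - v); have h2 := dot_ge0 (u - w); have h3 := dot_ge0 (v - w).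
move: h1 h2 h3; rewrite !dotE (dotC v u) (dotC w u) (dotC w v); lra.
Qed.

End Growth.

Section Diffusion.
Context {R : realType} {disp : measure_display} {T : measurableType disp}.
Variables (P : probability T R) (F : R -> set (set T)).
Hypothesis hF : filtration F.
Context {d : nat}.
Variable B : R -> T -> 'cV[R]_d.
Hypothesis hB : brownian_motion P F B.
Local Notation integ X := (P.-integrable [set: T] (fun w => (X w)%:E)).
Local Notation mu := (@lebesgue_measure R).
Variables (X : R -> T -> 'cV[R]_d) (x0 : 'cV[R]_d) (V : 'cV[R]_d -> 'cV[R]_d) (Lv : R).
Variables (psi kappa : R -> R) (H : R -> T -> 'M[R]_d).
Hypothesis aX : adapted F X.
Hypothesis cX : forall w, continuous (fun r : R => X r w).
Hypothesis X0 : {ae P, forall w, X 0 w = x0}.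
Hypothesis cV : forall j, continuous (fun x => V x j 0).
Hypothesis Lv0 : 0 <= Lv.
Hypothesis lV : forall x y, enorm (V x - V y) <= Lv * enorm (x - y).
Hypothesis cpsi : continuous psi.
Hypothesis psi01 : forall r, 0 <= psi r <= 1.
Hypothesis ckappa : continuous kappa.
Hypothesis hH : forall r w, 0 <= r -> enorm (H r w) ^+ 2 <= kappa r.
Hypothesis solX : forall t, 0 <= t -> exists2 I : T -> 'cV[R]_d, is_ito_integral P F B t H I &
  {ae P, forall w, X t w = x0 + vector_integral 0 t (fun r => - psi r *: V (X r w)) + I w}.

Let v w r := - psi r *: V (X r w).
(** Almost surely an increment of the stochastic integral. Being defined by the
    drift, it makes the decomposition of X t - X s hold on every path, and only
    its moments involve an exceptional set. *)
Definition noise s t w := X t w - X s w - vector_integral s t (v w).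

Let kappa0 r : 0 <= r -> 0 <= kappa r.
Proof. by move=> r0; apply: le_trans (hH point r0); exact: sqr_ge0. Qed.

Let cXi w i : continuous (fun r => X r w i 0).
Proof.
by move=> r; apply: (@continuous_comp _ _ _ (fun r => X r w) (fun x : 'cV[R]_d => x i 0)); [exact: cX|exact: coord_continuous].
Qed.

Let cgX (g : 'cV[R]_d -> R) w : continuous g -> continuous (fun r => g (X r w)).
Proof. by move=> cg r; apply: (@continuous_comp _ _ _ (fun r => X r w) g); [exact: cX|exact: cg]. Qed.

Let mX r i : 0 <= r -> measurable_fun setT (fun w => X r w i 0).
Proof.
by move=> r0; apply: (@measurable_wrt_fun R disp T (F r)); [exact: filtration_sub_measurable|exact: aX].
Qed.

Let mgX (g : 'cV[R]_d -> R) r : continuous g -> 0 <= r -> measurable_fun setT (fun w => g (X r w)).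
Proof. by move=> cg r0; apply: measurable_continuous_comp => // i; exact: mX. Qed.

Let cv w i : continuous (fun r => v w r i 0).
Proof.
under eq_fun do rewrite mxE; apply: continuous_mulr; last exact: (@cgX (fun x => V x i 0) w (@cV i)).
by move=> r; apply: cvgN; exact: cpsi.
Qed.

Let mv r i : 0 <= r -> measurable_fun setT (fun w => v w r i 0).
Proof.
by move=> r0; under eq_fun do rewrite mxE; apply: measurable_funM => //; exact: (@mgX (fun x => V x i 0) r (@cV i)).
Qed.

Lemma measurable_noise s t i : 0 <= s -> s <= t -> measurable_fun setT (fun w => noise s t w i 0).
Proof.
move=> s0 st; under eq_fun do rewrite !mxE.
apply: measurable_funB; first by apply: measurable_funB; apply: mX => //; exact: le_trans st.
by apply: (@measurable_path_integral _ _ _ (fun r w => v w r i 0)) => [w|r r0|//]; [exact: cv|exact: mv].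
Qed.

Let noise_ito s t : 0 <= s -> s <= t -> exists I0 I1,
  [/\ is_ito_integral P F B s H I0, is_ito_integral P F B t H I1 &
    {ae P, forall w, I1 w - I0 w = noise s t w}].
Proof.
move=> s0 st; have [I0 h0 e0] := solX s0; have [I1 h1 e1] := solX (le_trans s0 st).
exists I0, I1; split => //; apply: filterS2 e0 e1 => w e0 e1; rewrite /noise e1 e0.
have -> : vector_integral 0 t (v w) = vector_integral 0 s (v w) + vector_integral s t (v w).
  by apply/matrixP => i j; rewrite !mxE; exact: (@integral_split R (fun r => v w r i 0) 0 s t (@cv w i) s0 st).
by apply/matrixP => i j; rewrite !mxE; ring.
Qed.

(* the form in which the bound on the integrand after time s is used for
   increments of the stochastic integral *)
Let kappa_future s t : 0 <= s -> s <= t ->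
  (\int[mu]_(r in `[0%R, t]) (kappa r * (s < r)%R%:R)%:E <= (\int[mu]_(r in `[s, t]) kappa r)%:E)%E.
Proof.
move=> s0 st.
have -> : (\int[mu]_(r in `[0%R, t]) (kappa r * (s < r)%R%:R)%:E = \int[mu]_(r in `]s, t]) (kappa r)%:E)%E.
  rewrite integral_mkcond [RHS]integral_mkcond; apply: eq_integral => r _.
  rewrite !patchE !mem_setE !in_itv /=; case: (ltP s r) => sr /=; last first.
    by rewrite mulr0; case: ifP.
  by rewrite mulr1 (le_trans s0 (ltW sr)).
rewrite /Rintegral fineK; last first.
  by apply: (integrable_fin_num (mu := mu)) => //; exact: continuous_integrable.
apply: ge0_subset_integral => //.
- apply/measurable_EFinP; apply: measurable_funTS; exact: continuous_measurable_fun.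
- by move=> r; rewrite /= in_itv /= => /andP[sr _]; rewrite lee_fin kappa0// (le_trans s0).
- exact: subset_itv_oc_cc.
Qed.

Let mkappa t : measurable_fun (`[0, t] : set (measurableTypeR R)) (kappa : measurableTypeR R -> R).
Proof. by apply: measurable_funTS; exact: continuous_measurable_fun. Qed.

Let hHt t r w : 0 <= r <= t -> enorm (H r w) ^+ 2 <= kappa r.
Proof. by move=> /andP[r0 _]; exact: hH. Qed.

Let measurable_dot (Y Z : T -> 'cV[R]_d) :
  (forall i, measurable_fun setT (fun w => Y w i 0)) ->
  (forall i, measurable_fun setT (fun w => Z w i 0)) ->
  measurable_fun setT (fun w => dot (Y w) (Z w)).
Proof. by move=> mY mZ; apply: measurable_sum => i; exact: measurable_funM. Qed.

Lemma sqint_noise s t i : 0 <= s -> s <= t -> sqint P (fun w => noise s t w i 0).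
Proof.
move=> s0 st; have [I0 [I1 [h0 h1 e]]] := noise_ito s0 st.
have sq := @ito_increment_sqint _ _ _ _ _ hF _ _ hB _ _ _ _ _ s0 st h0 h1 _ _ (@mkappa t) (@hHt t) (kappa_future s0 st) i.
apply: (ae_sqint _ _ _ sq); [by case: sq|exact: measurable_noise|].
by apply: filterS e => w ->.
Qed.

Lemma noise_energy s t : 0 <= s -> s <= t ->
  \int[P]_w dot (noise s t w) (noise s t w) <= \int[mu]_(r in `[s, t]) kappa r.
Proof.
move=> s0 st; have [I0 [I1 [h0 h1 e]]] := noise_ito s0 st.
have sq := @ito_increment_sqint _ _ _ _ _ hF _ _ hB _ _ _ _ _ s0 st h0 h1 _ _ (@mkappa t) (@hHt t) (kappa_future s0 st).
have := @ito_increment_energy _ _ _ _ _ hF _ _ hB _ _ _ _ _ s0 st h0 h1 _ _ (@mkappa t) (@hHt t) (kappa_future s0 st).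
apply: le_trans; rewrite le_eqVlt; apply/orP; left; apply/eqP; apply/esym; apply: ae_Rintegral.
- by apply: measurable_dot => i; have [] := sq i.
- by apply: measurable_dot => i; exact: measurable_noise.
- by apply: filterS e => w ->.
Qed.

Lemma noise_orthogonal s t (Z : T -> 'cV[R]_d) : 0 <= s -> s <= t ->
  (forall q, measurable_wrt (F s) (fun w => Z w q 0)) ->
  (forall q, sqint P (fun w => Z w q 0)) ->
  \int[P]_w dot (Z w) (noise s t w) <= 0.
Proof.
move=> s0 st aZ sZ; have [I0 [I1 [h0 h1 e]]] := noise_ito s0 st.
have sq := @ito_increment_sqint _ _ _ _ _ hF _ _ hB _ _ _ _ _ s0 st h0 h1 _ _ (@mkappa t) (@hHt t) (kappa_future s0 st).
have := @ito_increment_orthogonal _ _ _ _ _ hF _ _ hB _ _ _ _ _ s0 st h0 h1 _ aZ sZ.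
apply: le_trans; rewrite le_eqVlt; apply/orP; left; apply/eqP; apply/esym; apply: ae_Rintegral.
- by apply: measurable_dot => i; [have [] := sZ i|have [] := sq i].
- by apply: measurable_dot => i; [have [] := sZ i|exact: measurable_noise].
- by apply: filterS e => w ->.
Qed.

Variable xs : 'cV[R]_d.
Local Notation sqdist x := (dot (x - xs) (x - xs)).
Let c0 := 2 * dot (V xs) (V xs).
Let c1 := 2 * Lv ^+ 2.

Let c00 : 0 <= c0. Proof. by rewrite mulr_ge0// dot_ge0. Qed.
Let c10 : 0 <= c1. Proof. by rewrite mulr_ge0// sqr_ge0. Qed.
Let growthV x : dot (V x) (V x) <= c0 + c1 * sqdist x.
Proof. exact: lipschitz_growth. Qed.

Lemma continuous_coord i : continuous (fun x : 'cV[R]_d => x i 0).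
Proof. exact: coord_continuous. Qed.

Lemma continuous_sqdist : continuous (fun x : 'cV[R]_d => sqdist x).
Proof.
have c i : continuous (fun x : 'cV[R]_d => (x - xs) i 0).
  have -> : (fun x : 'cV[R]_d => (x - xs) i 0) = (fun x => x i 0 + (- xs i 0)).
    by apply/funext => x; rewrite !mxE.
  by apply: continuous_addr; [exact: continuous_coord|exact: cst_continuous].
exact: continuous_dot.
Qed.

Let cVV : continuous (fun x => dot (V x) (V x)).
Proof. exact: continuous_dot. Qed.

Let drift_sqr s t w : s <= t ->
  dot (vector_integral s t (v w)) (vector_integral s t (v w)) <=
  (t - s) * \int[mu]_(r in `[s, t]) dot (V (X r w)) (V (X r w)).
Proof.
move=> st; have /le_trans := vector_integral_sqr st (@cv w); apply.
rewrite ler_wpM2l ?subr_ge0//; apply: le_integral_itv => [| |r _].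
- exact: (continuous_dot (@cv w) (@cv w)).
- exact: (@cgX _ w cVV).
rewrite /v !dotE mulrA ler_piMl ?dot_ge0//.
by have /andP[p0 p1] := psi01 r; rewrite mulrNN mulr_ile1.
Qed.

Let integ_noise s t : 0 <= s -> s <= t -> integ (fun w => dot (noise s t w) (noise s t w)).
Proof. by move=> s0 st; apply: integrable_dot => i; exact: sqint_noise. Qed.

(** On every path the squared distance y to xs satisfies
    y(t) <= alpha(t) + k int_0^t y, where alpha collects the starting point and
    the noise. Gronwall's inequality must be used before taking expectations,
    as it is not known yet that the expectation of y is finite. *)
Section Moment.
Variable tm : R.
Hypothesis tm0 : 0 <= tm.
Let Km := \int[mu]_(r in `[0, tm]) kappa r.
Let m r w := noise 0 (Num.max 0 r) w.
Let alpha r w := 3 * sqdist (X 0 w) + 3 * (tm ^+ 2 * c0) + 3 * dot (m r w) (m r w).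
Let k := 3 * (tm * c1).

Let cm w i : continuous (fun r => m r w i 0).
Proof.
rewrite /m /noise; under eq_fun do rewrite !mxE.
move=> r; apply: cvgB; last exact: (@continuous_primitive R (fun r => v w r i 0) (@cv w i) r).
apply: cvgB; last exact: cvg_cst.
by apply: (@continuous_extension R _ (fun r => X r w i 0)); apply: continuous_subspaceT; exact: cXi.
Qed.

Let calpha w : continuous (alpha^~ w : R -> R).
Proof.
apply: continuous_addr; first exact: cst_continuous.
by apply: continuous_scaler; exact: (continuous_dot (@cm w) (@cm w)).
Qed.

Let malpha r : 0 <= r -> measurable_fun setT (alpha r).
Proof.
move=> r0; apply: measurable_funD; first apply: measurable_funD => //.
  apply: measurable_funM => //; exact: (mgX continuous_sqdist).
by apply: measurable_funM => //; apply: measurable_dot => i; apply: measurable_noise => //; rewrite le_max lexx.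
Qed.

Let alpha0 r w : 0 <= alpha r w.
Proof. by rewrite /alpha !addr_ge0 ?mulr_ge0 ?dot_ge0// sqr_ge0. Qed.

Let pathwise t w : 0 <= t <= tm ->
  sqdist (X t w) <= alpha t w + k * \int[mu]_(r in `[0, t]) sqdist (X r w).
Proof.
move=> /andP[t0 ttm].
have -> : X t w - xs = (X 0 w - xs) + vector_integral 0 t (v w) + m t w.
  by rewrite /m /noise max_r//; apply/matrixP => i j; rewrite !mxE; ring.
apply: le_trans (dot_sqrD3 _ _ _) _.
have cs : continuous (fun r => sqdist (X r w)) by exact: (cgX continuous_sqdist).
have h : dot (vector_integral 0 t (v w)) (vector_integral 0 t (v w)) <=
    tm * (c0 * tm + c1 * \int[mu]_(r in `[0, t]) sqdist (X r w)).
  apply: le_trans (drift_sqr _ t0) _; rewrite subr0.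
  apply: ler_pM => //; first by apply: integral_itv_ge0 => r _; exact: dot_ge0.
  apply: (@le_trans _ _ (\int[mu]_(r in `[0, t]) (c0 + c1 * sqdist (X r w)))).
    apply: le_integral_itv => [| |r _]; [exact: (@cgX _ w cVV)| |exact: growthV].
    by apply: continuous_addr; [exact: cst_continuous|exact: continuous_scaler].
  rewrite integralD_itv; last 2 first.
  - exact: cst_continuous.
  - exact: continuous_scaler.
  rewrite integral_itv_cst// (integralZ_itv _ _ _ cs) lerD2r subr0.
  by rewrite ler_wpM2l.
rewrite /alpha /k; move: h; set I := \int[mu]_(r in _) _; lra.
Qed.

Let A := 3 * sqdist x0 + 3 * (tm ^+ 2 * c0) + 3 * Km.

Let integ_start : integ (fun w => sqdist (X 0 w)) /\ \int[P]_w sqdist (X 0 w) = sqdist x0.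
Proof.
have ms : measurable_fun setT (fun w => sqdist (X 0 w)) by exact: (mgX continuous_sqdist).
have e : {ae P, forall w, (fun=> sqdist x0) w = sqdist (X 0 w)} by apply: filterS X0 => w ->.
split.
  by apply: (ae_integrable _ _ e) => //; exact: finite_measure_integrable_cst.
rewrite -(ae_Rintegral _ _ e)// Rintegral_cst//.
by rewrite /= probability_setT mulr1.
Qed.

Let moment_alpha r : 0 <= r <= tm -> integ (alpha r) /\ \int[P]_w alpha r w <= A.
Proof.
move=> /andP[r0 rtm]; have [i0 e0] := integ_start.
have i1 : integ (fun w => 3 * sqdist (X 0 w)) by exact: integrable_scaler.
have i2 : integ (fun=> 3 * (tm ^+ 2 * c0)) by exact: finite_measure_integrable_cst.
have i12 : integ (fun w => 3 * sqdist (X 0 w) + 3 * (tm ^+ 2 * c0)) by exact: integrable_addr.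
have i3 : integ (fun w => dot (m r w) (m r w)).
  by apply: integ_noise => //; rewrite le_max lexx.
have i4 : integ (fun w => 3 * dot (m r w) (m r w)) by exact: integrable_scaler.
split; first exact: integrable_addr.
rewrite (RintegralD measurableT i12 i4) (RintegralD measurableT i1 i2).
rewrite (RintegralZl _ measurableT i0) (RintegralZl _ measurableT i3) e0.
rewrite Rintegral_cst// /= probability_setT mulr1 lerD2l ler_pM2l//.
rewrite /m max_r//; apply: le_trans (noise_energy (lexx _) r0) _.
rewrite /Km (@integral_split _ kappa 0 r tm)// lerDl.
by apply: integral_itv_ge0 => q /andP[rq _]; rewrite kappa0// (le_trans r0).
Qed.

Lemma second_moment_bound : exists2 C, 0 <= C & forall t, 0 <= t <= tm ->
  integ (fun w => sqdist (X t w)) /\ \int[P]_w sqdist (X t w) <= C.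
Proof.
have k0 : 0 <= k by rewrite !mulr_ge0.
pose IA w := \int[mu]_(r in `[0, tm]) alpha r w.
have [iA EA] : integ IA /\ \int[P]_w IA w <= A * (tm - 0).
  apply: path_integral_le => // [r rt|r rt]; by have [] := moment_alpha rt.
have A0 : 0 <= A.
  have [_] := moment_alpha (introT andP (conj (lexx 0) tm0)).
  by apply: le_trans; apply: Rintegral_ge0.
pose c := k * expR (k * tm).
have cc0 : 0 <= c by rewrite mulr_ge0// expR_ge0.
exists (A + c * (A * tm)); first by rewrite addr_ge0// mulr_ge0// mulr_ge0.
move=> t /[dup] ttm /andP[t0 tt].
have cs w : continuous (fun r => sqdist (X r w)) by exact: (cgX continuous_sqdist).
have le w : sqdist (X t w) <= alpha t w + c * IA w.
  apply: le_trans (pathwise w ttm) _; rewrite lerD2l /c -mulrA ler_wpM2l//.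
  apply: (@le_trans _ _ (\int[mu]_(r in `[0, tm]) sqdist (X r w))).
    rewrite (@integral_split _ _ 0 t tm)// lerDl.
    by apply: integral_itv_ge0 => r _; exact: dot_ge0.
  by apply: integral_gronwall => // r rt; exact: pathwise.
have [ia Ea] := moment_alpha ttm.
have ic : integ (fun w => c * IA w) by exact: integrable_scaler.
have is_ : integ (fun w => sqdist (X t w)).
  apply: (integrable_dominated _ (integrable_addr ia ic)).
    exact: (mgX continuous_sqdist).
  by move=> w; rewrite ger0_norm ?dot_ge0.
split => //; apply: (@le_trans _ _ (\int[P]_w (alpha t w + c * IA w))).
  by apply: le_Rintegral => //; exact: integrable_addr.
rewrite (RintegralD measurableT ia ic) (RintegralZl _ measurableT iA).
by apply: lerD => //; rewrite ler_wpM2l// -[X in _ <= _ * X]subr0.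
Qed.

End Moment.

Let kappa_bounded tm : 0 <= tm -> exists2 C, 0 <= C & forall s t, 0 <= s -> s <= t -> t <= tm ->
  \int[mu]_(r in `[s, t]) kappa r <= C * (t - s).
Proof.
move=> t0; have [q qt qmax] := @EVT_max R kappa 0 tm t0 (continuous_subspaceT ckappa).
exists (kappa q); first by apply: kappa0; move: qt; rewrite in_itv /= => /andP[].
move=> s t s0 st tt; apply: integral_itv_le => // r /andP[sr rt].
by apply: qmax; rewrite in_itv /= (le_trans s0)//= (le_trans rt).
Qed.

Let integ_drift tm C s t : 0 <= s -> s <= t -> t <= tm ->
  (forall r, 0 <= r <= tm -> integ (fun w => sqdist (X r w)) /\ \int[P]_w sqdist (X r w) <= C) ->
  integ (fun w => \int[mu]_(r in `[s, t]) dot (V (X r w)) (V (X r w))) /\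
  \int[P]_w (\int[mu]_(r in `[s, t]) dot (V (X r w)) (V (X r w))) <= (c0 + c1 * C) * (t - s).
Proof.
move=> s0 st tt HC.
have HV r : s <= r <= t -> integ (fun w => dot (V (X r w)) (V (X r w))) /\
    \int[P]_w dot (V (X r w)) (V (X r w)) <= c0 + c1 * C.
  move=> /andP[sr rt]; have r0 := le_trans s0 sr.
  have [i1 e1] : integ (fun w => sqdist (X r w)) /\ \int[P]_w sqdist (X r w) <= C.
    by apply: HC; rewrite r0 (le_trans rt).
  have i2 : integ (fun=> c0) by exact: finite_measure_integrable_cst.
  have i3 : integ (fun w => c1 * sqdist (X r w)) by exact: integrable_scaler.
  have iV : integ (fun w => dot (V (X r w)) (V (X r w))).
    apply: (integrable_dominated _ (integrable_addr i2 i3)); first exact: (mgX cVV).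
    by move=> w; rewrite ger0_norm ?dot_ge0.
  split => //; apply: (@le_trans _ _ (\int[P]_w (c0 + c1 * sqdist (X r w)))).
    by apply: le_Rintegral => //; exact: integrable_addr.
  rewrite (RintegralD measurableT i2 i3) (RintegralZl _ measurableT i1).
  by rewrite Rintegral_cst//= probability_setT mulr1 lerD2l ler_wpM2l.
apply: (@path_integral_le _ _ _ P (fun r w => dot (V (X r w)) (V (X r w)))) => //.
- by move=> w; exact: (@cgX _ w cVV).
- by move=> r r0; exact: (mgX cVV).
- by move=> r w _; exact: dot_ge0.
- by move=> r /HV[].
- by move=> r /HV[].
Qed.

Lemma increment_bound tm : 0 <= tm -> exists2 C, 0 <= C &
  forall s t, 0 <= s -> s <= t -> t <= tm ->
  integ (fun w => dot (X t w - X s w) (X t w - X s w)) /\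
  \int[P]_w dot (X t w - X s w) (X t w - X s w) <= C * (t - s).
Proof.
move=> tm0; have [C C0 HC] := second_moment_bound tm0; have [K K0 HK] := kappa_bounded tm0.
exists (2 * (tm * (c0 + c1 * C)) + 2 * K).
  by rewrite addr_ge0// mulr_ge0// mulr_ge0// addr_ge0// mulr_ge0.
move=> s t s0 st tt; have [iD eD] := integ_drift s0 st tt HC.
set ID := fun w => \int[mu]_(r in `[s, t]) dot (V (X r w)) (V (X r w)) in iD eD.
have iN := integ_noise s0 st; have eN := le_trans (noise_energy s0 st) (HK s t s0 st tt).
have ts : t - s <= tm by lra.
have le w : dot (X t w - X s w) (X t w - X s w) <=
    2 * tm * ID w + 2 * dot (noise s t w) (noise s t w).
  have -> : X t w - X s w = vector_integral s t (v w) + noise s t w by rewrite [RHS]addrC /noise subrK.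
  apply: le_trans (dot_sqrD _ _ ltr01) _; rewrite invr1 lerD2r.
  rewrite -mulrA ler_wpM2l//; apply: le_trans (drift_sqr _ st) _.
  by rewrite ler_wpM2r// integral_itv_ge0// => r _; exact: dot_ge0.
have i1 : integ (fun w => 2 * tm * ID w) by exact: integrable_scaler.
have i2 : integ (fun w => 2 * dot (noise s t w) (noise s t w)) by exact: integrable_scaler.
have ii : integ (fun w => dot (X t w - X s w) (X t w - X s w)).
  apply: (integrable_dominated _ (integrable_addr i1 i2)).
    by apply: measurable_dot => i; under eq_fun do rewrite !mxE;
      apply: measurable_funB; apply: mX => //; exact: le_trans st.
  by move=> w; rewrite ger0_norm ?dot_ge0.
split => //; apply: (@le_trans _ _ (\int[P]_w (2 * tm * ID w + 2 * dot (noise s t w) (noise s t w)))).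
  by apply: le_Rintegral => //; exact: integrable_addr.
rewrite (RintegralD measurableT i1 i2) (RintegralZl _ measurableT iD) (RintegralZl _ measurableT iN).
have : 2 * tm * \int[P]_w ID w <= 2 * tm * ((c0 + c1 * C) * (t - s)) by rewrite ler_wpM2l// mulr_ge0.
move: eN; set N := \int[P]_w dot _ _; lra.
Qed.

(** Here g is the function followed along the diffusion and q a lower bound of
    its dissipation rate <G, V>. *)
Section Energy.
Variables (g q : 'cV[R]_d -> R) (G : 'cV[R]_d -> 'cV[R]_d) (K KG : R).
Hypothesis K0 : 0 <= K.
Hypothesis KG0 : 0 <= KG.
Hypothesis cg : continuous g.
Hypothesis cq : continuous q.
Hypothesis cG : forall i, continuous (fun x => G x i 0).
Hypothesis g0 : forall x, 0 <= g x.
Hypothesis q0 : forall x, 0 <= q x.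
Hypothesis lG : forall x y, enorm (G x - G y) <= KG * enorm (x - y).
Hypothesis descent : forall x y, g y <= g x + dot (G x) (y - x) + K / 2 * dot (y - x) (y - x).
Hypothesis qGV : forall x, q x <= dot (G x) (V x).

Let growthG x : dot (G x) (G x) <= 2 * dot (G xs) (G xs) + 2 * KG ^+ 2 * sqdist x.
Proof. exact: lipschitz_growth. Qed.

Let sqdistX tm t : 0 <= t -> t <= tm -> integ (fun w => sqdist (X t w)).
Proof.
move=> t0 tt; have [C _ HC] := second_moment_bound (le_trans t0 tt).
by have [] := HC t (introT andP (conj t0 tt)).
Qed.

Lemma integrable_quadratic_growth (f : 'cV[R]_d -> R) (a b t : R) : continuous f ->
  (forall x, 0 <= f x <= a + b * sqdist x) -> 0 <= t -> integ (fun w => f (X t w)).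
Proof.
move=> cf fab t0; have i1 := sqdistX t0 (lexx t).
have i2 : integ (fun=> a) by exact: finite_measure_integrable_cst.
apply: (integrable_dominated _ (integrable_addr i2 (integrable_scaler b i1))); first exact: mgX.
by move=> w; have /andP[f0 fle] := fab (X t w); rewrite ger0_norm.
Qed.

Lemma integrable_potential t : 0 <= t -> integ (fun w => g (X t w)).
Proof.
apply: (@integrable_quadratic_growth _ (g xs + dot (G xs) (G xs) / 2) (2^-1 + K / 2)) => // x.
rewrite g0 /=; have := descent xs x; have := young (G xs) (x - xs) (ltr01).
by rewrite invr1; lra.
Qed.

Let sqint_grad t i : 0 <= t -> sqint P (fun w => G (X t w) i 0).
Proof.
move=> t0; have iG : integ (fun w => dot (G (X t w)) (G (X t w))).
  apply: (@integrable_quadratic_growth (fun x => dot (G x) (G x)) (2 * dot (G xs) (G xs)) (2 * KG ^+ 2)) => //.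
    exact: (continuous_dot cG cG).
  by move=> x; rewrite dot_ge0 growthG.
apply: (sqint_le _ iG); first exact: (mgX (@cG i)).
move=> w; rewrite -enorm_sqr -real_normK ?num_real// ler_pXn2r ?nnegrE ?enorm_ge0//.
exact: entry_le_enorm.
Qed.

Let qle x : 0 <= q x <= (dot (G xs) (G xs) + dot (V xs) (V xs)) + (KG ^+ 2 + Lv ^+ 2) * sqdist x.
Proof.
rewrite q0 /=; have := young (G x) (V x) ltr01; rewrite invr1.
have := growthG x; have := growthV x; have := qGV x; rewrite /c0 /c1; lra.
Qed.

Lemma integrable_dissipation t : 0 <= t -> integ (fun w => q (X t w)).
Proof. exact: (integrable_quadratic_growth cq qle). Qed.

Let cq' w : continuous (fun r => psi r * q (X r w)).
Proof. by apply: continuous_mulr => //; exact: cgX. Qed.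

Let dissipation s t w := \int[mu]_(r in `[s, t]) (psi r * q (X r w)).

Let integ_q t : 0 <= t -> integ (fun w => psi t * q (X t w)).
Proof. by move=> t0; apply: integrable_scaler; exact: integrable_dissipation. Qed.

Let Eq t : 0 <= t -> \int[P]_w (psi t * q (X t w)) = psi t * \int[P]_w q (X t w).
Proof. by move=> t0; rewrite (RintegralZl _ measurableT (integrable_dissipation t0)). Qed.

Lemma dissipation_expectation s t : 0 <= s -> s <= t ->
  integ (dissipation s t) /\
  \int[P]_w dissipation s t w = \int[mu]_(r in `[s, t]) (psi r * \int[P]_w q (X r w)).
Proof.
move=> s0 st; have t0 := le_trans s0 st.
have [C C0 HC] := second_moment_bound t0.
pose a := dot (G xs) (G xs) + dot (V xs) (V xs); pose b := KG ^+ 2 + Lv ^+ 2.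
have a0 : 0 <= a by rewrite addr_ge0 ?dot_ge0.
have b0 : 0 <= b by rewrite addr_ge0 ?sqr_ge0.
have ir r : s <= r <= t -> integ (fun w => psi r * q (X r w)).
  by move=> /andP[sr _]; apply: integ_q; exact: le_trans sr.
have mr r : 0 <= r -> measurable_fun setT (fun w => psi r * q (X r w)).
  by move=> r0; apply: measurable_funM => //; exact: (mgX cq).
have p0 r w : s <= r <= t -> 0 <= psi r * q (X r w).
  by move=> _; rewrite mulr_ge0 ?q0//; have /andP[] := psi01 r.
split.
  have [] // := @path_integral_le _ _ _ P (fun r w => psi r * q (X r w)) cq' mr s t s0 p0 st (a + b * C) ir.
  move=> r /andP[sr rt]; have r0 := le_trans s0 sr.
  have [i1 e1] := HC r (introT andP (conj r0 rt)).
  have i2 : integ (fun=> a) by exact: finite_measure_integrable_cst.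
  have i3 : integ (fun w => b * sqdist (X r w)) by exact: integrable_scaler.
  apply: (@le_trans _ _ (\int[P]_w (a + b * sqdist (X r w)))).
    apply: le_Rintegral => //; [by apply: ir; rewrite sr|exact: integrable_addr|].
    move=> w _; have /andP[u0 u1] := qle (X r w); apply: le_trans u1.
    by rewrite ler_piMl//; have /andP[] := psi01 r.
  rewrite (RintegralD measurableT i2 i3) (RintegralZl _ measurableT i1).
  by rewrite Rintegral_cst//= probability_setT mulr1 lerD2l ler_wpM2l.
rewrite (@path_integral_expectation _ _ _ P (fun r w => psi r * q (X r w)))//.
by apply: eq_Rintegral => r; rewrite inE /= in_itv /= => /andP[sr _]; rewrite Eq// (le_trans s0).
Qed.

(** One step on one path: the descent inequality for g, where G(X s) is replaced
    by G(X r) inside the drift term. The parameter eta of Young's inequality is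
    free; it is chosen before the length of the step. *)
Let step_pathwise s t w eta : s <= t -> 0 < eta ->
  g (X t w) + dissipation s t w <= g (X s w) + dot (G (X s w)) (noise s t w) +
   (eta^-1 / 2 * \int[mu]_(r in `[s, t]) dot (G (X r w) - G (X s w)) (G (X r w) - G (X s w)) +
   (eta / 2 + K / 2 * ((1 + eta^-1) * (t - s))) * \int[mu]_(r in `[s, t]) dot (V (X r w)) (V (X r w)) +
   K / 2 * (1 + eta) * dot (noise s t w) (noise s t w)).
Proof.
move=> st eta0; set D := vector_integral s t (v w).
have XE : X t w - X s w = D + noise s t w by rewrite [RHS]addrC /noise subrK.
have h1 := descent (X s w) (X t w); rewrite XE in h1.
have h2 := @dot_sqrD R d eta D (noise s t w) eta0.
have h3 := @drift_sqr s t w st.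
have cdG : continuous (fun r => dot (G (X r w) - G (X s w)) (G (X r w) - G (X s w))).
  have c i : continuous (fun r => (G (X r w) - G (X s w)) i 0).
    have -> : (fun r => (G (X r w) - G (X s w)) i 0) = (fun r => G (X r w) i 0 + (- G (X s w) i 0)).
      by apply/funext => r; rewrite !mxE.
    apply: continuous_addr; last exact: cst_continuous.
    exact: (@cgX _ w (@cG i)).
  exact: (continuous_dot c c).
have cVX := @cgX _ w cVV.
have h4 : dot (G (X s w)) D <= - dissipation s t w +
    (eta^-1 / 2 * \int[mu]_(r in `[s, t]) dot (G (X r w) - G (X s w)) (G (X r w) - G (X s w)) +
     eta / 2 * \int[mu]_(r in `[s, t]) dot (V (X r w)) (V (X r w))).
  rewrite (dot_vector_integral _ _ _ (@cv w)) /dissipation.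
  rewrite -mulN1r -(integralZ_itv (-1) s t (@cq' w)) -(integralZ_itv _ s t cdG) -(integralZ_itv _ s t cVX).
  rewrite -integralD_itv; [|exact: continuous_scaler|exact: continuous_scaler].
  rewrite -integralD_itv; last 2 first.
  - by apply: continuous_scaler; exact: cq'.
  - by apply: continuous_addr; exact: continuous_scaler.
  apply: le_integral_itv.
  - by apply: (continuous_dot _ (@cv w)) => i; exact: cst_continuous.
  - by apply: continuous_addr; [apply: continuous_scaler; exact: cq'|apply: continuous_addr; exact: continuous_scaler].
  move=> r _; rewrite /v dotZr.
  have /andP[p0 p1] := psi01 r.
  have hq := qGV (X r w).
  have ie : 0 < eta^-1 by rewrite invr_gt0.
  have := young (G (X r w) - G (X s w)) (V (X r w)) ie; rewrite invrK.
  set a := dot (_ - _) (_ - _); set c := dot (V _) _ => hy.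
  have a0 : 0 <= a by exact: dot_ge0.
  have cc : 0 <= c by exact: dot_ge0.
  have E : dot (G (X s w)) (V (X r w)) = dot (G (X r w)) (V (X r w)) - dot (G (X r w) - G (X s w)) (V (X r w)).
    by rewrite dotDl dotNl; lra.
  have k1 : psi r * q (X r w) <= psi r * dot (G (X r w)) (V (X r w)) by rewrite ler_wpM2l.
  have k2 : psi r * dot (G (X r w) - G (X s w)) (V (X r w)) <= psi r * (eta^-1 / 2 * a + eta / 2 * c).
    by rewrite ler_wpM2l//; lra.
  have k3 : psi r * (eta^-1 / 2 * a + eta / 2 * c) <= eta^-1 / 2 * a + eta / 2 * c.
    by rewrite ler_piMl// addr_ge0// mulr_ge0// divr_ge0// ltW.
  rewrite E mulrBr mulNr; lra.
have h5 : dot (D + noise s t w) (D + noise s t w) <=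
   (1 + eta^-1) * ((t - s) * \int[mu]_(r in `[s, t]) dot (V (X r w)) (V (X r w))) +
   (1 + eta) * dot (noise s t w) (noise s t w).
  apply: le_trans h2 _; rewrite lerD2r ler_wpM2l//.
  by rewrite addr_ge0// invr_ge0 ltW.
have k2 : 0 <= K / 2 by rewrite divr_ge0.
have h6 := ler_wpM2l k2 h5.
move: h1 h4 h6; rewrite dotDr; set N := dot (noise _ _ _) _; set DD := dot (D + _) _.
set IV := \int[mu]_(r in _) dot (V _) _; set IG := \int[mu]_(r in _) dot (_ - _) _.
move=> h1 h4 h6; nra.
Qed.

(** Taking expectations, the terms in eta are at most eta a (t - s) and the other
    errors at most c (t - s)^2, where c depends on eta: X r - X s and the
    drift have second moments of order t - s and (t - s)^2. *)
Let expected_step tm e : 0 <= tm -> 0 < e -> exists2 delta, 0 < delta &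
  forall s t, 0 <= s -> s <= t -> t <= tm -> t - s <= delta ->
  \int[P]_w g (X t w) + \int[P]_w dissipation s t w <=
  \int[P]_w g (X s w) + K / 2 * \int[mu]_(r in `[s, t]) kappa r + e * (t - s).
Proof.
move=> tm0 e0.
have [C C0 HC] := second_moment_bound tm0; have [kb kb0 Hkb] := kappa_bounded tm0.
have [CI CI0 HCI] := increment_bound tm0.
pose CV := c0 + c1 * C; have CV0 : 0 <= CV by rewrite addr_ge0// mulr_ge0.
pose a := CV / 2 + K / 2 * kb; have a0 : 0 <= a by rewrite addr_ge0 ?mulr_ge0 ?divr_ge0.
pose eta := e / (2 * (a + 1)).
have a1 : 0 < 2 * (a + 1) by lra.
have eta0 : 0 < eta by rewrite divr_gt0.
have etaa : eta * a <= e / 2.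
  rewrite /eta mulrAC ler_pdivrMr//; have : e * a <= e * (a + 1) by rewrite ler_pM2l//; lra.
  lra.
have ie0 : 0 < eta^-1 by rewrite invr_gt0.
pose c := eta^-1 / 2 * (KG ^+ 2 * CI) + K / 2 * ((1 + eta^-1) * CV).
have k2 : 0 <= K / 2 by rewrite divr_ge0.
have ie1 : 0 <= 1 + eta^-1 by rewrite addr_ge0// ltW.
have ie2 : 0 <= eta^-1 / 2 by rewrite divr_ge0// ltW.
have cc0 : 0 <= c by rewrite addr_ge0// mulr_ge0// mulr_ge0// sqr_ge0.
have cc1 : 0 < 2 * (c + 1) by lra.
exists (e / (2 * (c + 1))); first by rewrite divr_gt0.
move=> s t s0 st tt; rewrite ler_pdivlMr// => tsd.
have t0 := le_trans s0 st; have D0 : 0 <= t - s by lra.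
have tsc : (t - s) * c <= e / 2.
  have : (t - s) * c <= (t - s) * (c + 1) by rewrite ler_wpM2l//; lra.
  lra.
pose Phi r w := dot (G (X r w) - G (X s w)) (G (X r w) - G (X s w)).
have [iV EV] := integ_drift s0 st tt HC.
have cPhi w : continuous (Phi^~ w : R -> R).
  have cc i : continuous (fun r => (G (X r w) - G (X s w)) i 0).
    have -> : (fun r => (G (X r w) - G (X s w)) i 0) = (fun r => G (X r w) i 0 + (- G (X s w) i 0)).
      by apply/funext => x; rewrite !mxE.
    apply: continuous_addr; last exact: cst_continuous.
    exact: (@cgX _ w (@cG i)).
  exact: (continuous_dot cc cc).
have mPhi r : 0 <= r -> measurable_fun setT (Phi r).
  move=> r0; apply: measurable_dot => i; under eq_fun do rewrite !mxE;
  by apply: measurable_funB; exact: (mgX (@cG i)).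
have HPhi r : s <= r <= t -> integ (Phi r) /\ \int[P]_w Phi r w <= KG ^+ 2 * (CI * (t - s)).
  move=> /andP[sr rt]; have [i1 E1] := HCI s r s0 sr (le_trans rt tt).
  have le w : Phi r w <= KG ^+ 2 * dot (X r w - X s w) (X r w - X s w).
    exact: lipschitz_dot.
  have i2 : integ (fun w => KG ^+ 2 * dot (X r w - X s w) (X r w - X s w)) by exact: integrable_scaler.
  have ip : integ (Phi r).
    apply: (integrable_dominated _ i2); first by apply: mPhi; exact: le_trans sr.
    by move=> w; rewrite ger0_norm ?dot_ge0.
  split => //; apply: (le_trans (le_Rintegral measurableT ip i2 _)); first by move=> w _; exact: le.
  rewrite (RintegralZl _ measurableT i1) ler_wpM2l ?sqr_ge0//.
  by apply: le_trans E1 _; rewrite ler_wpM2l//; lra.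
have [iG EG] : integ (fun w => \int[mu]_(r in `[s, t]) Phi r w) /\
    \int[P]_w \int[mu]_(r in `[s, t]) Phi r w <= KG ^+ 2 * (CI * (t - s)) * (t - s).
  apply: path_integral_le => //.
  - by move=> r w _; exact: dot_ge0.
  - by move=> r /HPhi[].
  - by move=> r /HPhi[].
have iN := integ_noise s0 st; have EN := noise_energy s0 st; have EK := Hkb s t s0 st tt.
have aG i : measurable_wrt (F s) (fun w => G (X s w) i 0).
  have sF := sigma_algebra_filtration hF s0.
  by apply: (@measurable_wrt_comp _ _ _ sF _ (fun x => G x i 0)); [exact: cG|move=> j; exact: aX].
have sG i : sqint P (fun w => G (X s w) i 0) by exact: sqint_grad.
have iGN : integ (fun w => dot (G (X s w)) (noise s t w)).
  by apply: integrable_dot => // i; exact: sqint_noise.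
have EGN := noise_orthogonal s0 st aG sG.
have ig0 := integrable_potential s0; have ig1 := integrable_potential t0.
have [iq _] := dissipation_expectation s0 st.
pose b1 := eta^-1 / 2; pose b2 := eta / 2 + K / 2 * ((1 + eta^-1) * (t - s)).
pose b3 := K / 2 * (1 + eta).
have b20 : 0 <= b2.
  have eta2 : 0 <= eta / 2 by rewrite divr_ge0// ltW.
  by rewrite addr_ge0// mulr_ge0// mulr_ge0.
have b30 : 0 <= b3 by rewrite mulr_ge0// addr_ge0// ltW.
have iL := integrable_addr ig1 iq.
have i1 := integrable_scaler b1 iG; have i2 := integrable_scaler b2 iV.
have i3 := integrable_scaler b3 iN; have i12 := integrable_addr i1 i2.
have i123 := integrable_addr i12 i3; have igG := integrable_addr ig0 iGN.
have iR := integrable_addr igG i123.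
have : \int[P]_w (g (X t w) + dissipation s t w) <= \int[P]_w (g (X s w) + dot (G (X s w)) (noise s t w) +
   (b1 * \int[mu]_(r in `[s, t]) Phi r w + b2 * \int[mu]_(r in `[s, t]) dot (V (X r w)) (V (X r w)) +
   b3 * dot (noise s t w) (noise s t w))).
  by apply: le_Rintegral => // w _; exact: step_pathwise.
rewrite (RintegralD measurableT ig1 iq) (RintegralD measurableT igG i123) (RintegralD measurableT ig0 iGN).
rewrite (RintegralD measurableT i12 i3) (RintegralD measurableT i1 i2).
rewrite (RintegralZl _ measurableT iG) (RintegralZl _ measurableT iV) (RintegralZl _ measurableT iN).
have j1 := ler_wpM2l ie2 EG; have j2 := ler_wpM2l b20 EV; have j3 := ler_wpM2l b30 EN.
have e2 : 0 <= K / 2 * eta by rewrite mulr_ge0// ltW.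
have j4 := ler_wpM2l e2 EK.
have j5 := ler_wpM2l D0 etaa; have j6 := ler_wpM2l D0 tsc.
move: EGN j1 j2 j3 j4 j5 j6; rewrite -/CV -/b1.
set EN' := \int[P]_w dot (noise _ _ _) _; set IK := \int[mu]_(r in _) kappa r.
set IG := \int[P]_w \int[mu]_(r in _) Phi _ _; set IV := \int[P]_w \int[mu]_(r in _) dot (V _) _.
have -> : b3 * IK = K / 2 * IK + K / 2 * eta * IK by rewrite /b3; ring.
have -> : (t - s) * (eta * a) = eta / 2 * (CV * (t - s)) + K / 2 * eta * (kb * (t - s)).
  by rewrite /a; ring.
have -> : (t - s) * ((t - s) * c) = b1 * (KG ^+ 2 * (CI * (t - s)) * (t - s)) +
    K / 2 * ((1 + eta^-1) * (t - s)) * (CV * (t - s)) by rewrite /c /b1; ring.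
have -> : b2 * (CV * (t - s)) = eta / 2 * (CV * (t - s)) +
    K / 2 * ((1 + eta^-1) * (t - s)) * (CV * (t - s)) by rewrite /b2; ring.
lra.
Qed.

(** The inequality that Ito's formula would give for g, with the second order
    term bounded by means of K. *)
Lemma energy_inequality s t : 0 <= s -> s <= t ->
  \int[P]_w g (X t w) + \int[mu]_(r in `[s, t]) (psi r * \int[P]_w q (X r w)) <=
  \int[P]_w g (X s w) + K / 2 * \int[mu]_(r in `[s, t]) kappa r.
Proof.
move=> s0 st; have t0 := le_trans s0 st.
have ar1 (u u' c y k m n x : R) : u' + y <= u + k * m + x ->
  u' + (c + y) - (u + c) <= k * (n + m) - k * n + x by lra.
have ar2 (u u' c y k m n : R) : u' + (c + y) - (u + c) <= k * (n + m) - k * n ->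
  u' + y <= u + k * m by lra.
have [_ Est] := dissipation_expectation s0 st; rewrite -Est.
have split_diss r r' : 0 <= r -> r <= r' ->
    \int[P]_w dissipation 0 r' w = \int[P]_w dissipation 0 r w + \int[P]_w dissipation r r' w.
  move=> r0 rr'; have [i1 _] := dissipation_expectation (lexx 0) r0.
  have [i2 _] := dissipation_expectation r0 rr'.
  rewrite -(RintegralD measurableT i1 i2); apply: eq_Rintegral => w _.
  exact: (@integral_split R (fun r => psi r * q (X r w)) 0 r r' (@cq' w)).
pose U r := \int[P]_w g (X r w) + \int[P]_w dissipation 0 r w.
pose A r := K / 2 * \int[mu]_(x in `[0, r]) kappa x.
have : U t - U s <= A t - A s.
  apply: le_of_local_increments => // e e0.
  have [delta d0 H1] := expected_step t0 e0; exists delta => // r r' sr rr' r't rd.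
  have r0 := le_trans s0 sr; have := H1 r r' r0 rr' r't rd.
  by rewrite /U /A (split_diss r r')// (@integral_split R kappa 0 r r')//; exact: ar1.
by rewrite /U /A (split_diss s t)// (@integral_split R kappa 0 s t)//; exact: ar2.
Qed.

End Energy.

End Diffusion.

(** * Evaluation at an independent random time *)

Section RandomTime.
Context {R : realType} {disp : measure_display} {T : measurableType disp}.
Variable P : probability T R.
Local Notation integ X := (P.-integrable [set: T] (fun w => (X w)%:E)).
Local Notation mu := (@lebesgue_measure R).
Variables (Y : R -> T -> R) (tau : T -> R) (p : R -> R) (t C : R) (G H : set (set T)).
Hypothesis cY : forall w, continuous (Y^~ w : R -> R).
Hypothesis Y0 : forall r w, 0 <= Y r w.
Hypothesis Gm : G `<=` measurable.
Hypothesis Hm : H `<=` measurable.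
Hypothesis GH : independent P G H.
Hypothesis tauG : measurable_wrt G tau.
Hypothesis aY : forall r, 0 <= r -> measurable_wrt H (Y r).
Hypothesis iY : forall r, 0 <= r -> integ (Y r).
Hypothesis tau_range : forall w, 0 <= tau w <= t.
Hypothesis p0 : forall s, 0 <= p s.
Hypothesis mp : measurable_fun (`[0, t] : set (measurableTypeR R)) (p : measurableTypeR R -> R).
Hypothesis law : forall A : set R, measurable A ->
  P (tau @^-1` A) = (\int[mu]_(s in `[0%R, t]) (p s * \1_A s)%:E)%E.
Let u r := \int[P]_w Y r w.
Hypothesis m_u : measurable_fun (`[0, t] : set (measurableTypeR R)) (u : measurableTypeR R -> R).
Hypothesis C0 : 0 <= C.
Hypothesis u_mod : forall s r, 0 <= s -> s <= t -> s <= r -> r <= s + 1 -> u r <= u s + C * (r - s).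

(** Times are rounded up, and not to the nearest grid point, because u is
    controlled at times later than those where it is known ([u_mod]). *)
Section Rounding.
Variable n : nat.
Let cell (k : nat) : set R := `[k%:R / n.+1%:R, k.+1%:R / n.+1%:R[%classic.
Let upper (k : nat) : R := k.+1%:R / n.+1%:R.
Let N := (Num.truncn (n.+1%:R * t)).+1.
Definition round_up (s : R) : R := (Num.truncn (n.+1%:R * s)).+1%:R / n.+1%:R.

Let n0 : 0 < n.+1%:R :> R. Proof. by rewrite ltr0n. Qed.

Let cellE k s : 0 <= s -> (s \in cell k) = (Num.truncn (n.+1%:R * s) == k).
Proof.
move=> s0; rewrite mem_setE in_itv /= truncn_eq ?mulr_ge0//.
by rewrite ler_pdivrMr// ltr_pdivlMr// (mulrC s).
Qed.

Lemma round_up_bounds s : 0 <= s -> s <= round_up s <= s + n.+1%:R^-1.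
Proof.
move=> s0; have := @truncn_itv R (n.+1%:R * s); rewrite mulr_ge0// => /(_ isT) /andP[h1 h2].
rewrite /round_up ler_pdivlMr// mulrC (ltW h2)/= ler_pdivrMr// mulrDl mulVf ?gt_eqF//.
by rewrite -[(Num.truncn _).+1%:R]natr1 lerD2r (mulrC s).
Qed.

Let sum_cells (f : nat -> R) s : 0 <= s <= t ->
  \sum_(k < N) \1_(cell k) s * f k = f (Num.truncn (n.+1%:R * s)).
Proof.
move=> /andP[s0 st]; set j := Num.truncn _.
have jN : (j < N)%N by rewrite ltnS le_truncn// ler_wpM2l.
rewrite (bigD1 (Ordinal jN))//= big1 => [|k kj].
  by rewrite addr0 indicE cellE// eqxx mul1r.
rewrite indicE cellE// -/j; have [jk|] := eqVneq j k; last by rewrite mul0r.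
by move: kj; rewrite -val_eqE /= jk eqxx.
Qed.

Let mcell k : measurable (cell k). Proof. exact: measurable_itv. Qed.

Let m_tau : measurable_fun setT tau.
Proof. exact: (measurable_wrt_fun Gm tauG). Qed.

Let m_ind k : measurable_fun setT (fun w => \1_(cell k) (tau w) : R).
Proof. by apply: measurableT_comp m_tau; exact: measurable_indic. Qed.

Let upper0 k : 0 <= upper k. Proof. by rewrite divr_ge0. Qed.

Let mY r : 0 <= r -> measurable_fun setT (Y r).
Proof. by move=> r0; exact: (measurable_wrt_fun Hm (aY r0)). Qed.

Let round_upE w : Y (round_up (tau w)) w = \sum_(k < N) \1_(cell k) (tau w) * Y (upper k) w.
Proof. by rewrite (sum_cells (fun k => Y (upper k) w)). Qed.

Lemma measurable_round_up : measurable_fun setT (fun w => Y (round_up (tau w)) w).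
Proof.
under eq_fun do rewrite round_upE.
by apply: measurable_sum => k; apply: measurable_funM => //; exact: mY.
Qed.

(** On a cell the rounded time is constant, so independence applies to the
    indicator of the cell and to one variable of the process. *)
Let expected_cell k : (\int[P]_w (\1_(cell k) (tau w) * Y (upper k) w)%:E =
  P (tau @^-1` cell k) * (u (upper k))%:E)%E.
Proof.
have i1 : integ (fun w => \1_(cell k) (tau w)).
  by apply: (@integrable_bounded _ _ _ P _ 1) => // w; rewrite indicE; case: (_ \in _); rewrite ?normr0 ?normr1.
have i2 := iY (upper0 k).
have i12 : integ (fun w => \1_(cell k) (tau w) * Y (upper k) w).
  apply: (integrable_dominated _ i2); first by apply: measurable_funM => //; exact: mY.
  move=> w; rewrite ger0_norm; last by rewrite mulr_ge0// indicE.
  by rewrite ler_piMl// indicE lern1 leq_b1.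
have a1 : measurable_wrt G (fun w => \1_(cell k) (tau w) : R).
  move=> _ [A mA <-]; apply: tauG; exists ((\1_(cell k) : R -> R) @^-1` A) => //.
  have mi : measurable_fun (setT : set (measurableTypeR R)) (\1_(cell k) : measurableTypeR R -> R).
    by apply: measurable_indic; exact: measurable_itv.
  by rewrite -[X in measurable X]setTI; exact: (mi measurableT A mA).
have E := Rintegral_independent Gm Hm GH a1 (aY (upper0 k)) i1 i2 i12.
rewrite -(fineK (integrable_fin_num measurableT i12)).
rewrite -[fine _]/(\int[P]_w (\1_(cell k) (tau w) * Y (upper k) w)) E EFinM; congr (_ * _)%E.
rewrite /Rintegral (fineK (integrable_fin_num measurableT i1)).
transitivity (\int[P]_w (\1_(tau @^-1` cell k) w)%:E)%E.
  by apply: eq_integral => w _; rewrite !indicE; congr ((_ : bool)%:R%:E); rewrite !mem_setE.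
by rewrite integral_indic// ?setIT// -[X in measurable X]setTI; exact: m_tau.
Qed.

Let u0 r : 0 <= u r. Proof. by apply: Rintegral_ge0. Qed.

Lemma expected_round_up : (\int[P]_w (Y (round_up (tau w)) w)%:E <=
  \int[mu]_(s in `[0%R, t]) (p s * u s)%:E + (C / n.+1%:R)%:E)%E.
Proof.
have i0 : 0 <= C / n.+1%:R by rewrite divr_ge0.
have mcell' k : measurable_fun (`[0, t] : set (measurableTypeR R)) (\1_(cell k) : measurableTypeR R -> R).
  by apply: measurable_funTS; apply: measurable_indic; exact: measurable_itv.
have ind0 k s : 0 <= \1_(cell k) s :> R by rewrite indicE.
have -> : (\int[P]_w (Y (round_up (tau w)) w)%:E =
    \sum_(k < N) \int[mu]_(s in `[0%R, t]) (p s * \1_(cell k) s * u (upper k))%:E)%E.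
  under eq_integral do rewrite round_upE -sumEFin.
  rewrite ge0_integral_sum//; last 2 first.
  - by move=> k; apply/measurable_EFinP; apply: measurable_funM => //; exact: mY.
  - by move=> k w _; rewrite lee_fin mulr_ge0.
  apply: eq_bigr => k _; rewrite expected_cell law// -ge0_integralZr//.
  - by apply/measurable_EFinP; apply: measurable_funM.
  - by move=> s _; rewrite lee_fin mulr_ge0.
  - by rewrite lee_fin.
apply: (@le_trans _ _ (\sum_(k < N) \int[mu]_(s in `[0%R, t])
    (\1_(cell k) s * (p s * (u s + C / n.+1%:R)))%:E)%E).
  apply: lee_sum => k _; apply: ge0_le_integral => //.
  - by move=> s _; rewrite lee_fin !mulr_ge0.
  - by apply/measurable_EFinP; apply: measurable_funM => //; apply: measurable_funM.
  - apply/measurable_EFinP; apply: measurable_funM => //; apply: measurable_funM => //.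
    exact: measurable_funD.
  move=> s; rewrite /= in_itv /= => /andP[s0 st]; rewrite lee_fin.
  rewrite indicE cellE//; case: eqVneq => [kE|_]; last by rewrite mulr0 !mul0r.
  rewrite mulr1 mul1r ler_wpM2l//.
  have /andP[r1 r2] := round_up_bounds s0.
  have E : upper k = round_up s by rewrite /upper /round_up kE.
  have n1 : n.+1%:R^-1 <= 1 :> R by rewrite invf_le1// ler1n.
  rewrite E; apply: le_trans (u_mod s0 st r1 _) _.
    by apply: le_trans r2 _; rewrite lerD2l.
  by rewrite lerD2l ler_wpM2l// lerBlDl.
rewrite -ge0_integral_sum//; last 2 first.
- move=> k; apply/measurable_EFinP; apply: measurable_funM => //; apply: measurable_funM => //.
  exact: measurable_funD.
- by move=> k s _; rewrite lee_fin mulr_ge0// mulr_ge0// addr_ge0.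
have -> : (\int[mu]_(s in `[0%R, t]) \sum_(k < N) (\1_(cell k) s * (p s * (u s + C / n.+1%:R)))%:E =
    \int[mu]_(s in `[0%R, t]) ((p s * u s)%:E + (p s * (C / n.+1%:R))%:E))%E.
  apply: eq_integral => s; rewrite inE /= in_itv /= => st; rewrite sumEFin.
  by rewrite (sum_cells (fun=> p s * (u s + C / n.+1%:R)))// mulrDr EFinD.
rewrite ge0_integralD//; last 4 first.
- by move=> s _; rewrite lee_fin mulr_ge0.
- by apply/measurable_EFinP; exact: measurable_funM.
- by move=> s _; rewrite lee_fin mulr_ge0.
- by apply/measurable_EFinP; exact: measurable_funM.
rewrite leeD2l//; under eq_integral do rewrite EFinM.
rewrite ge0_integralZr//; last 2 first.
- exact/measurable_EFinP.
- by move=> s _; rewrite lee_fin.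
have <- : P (tau @^-1` setT) = (\int[mu]_(s in `[0%R, t]) (p s)%:E)%E.
  by rewrite law//; apply: eq_integral => s _; rewrite indicE in_setT mulr1.
by rewrite preimage_setT probability_setT mul1e.
Qed.

End Rounding.

Lemma cvg_round_up s : 0 <= s -> round_up n s @[n --> \oo] --> s.
Proof.
move=> s0; have c1 : s + n.+1%:R^-1 @[n --> \oo] --> s.
  by rewrite -[X in _ --> X]addr0; apply: cvgD; [exact: cvg_cst|exact: cvg_harmonic].
by apply: squeeze_cvgr (cvg_cst s) c1; apply: nearW => n; exact: round_up_bounds.
Qed.

Lemma expectation_random_time :
  (\int[P]_w (Y (tau w) w)%:E <= \int[mu]_(s in `[0%R, t]) (p s * u s)%:E)%E.
Proof.
have E w : (Y (tau w) w)%:E = limn_einf (fun n => (Y (round_up n (tau w)) w)%:E).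
  apply/esym; apply: (cvg_limn_einf_sup _).1; apply: cvg_EFin; first exact: nearW.
  have /andP[t0 _] := tau_range w.
  exact: (cvg_comp _ _ (cvg_round_up t0) (@cY w (tau w))).
under eq_integral do rewrite E.
apply: le_trans (@fatou _ _ _ P _ measurableT _ _ _) _.
- by move=> n; apply/measurable_EFinP; exact: measurable_round_up.
- by move=> n w _; rewrite lee_fin.
rewrite limn_einf_lim; set I := (\int[mu]_(s in _) _)%E.
apply/lee_addgt0Pr => e e0.
apply: lime_le; first exact: is_cvg_einfs.
apply: nearW => m.
pose k := (m + Num.truncn (C / e))%N.
apply: (@le_trans _ _ (\int[P]_w (Y (round_up k (tau w)) w)%:E)%E).
  by apply: ereal_inf_lbound; exists k => //=; exact: leq_addr.
apply: le_trans (expected_round_up k) _; rewrite leeD2l// lee_fin.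
rewrite ler_pdivrMr ?ltr0n// mulrC -ler_pdivrMr//; apply/ltW.
apply: lt_le_trans (truncnS_gt _) _; by rewrite ler_nat ltnS leq_addl.
Qed.

End RandomTime.

(** * The mini-batch flow *)

Section GeneratedSigmaAlgebra.
Context {R : realType} {T I : Type} (D : set I) (Y : I -> T -> R).

Lemma measurable_wrt_generated i : D i -> measurable_wrt (sigma_generated D Y) (Y i).
Proof. by move=> Di A YA; apply: sub_sigma_algebra; exists i. Qed.

Lemma sigma_algebra_generated : sigma_algebra setT (sigma_generated D Y).
Proof. exact: smallest_sigma_algebra. Qed.

End GeneratedSigmaAlgebra.

Lemma sigma_generated_measurable {R : realType} {disp : measure_display} {T : measurableType disp}
    {I : Type} (D : set I) (Y : I -> T -> R) :
  (forall i, D i -> measurable_fun setT (Y i)) -> sigma_generated D Y `<=` measurable.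
Proof.
move=> mY; apply: smallest_sub; first exact: sigma_algebra_measurable.
by move=> _ [i Di [A mA <-]]; exact: mY.
Qed.

Section WeightedDescent.
Context {R : realType}.
Local Notation mu := (@lebesgue_measure R).
Variables (psi beta u : R -> R) (c K tau E : R).
Hypothesis cpsi : continuous psi.
Hypothesis psi01 : forall r, 0 <= psi r <= 1.
Hypothesis cbeta : continuous beta.
Hypothesis beta0 : forall r, 0 <= beta r.
Hypothesis c0 : 0 <= c.
Hypothesis K0 : 0 <= K.
Hypothesis u0 : forall r, 0 <= u r.
Hypothesis u_increase : forall s r, 0 <= s -> s <= r ->
  u r <= u s + K / 2 * (c * \int[mu]_(x in `[s, r]) beta x).
Variable t : R.
Hypothesis t0 : 0 <= t.
Hypothesis mu_ : measurable_fun (`[0, t] : set (measurableTypeR R)) (u : measurableTypeR R -> R).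

Let beta_mono r : 0 <= r -> r <= t ->
  \int[mu]_(x in `[0, r]) beta x <= \int[mu]_(x in `[0, t]) beta x.
Proof.
move=> r0 rt; rewrite (@integral_split _ beta 0 r t)// lerDl.
by apply: integral_itv_ge0 => x _; exact: beta0.
Qed.

Lemma integrable_weighted : mu.-integrable `[0, t] (fun r => (psi r * u r)%:E).
Proof.
pose M := u 0 + K / 2 * (c * \int[mu]_(r in `[0, t]) beta r).
apply: (@le_integrable _ _ _ mu _ _ _ (EFin \o cst M)) => //.
- apply/measurable_EFinP; apply: measurable_funM; last exact: mu_.
  by apply: measurable_funTS; exact: continuous_measurable_fun.
- move=> r; rewrite /= in_itv /= => /andP[r0 rt]; rewrite lee_fin.
  have /andP[p0 p1] := psi01 r.
  rewrite ger0_norm ?mulr_ge0//; apply: le_trans (ler_norm _).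
  apply: (@le_trans _ _ (u r)); first by rewrite ler_piMl.
  apply: le_trans (u_increase (lexx 0) r0) _; rewrite lerD2l ler_wpM2l ?divr_ge0//.
  by rewrite ler_wpM2l// beta_mono.
- by apply: continuous_integrable; exact: cst_continuous.
Qed.

(** Multiply the bound of u(t) by u(s) plus the noise accumulated over [s, t] by
    psi(s) and integrate in s. *)
Lemma last_value_le : (\int[mu]_(s in `[0, t]) psi s) * u t <=
  \int[mu]_(s in `[0, t]) (psi s * u s) +
  K / 2 * (c * \int[mu]_(r in `[0, t]) ((\int[mu]_(s in `[0, r]) psi s) * beta r)).
Proof.
pose I := \int[mu]_(r in `[0, t]) beta r.
pose tail s := I - \int[mu]_(r in `[0, Num.max 0 s]) beta r.
have ctail : continuous tail.
  by move=> s; apply: cvgB; [exact: cvg_cst|exact: (continuous_primitive cbeta)].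
have tailE s : 0 <= s -> s <= t -> tail s = \int[mu]_(r in `[s, t]) beta r.
  move=> s0 st; rewrite /tail /I max_r// (@integral_split _ beta 0 s t)//.
  by rewrite addrAC subrr add0r.
have ct : continuous (fun s => psi s * tail s) by exact: continuous_mulr.
have it : mu.-integrable `[0, t] (fun s => (K / 2 * c * (psi s * tail s))%:E).
  by apply: (@continuous_integrable _ (fun s => K / 2 * c * (psi s * tail s))); exact: continuous_scaler.
have -> : (\int[mu]_(s in `[0, t]) psi s) * u t = \int[mu]_(s in `[0, t]) (u t * psi s).
  by rewrite (integralZ_itv _ _ _ cpsi) mulrC.
have -> : \int[mu]_(r in `[0, t]) ((\int[mu]_(s in `[0, r]) psi s) * beta r) =
    \int[mu]_(s in `[0, t]) (psi s * tail s).
  rewrite -(integral_triangle cpsi cbeta t0).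
  by apply: eq_Rintegral => s; rewrite inE /= in_itv /= => /andP[s0 st]; rewrite tailE.
rewrite mulrA -(integralZ_itv _ _ _ ct) -(RintegralD _ integrable_weighted it)//.
apply: le_Rintegral => //.
- by apply: (@continuous_integrable _ (fun s => u t * psi s)); exact: continuous_scaler.
- exact: (integrableD _ integrable_weighted it).
- move=> s; rewrite /= in_itv /= => /andP[s0 st]; rewrite tailE//.
  have /andP[p0 _] := psi01 s.
  have := ler_wpM2l p0 (u_increase s0 st).
  by rewrite mulrC mulrDr; congr (_ <= _ + _); ring.
Qed.

End WeightedDescent.

Lemma integral_gt0_at_0 {R : realType} (p : R -> R) (t : R) : continuous p -> p 0 = 1 ->
  (forall r, 0 <= p r) -> 0 < t -> 0 < \int[@lebesgue_measure R]_(s in `[0, t]) p s.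
Proof.
move=> cp p01 p0 t0.
have /cvgrPdist_lt/(_ 2^-1)H := @cp 0.
have : \forall s \near (0 : R), `|p 0 - p s| < 2^-1 by apply: H; rewrite invr_gt0.
move=> /nbhs_ballP[e /= e0 He].
pose m := Num.min t (e / 2).
have m0 : 0 < m by rewrite lt_min t0 divr_gt0.
have mt : m <= t by rewrite ge_min lexx.
rewrite (@integral_split _ p 0 m t)// ?ltW//.
apply: ltr_pwDl; last by apply: integral_itv_ge0.
apply: (@lt_le_trans _ _ (2^-1 * (m - 0))); first by rewrite subr0 mulr_gt0// invr_gt0.
rewrite -(@integral_itv_cst _ 2^-1 0 m (ltW m0)).
apply: (@le_integral_itv _ (fun=> 2^-1) p 0 m (@cst_continuous _ _ _) cp) => s /andP[s0 sm].
have : `|p 0 - p s| < 2^-1.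
  apply: He; rewrite /ball /= sub0r normrN ger0_norm//; apply: le_lt_trans sm _.
  by apply: le_lt_trans (_ : e / 2 < e); [rewrite ge_min lexx orbT|lra].
by rewrite p01 => /ltr_normlW; lra.
Qed.

Lemma lebesgue_integral_vecE {R : realType} {d : nat} (t : R) (v v' : R -> 'cV[R]_d) :
  (forall r, 0 <= r -> r <= t -> v r = v' r) ->
  lebesgue_integral_vec t v = vector_integral 0 t v'.
Proof.
move=> vv; apply/matrixP => i j; rewrite !mxE; apply: eq_Rintegral => r.
by rewrite inE /= in_itv /= => /andP[r0 rt]; rewrite vv.
Qed.

Lemma enorm_sqrZ {R : realType} m n (a : R) (A : 'M[R]_(m, n)) :
  enorm (a *: A) ^+ 2 = a ^+ 2 * enorm A ^+ 2.
Proof.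
rewrite !frobenius_sqr mulr_sumr; apply: eq_bigr => i _.
by rewrite mulr_sumr; apply: eq_bigr => j _; rewrite mxE exprMn.
Qed.

Lemma half_sqdist_expansion {R : realType} {d : nat} (a v : 'cV[R]_d) :
  2^-1 * dot (a + v) (a + v) = 2^-1 * dot a a + dot a v + 1 / 2 * dot v v.
Proof. rewrite !dotDl !dotDr (dotC v a); lra. Qed.

Section MiniBatchFlow.
Context {R : realType} {disp : measure_display} {T : measurableType disp}.
Variables (P : probability T R) (F : R -> set (set T)).
Hypothesis hF : filtration F.
Context {d N : nat}.
Hypothesis hN : (0 < N)%N.
Variable B : R -> T -> 'cV[R]_d.
Hypothesis hB : brownian_motion P F B.
Variables (f_ : 'I_N -> 'cV[R]_d -> R) (L : R).
Hypothesis hC3 : forall i, Ck 3 (f_ i).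
Hypothesis hL : forall i, L_smooth L (f_ i).
Hypothesis hsigma : has_ubound (volatility_norms f_).
Variable xstar : 'cV[R]_d.
Hypothesis hxstar : forall x, average f_ xstar <= average f_ x.
Variable tau : R.
Hypothesis htau : 0 < tau.
Hypothesis hwqc : weakly_quasi_convex tau (average f_) xstar.
Variable h : R.
Hypothesis hh : 0 < h.
Variable psi : R -> R.
Hypothesis hpsi : adjustment_function psi.
Variable b : R -> R.
Hypothesis hb : batch_size_function b.
Variables (x0 : 'cV[R]_d) (X : R -> T -> 'cV[R]_d).
Hypothesis hX : mb_pgf_solution P F B f_ h psi b x0 X.
Local Notation integ X := (P.-integrable [set: T] (fun w => (X w)%:E)).
Local Notation mu := (@lebesgue_measure R).

Let f := average f_.
Let V := grad f.
Let Lv := Num.max 0 L.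
(* all functions of time are extended to negative times by their value at 0 *)
Let X' r w := X (Num.max 0 r) w.
Let psi' r := psi (Num.max 0 r).
Let beta r := psi' r ^+ 2 / b (Num.max 0 r).
Let c := h * d%:R * sigma_star2 f_.
Let kappa r := c * beta r.
Let g x := f x - f xstar.

Let max0 (r : R) : 0 <= Num.max 0 r. Proof. by rewrite le_max lexx. Qed.
Let X'E r : 0 <= r -> X' r = X r. Proof. by move=> r0; rewrite /X' max_r. Qed.
Let psi'E r : 0 <= r -> psi' r = psi r. Proof. by move=> r0; rewrite /psi' max_r. Qed.

Let smooth_f : L_smooth L f. Proof. exact: L_smooth_average. Qed.
Let diff_f x : differentiable f x. Proof. by have [] := smooth_f. Qed.
Let cf : continuous f. Proof. by move=> x; apply: differentiable_continuous; exact: diff_f. Qed.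
Let Lv0 : 0 <= Lv. Proof. exact: max0. Qed.
Let lV x y : enorm (V x - V y) <= Lv * enorm (x - y).
Proof.
have [_ lf] := smooth_f; apply: le_trans (lf x y) _.
by rewrite ler_wpM2r ?enorm_ge0// le_max lexx orbT.
Qed.
Let cV j : continuous (fun x => V x j 0). Proof. exact: continuous_grad_average. Qed.

(* in dimension zero every Lipschitz constant is allowed, even a negative one,
   but then the noise term vanishes *)
Let Lvc : Lv * c = L * c.
Proof.
rewrite /c; case: (posnP d) => d0.
  by have -> : d%:R = 0 :> R by [rewrite d0]; rewrite mulr0 mul0r !mulr0.
by rewrite /Lv max_r//; exact: (L_smooth_ge0 d0 smooth_f).
Qed.

Let cpsi : continuous psi'.
Proof. by apply: continuous_extension; apply: C1_nonneg_continuous; have [] := hpsi. Qed.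
Let psi01 r : 0 <= psi' r <= 1.
Proof. by have [_ p01 _ _] := hpsi; exact: p01. Qed.
Let b1 r : 1 <= b (Num.max 0 r). Proof. by have [_] := hb; apply. Qed.
Let b0 r : 0 < b (Num.max 0 r). Proof. exact: lt_le_trans (b1 r). Qed.
Let cbeta : continuous beta.
Proof.
apply: continuous_mulr; first exact: continuous_mulr.
have cb : continuous (fun r : R => b (Num.max 0 r)).
  by apply: continuous_extension; apply: C1_nonneg_continuous; have [] := hb.
by move=> r; apply: cvgV; [rewrite gt_eqF|exact: cb].
Qed.
Let ckappa : continuous kappa. Proof. exact: continuous_scaler. Qed.
Lemma beta_ge0 r : 0 <= beta r. Proof. by rewrite divr_ge0 ?sqr_ge0// ltW. Qed.

Lemma volatility_le x : enorm (sigmaMB f_ x) ^+ 2 <= d%:R * sigma_star2 f_.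
Proof.
apply: le_trans (frobenius_spectral _) _; rewrite ler_wpM2l//.
by apply: ub_le_sup => //; exists x.
Qed.

Lemma noise_cst_ge0 : 0 <= c.
Proof.
rewrite /c -mulrA; apply: mulr_ge0; first exact: ltW.
exact: (le_trans (sqr_ge0 _) (volatility_le 0)).
Qed.

Let vol r w := (psi r * Num.sqrt (h / b r)) *: sigmaMB f_ (X r w).
Let hH r w : 0 <= r -> enorm (vol r w) ^+ 2 <= kappa r.
Proof.
move=> r0; rewrite /vol enorm_sqrZ exprMn sqr_sqrtr; last first.
  by have := b0 r; rewrite max_r// => bb; rewrite divr_ge0// ltW.
have bb := b0 r; rewrite max_r// in bb.
have -> : kappa r = psi r ^+ 2 * (h / b r) * (d%:R * sigma_star2 f_).
  by rewrite /kappa /c /beta /psi' max_r//; ring.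
apply: ler_wpM2l (volatility_le _).
by rewrite mulr_ge0 ?sqr_ge0// divr_ge0// ltW.
Qed.

Let aX : adapted F X'.
Proof. by have [a _ _ _] := hX; move=> s s0; rewrite X'E//; exact: a. Qed.
Let cX w : continuous (fun r : R => X' r w).
Proof. by have [_ cp _ _] := hX; exact: (@continuous_extension R _ (fun r => X r w)). Qed.
Let X'0 : {ae P, forall w, X' 0 w = x0}.
Proof. by have [_ _ H _] := hX; rewrite X'E. Qed.
Let solX t : 0 <= t -> exists2 I : T -> 'cV[R]_d, is_ito_integral P F B t vol I &
  {ae P, forall w, X' t w = x0 + vector_integral 0 t (fun r => - psi' r *: V (X' r w)) + I w}.
Proof.
have [_ _ _ sol] := hX; move=> t0; have [I hI eI] := sol t t0; exists I; first exact: hI.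
have E w : lebesgue_integral_vec t (fun s => - psi s *: grad (average f_) (X s w)) =
    vector_integral 0 t (fun r => - psi' r *: V (X' r w)).
  by apply: lebesgue_integral_vecE => r r0 _; rewrite (psi'E r0) (X'E r0).
by apply: filterS eI => w ew; rewrite (X'E t0) -E; exact: ew.
Qed.

Let g0 x : 0 <= g x. Proof. by rewrite subr_ge0. Qed.
Let cg : continuous g. Proof. by apply: continuous_addr => //; exact: cst_continuous. Qed.
Let u r := \int[P]_w g (X' r w).
Lemma expected_gap_ge0 r : 0 <= u r. Proof. exact: Rintegral_ge0. Qed.
Lemma descent_gap x y : g y <= g x + dot (V x) (y - x) + Lv / 2 * dot (y - x) (y - x).
Proof. by have := descent_lemma x y diff_f lV; rewrite /g; lra. Qed.

Lemma integrable_gap t : 0 <= t -> integ (fun w => g (X' t w)).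
Proof.
exact: (@integrable_potential _ _ _ P F hF d B hB X' x0 V Lv psi' kappa vol aX cX X'0 cV Lv0 lV
  cpsi psi01 ckappa hH solX xstar g V Lv cg g0 descent_gap).
Qed.

Lemma potential_inequality s t : 0 <= s -> s <= t ->
  u t <= u s + Lv / 2 * (c * \int[mu]_(r in `[s, t]) beta r).
Proof.
move=> s0 st; rewrite -(integralZ_itv c s t cbeta).
have := @energy_inequality _ _ _ P F hF d B hB X' x0 V Lv psi' kappa vol aX cX X'0 cV Lv0 lV
  cpsi psi01 ckappa hH solX xstar g (fun=> 0) V Lv Lv Lv0 Lv0 cg (@cst_continuous _ _ 0) cV g0
  (fun=> lexx 0) lV descent_gap (fun x => dot_ge0 (V x)) s t s0 st.
apply: le_trans; rewrite lerDl; apply: integral_itv_ge0 => r _.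
by have /andP[p0 _] := psi01 r; rewrite mulr_ge0// Rintegral_ge0.
Qed.

Lemma measurable_expected_gap t : measurable_fun (`[0, t] : set (measurableTypeR R)) (u : measurableTypeR R -> R).
Proof.
apply: (@measurable_expectation _ _ _ P (fun r w => g (X' r w))) => // [w|r r0].
- by move=> r; apply: (@continuous_comp _ _ _ (fun r => X' r w) g); [exact: cX|exact: cg].
- by apply: integrable_measurable; exact: integrable_gap.
Qed.

Let Kpsi t := \int[mu]_(r in `[0, t]) (psi' r * u r).

Lemma integrable_weighted_gap t : mu.-integrable `[0, t] (fun r => (psi' r * u r)%:E).
Proof. exact: (integrable_weighted cpsi psi01 cbeta beta_ge0 noise_cst_ge0 Lv0 expected_gap_ge0 potential_inequality (@measurable_expected_gap t)). Qed.

Let half_sqdist x := 2^-1 * dot (x - xstar) (x - xstar).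

Lemma distance_inequality t : 0 <= t ->
  tau * Kpsi t <= half_sqdist x0 + 2^-1 * (c * \int[mu]_(r in `[0, t]) beta r).
Proof.
move=> t0; rewrite -(integralZ_itv c 0 t cbeta).
pose G (x : 'cV[R]_d) := x - xstar.
have ch : continuous half_sqdist by apply: continuous_scaler; exact: continuous_sqdist.
have cq : continuous (fun x => tau * g x) by exact: continuous_scaler.
have cG i : continuous (fun x => G x i 0).
  have -> : (fun x => G x i 0) = (fun x => x i 0 + (- xstar i 0)) by apply/funext => x; rewrite !mxE.
  by apply: continuous_addr; [exact: coord_continuous|exact: cst_continuous].
have h0 x : 0 <= half_sqdist x by rewrite mulr_ge0// ?dot_ge0.
have q0 x : 0 <= tau * g x by rewrite mulr_ge0// ltW.
have lG x y : enorm (G x - G y) <= 1 * enorm (x - y).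
  by rewrite mul1r /G opprB addrA subrK.
have dG x y : half_sqdist y <= half_sqdist x + dot (G x) (y - x) + 1 / 2 * dot (y - x) (y - x).
  have yE : y - xstar = G x + (y - x) by rewrite [RHS]addrC /G addrA subrK.
  by rewrite /half_sqdist yE half_sqdist_expansion.
have qGV x : tau * g x <= dot (G x) (V x) by rewrite dotC; exact: hwqc.
have := @energy_inequality _ _ _ P F hF d B hB X' x0 V Lv psi' kappa vol aX cX X'0 cV Lv0 lV
  cpsi psi01 ckappa hH solX xstar half_sqdist (fun x => tau * g x) G 1 1 ler01 ler01 ch cq cG h0
  q0 lG dG qGV 0 t (lexx 0) t0.
have -> : \int[P]_w half_sqdist (X' 0 w) = half_sqdist x0.
  have m0 : measurable_fun setT (fun w => half_sqdist (X' 0 w)).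
    apply: measurable_continuous_comp => // i.
    apply: (@measurable_wrt_fun R disp T (F 0)); [exact: filtration_sub_measurable|exact: aX].
  rewrite -(@ae_Rintegral _ _ _ P (fun=> half_sqdist x0))//.
    by rewrite Rintegral_cst//= probability_setT mulr1.
  by apply: filterS X'0 => w ->.
have -> : \int[mu]_(r in `[0, t]) (psi' r * \int[P]_w (tau * g (X' r w))) = tau * Kpsi t.
  rewrite /Kpsi -(RintegralZl _ _ (integrable_weighted_gap t))//.
  apply: eq_Rintegral => r; rewrite inE /= in_itv /= => /andP[r0 _].
  by rewrite (RintegralZl _ measurableT (integrable_gap r0)) mulrCA.
rewrite mul1r; apply: le_trans; rewrite lerDr; exact: Rintegral_ge0.
Qed.


Section Bounds.
Variable t : R.
Hypothesis ht : 0 < t.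
Let t0 : 0 <= t. Proof. exact: ltW. Qed.
Let I0 := \int[mu]_(s in `[0, t]) (psi s ^+ 2 / b s).
Let phi' r := \int[mu]_(s in `[0, r]) psi' s.

Lemma phi_extension r : phi psi r = phi' r.
Proof.
by apply: eq_Rintegral => s; rewrite inE /= in_itv /= => /andP[s0 _]; rewrite psi'E.
Qed.

Lemma phi_gt0 : 0 < phi' t.
Proof.
apply: integral_gt0_at_0 => // [|r]; last by have /andP[] := psi01 r.
by rewrite (psi'E (lexx 0)); have [_ _ _] := hpsi.
Qed.

Lemma integral_betaE : \int[mu]_(s in `[0, t]) beta s = I0.
Proof.
apply: eq_Rintegral => s; rewrite inE /= in_itv /= => /andP[s0 _].
by rewrite /beta psi'E// max_r.
Qed.

Lemma integral_phi_beta_extension : \int[mu]_(s in `[0, t]) (phi' (Num.max 0 s) * beta s) =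
  \int[mu]_(s in `[0, t]) (phi' s * beta s).
Proof.
by apply: eq_Rintegral => s; rewrite inE /= in_itv /= => /andP[s0 _]; rewrite max_r.
Qed.

Let E0 := enorm (x0 - xstar) ^+ 2.

Lemma weighted_gap_le : Kpsi t <= E0 / (2 * tau) + c / (2 * tau) * I0.
Proof.
have := distance_inequality t0; rewrite integral_betaE /half_sqdist -enorm_sqr -/E0.
have -> : 2^-1 * E0 + 2^-1 * (c * I0) = tau * (E0 / (2 * tau) + c / (2 * tau) * I0).
  by field; rewrite gt_eqF.
by rewrite (ler_pM2l htau).
Qed.

Lemma last_iterate_bound :
  ('E_P[(fun w => average f_ (X t w) - average f_ xstar)%R] <=
   (E0 / (2 * tau * phi psi t) + c / (2 * tau * phi psi t) *
    \int[mu]_(s in `[0, t]) ((L * tau * phi psi s + 1) * (psi s ^+ 2 / b s)))%:E)%E.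
Proof.
have -> : ('E_P[(fun w => average f_ (X t w) - average f_ xstar)%R] = (u t)%:E)%E.
  rewrite unlock /u (X'E t0) /Rintegral fineK; first by [].
  by have := integrable_fin_num measurableT (integrable_gap t0); rewrite (X'E t0).
pose J := \int[mu]_(s in `[0, t]) (phi' s * beta s).
have cpb : continuous (fun s : R => L * tau * (phi' (Num.max 0 s) * beta s)).
  by apply: continuous_scaler; apply: continuous_mulr => //; exact: continuous_primitive.
have -> : \int[mu]_(s in `[0, t]) ((L * tau * phi psi s + 1) * (psi s ^+ 2 / b s)) =
    L * tau * J + I0.
  transitivity (\int[mu]_(s in `[0, t]) (L * tau * (phi' (Num.max 0 s) * beta s) + beta s)).
    apply: eq_Rintegral => s; rewrite inE /= in_itv /= => /andP[s0 st].
    by rewrite phi_extension max_r// /beta psi'E// max_r//; ring.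
  rewrite (integralD_itv _ _ cpb cbeta) integral_betaE; congr (_ + _).
  rewrite integralZ_itv; last by apply: continuous_mulr => //; exact: continuous_primitive.
  by rewrite integral_phi_beta_extension.
rewrite lee_fin phi_extension; have p0 := phi_gt0.
rewrite -(ler_pM2l p0).
apply: le_trans (last_value_le cpsi psi01 cbeta beta_ge0 noise_cst_ge0 Lv0 expected_gap_ge0 potential_inequality t0 (@measurable_expected_gap t)) _.
rewrite -/(phi' t) -/(Kpsi t) -/J mulrA.
apply: (@le_trans _ _ (E0 / (2 * tau) + c / (2 * tau) * I0 + Lv / 2 * c * J)).
  by rewrite lerD2r; exact: weighted_gap_le.
have -> : Lv / 2 * c = L * c / 2 by rewrite -Lvc mulrAC.
rewrite le_eqVlt; apply/orP; left; apply/eqP.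
by field; rewrite !gt_eqF.
Qed.

Variable ttilde : {RV P >-> R}.
Hypothesis htt_range : forall w, 0 <= ttilde w <= t.
Hypothesis htt_density : has_density ttilde
     (fun s => if 0 <= s <= t then psi s / phi psi t else 0).
Hypothesis htt_indep : independent P (sigma_generated [set: unit] (fun _ => ttilde))
     (process_sigma_algebra X).

Lemma random_iterate_bound :
  ('E_P[(fun w => average f_ (X (ttilde w) w) - average f_ xstar)%R] <=
   (E0 / (2 * tau * phi psi t) + c / (2 * tau * phi psi t) * I0)%:E)%E.
Proof.
have p0 : 0 < phi psi t by rewrite phi_extension; exact: phi_gt0.
pose p s := psi' s / phi psi t.
have cgX w : continuous (fun r => g (X' r w)).
  by move=> r; apply: (@continuous_comp _ _ _ (fun r => X' r w) g); [exact: cX|exact: cg].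
have Gm : sigma_generated [set: unit] (fun _ => ttilde : T -> R) `<=` measurable.
  by apply: sigma_generated_measurable => _ _; exact: measurable_funP.
have mX r i : 0 <= r -> measurable_fun setT (fun w => X r w i 0).
  move=> r0; apply: (@measurable_wrt_fun R disp T (F r)); first exact: filtration_sub_measurable.
  by have [a _ _ _] := hX; exact: a.
have Hm : process_sigma_algebra X `<=` measurable.
  by apply: sigma_generated_measurable => -[r i] /= r0; exact: mX.
have aY r : 0 <= r -> measurable_wrt (process_sigma_algebra X) (fun w => g (X' r w)).
  move=> r0; apply: (@measurable_wrt_comp _ _ _ (sigma_algebra_generated _ _)) => // i.
  rewrite X'E//.
  exact: (@measurable_wrt_generated R T (R * 'I_d)%type [set p | 0 <= p.1] (fun p w => X p.1 w p.2 0) (r, i)).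
have pp s : 0 <= p s by have /andP[q0 _] := psi01 s; rewrite divr_ge0// ltW.
have mp : measurable_fun (`[0, t] : set (measurableTypeR R)) (p : measurableTypeR R -> R).
  apply: measurable_funM; last exact: measurable_cst.
  by apply: measurable_funTS; exact: continuous_measurable_fun.
have law A : measurable A -> P (ttilde @^-1` A) = (\int[mu]_(s in `[0%R, t]) (p s * \1_A s)%:E)%E.
  move=> mA; have := htt_density mA; rewrite /distribution /pushforward => ->.
  rewrite integral_mkcond [RHS]integral_mkcond; apply: eq_integral => s _.
  rewrite !patchE mem_setE in_itv /= indicE; case: (s \in A); last by case: ifP; rewrite ?mulr0.
  rewrite mulr1; case: ifP => //= /andP[s0 _].
  by rewrite /p psi'E.
have [q qt qmax] := @EVT_max R beta 0 (t + 1) (addr_ge0 t0 ler01) (continuous_subspaceT cbeta).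
have C1 : 0 <= Lv / 2 * c by rewrite mulr_ge0 ?noise_cst_ge0// divr_ge0.
have C0 : 0 <= Lv / 2 * c * beta q by rewrite mulr_ge0 ?beta_ge0.
have u_mod s r : 0 <= s -> s <= t -> s <= r -> r <= s + 1 -> u r <= u s + Lv / 2 * c * beta q * (r - s).
  move=> s0 st sr rs; apply: le_trans (potential_inequality s0 sr) _; rewrite lerD2l mulrA -[leRHS]mulrA.
  rewrite ler_wpM2l//; apply: integral_itv_le => // x /andP[sx xr].
  by apply: qmax; rewrite in_itv /= (le_trans s0)//= (le_trans xr)// (le_trans rs)// lerD2r.
have := @expectation_random_time _ _ _ P (fun r w => g (X' r w)) ttilde p t _ _ _ cgX
  (fun r w => g0 _) Gm Hm htt_indep (@measurable_wrt_generated _ _ _ setT (fun=> ttilde : T -> R) tt I)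
  aY integrable_gap htt_range pp mp law (@measurable_expected_gap t) C0 u_mod.
rewrite unlock.
have -> : (\int[P]_w (g (X' (ttilde w) w))%:E =
    \int[P]_w (average f_ (X (ttilde w) w) - average f_ xstar)%:E)%E.
  apply: eq_integral => w _; rewrite X'E//.
  by have /andP[] := htt_range w.
move=> /le_trans; apply.
have -> : (\int[mu]_(s in `[0%R, t]) (p s * u s)%:E = (Kpsi t / phi psi t)%:E)%E.
  transitivity (\int[mu]_(s in `[0%R, t]) ((phi psi t)^-1%:E * (psi' s * u s)%:E))%E.
    by apply: eq_integral => s _; rewrite -EFinM /p; congr EFin; ring.
  rewrite integralZl//; last exact: integrable_weighted_gap.
  rewrite mulrC EFinM /Kpsi /Rintegral fineK//.
  exact: (integrable_fin_num _ (integrable_weighted_gap t)).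
rewrite lee_fin ler_pdivrMr//; apply: le_trans weighted_gap_le _.
rewrite le_eqVlt; apply/orP; left; apply/eqP.
by field; rewrite !gt_eqF.
Qed.

End Bounds.

End MiniBatchFlow.

Theorem theorem2
  (R : realType) (disp : measure_display) (T : measurableType disp)
  (P : probability T R)
  (F : R -> set (set T)) (hF : filtration F)
  (d N : nat) (hN : (0 < N)%N)
  (B : R -> T -> 'cV[R]_d) (hB : brownian_motion P F B)
  (f_ : 'I_N -> 'cV[R]_d -> R) (L : R)
  (hC3 : forall i, Ck 3 (f_ i))
  (hD3 : forall i, bounded_third_derivative (f_ i))
  (hL : forall i, L_smooth L (f_ i))
  (hsigma : has_ubound (volatility_norms f_))
  (xstar : 'cV[R]_d) (hxstar : forall x, average f_ xstar <= average f_ x)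
  (tau : R) (htau : 0 < tau)
  (hwqc : weakly_quasi_convex tau (average f_) xstar)
  (h : R) (hh : 0 < h)
  (psi : R -> R) (hpsi : adjustment_function psi)
  (b : R -> R) (hb : batch_size_function b)
  (x0 : 'cV[R]_d)
  (X : R -> T -> 'cV[R]_d) (hX : mb_pgf_solution P F B f_ h psi b x0 X)
  (t : R) (ht : 0 < t)
  (ttilde : {RV P >-> R})
  (htt_range : forall w, 0 <= ttilde w <= t)
  (htt_density : has_density ttilde
     (fun s => if 0 <= s <= t then psi s / phi psi t else 0))
  (htt_indep : independent P (sigma_generated [set: unit] (fun _ => ttilde))
     (process_sigma_algebra X)) :
  ('E_P[(fun w => average f_ (X (ttilde w) w) - average f_ xstar)%R] <=
   (enorm (x0 - xstar) ^+ 2 / (2 * tau * phi psi t) +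
    h * d%:R * sigma_star2 f_ / (2 * tau * phi psi t) *
    \int[lebesgue_measure]_(s in `[0, t]) (psi s ^+ 2 / b s))%:E)%E
  /\
  ('E_P[(fun w => average f_ (X t w) - average f_ xstar)%R] <=
   (enorm (x0 - xstar) ^+ 2 / (2 * tau * phi psi t) +
    h * d%:R * sigma_star2 f_ / (2 * tau * phi psi t) *
    \int[lebesgue_measure]_(s in `[0, t])
      ((L * tau * phi psi s + 1) * (psi s ^+ 2 / b s)))%:E)%E.
Proof.
split.
  exact: (random_iterate_bound hF hN hB hC3 hL hsigma hxstar htau hwqc hh hpsi hb hX ht
    htt_range htt_density htt_indep).
exact: (last_iterate_bound hF hN hB hC3 hL hsigma hxstar htau hwqc hh hpsi hb hX ht).
Qed.
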